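(* Let $1<p<\infty$, $0<\lambda<1$, $w\in A_{p}$, and let $\overline{\mathcal{T}}$ be a sublinear operator satisfying $$|\overline{\mathcal{T}}f(x)|\leq C\int_{\mathbb{R}^{n}}\frac{|f(y)|}{|x-y|^{n}}\,dy,\qquad x\notin\operatorname{supp} f,$$ for any integrable function $f$ with compact support, with $C$ independent of $f$ and $x$. Then: (a) If $\overline{\mathcal{T}}$ is bounded on $L^{p}(w)$, then $\overline{\mathcal{T}}$ is bounded on $M_{p,\lambda}(w)$. (b) If $b\in BMO(\mathbb{R}^{n})$ and the commutator $\overline{\mathcal{T}}_{b}$ is bounded on $L^{p}(w)$, then $\overline{\mathcal{T}}_{b}$ is bounded on $M_{p,\lambda}(w)$.
   Context: An operator $N$ is sublinear if $|N(f+g)|\le|Nf|+|Ng|$ and $|N(cf)|=|c||Nf|$. For an operator $N$ acting on functions and a function $b$, the commutator is formally defined by $N_{b}f=[b,N]f=bN(f)-N(bf)$. $A_p$ denotes the Muckenhoupt class of weights on $\mathbb{R}^n$. For a weight $w$, $w(E)=\int_E w(x)\,dx$ and $\|f\|_{L^{p}(w)}=\left(\int_{\mathbb{R}^{n}}|f(x)|^{p}w(x)\,dx\right)^{1/p}$. $BMO(\mathbb{R}^n)$ is the space of $b$ with $\|b\|_{BMO}=\sup_B\frac1{|B|}\int_B|b(y)-b_B|\,dy<\infty$, $b_B=\frac1{|B|}\int_B b(y)\,dy$, the supremum over all balls. For $1\le p<\infty$ and $0<\lambda<1$, the weighted Morrey space $M_{p,\lambda}(w)$ consists of all $f$ with $$\|f\|_{M_{p,\lambda}(w)}=\sup_{B}\left(\frac{1}{w(B)^{\lambda}}\int_{B}|f(x)|^{p}w(x)\,dx\right)^{1/p}<\infty,$$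 the supremum being over all balls $B\subset\mathbb{R}^{n}$.
   Formalization: ''Bounded on M_{p,λ}(w)'' means: the extension by truncation, |Sf|=lim|T(f1_{B(0,k)})| a.e. and S=T a.e. on M∩L^p(w), is bounded. For nonlinear T the commutator is T((b(x)-b)f)(x); bT(f)-T(bf) is treated for linear T only. Read literally, both (a) and (b) fail. *)

(* Defs.v *)
From HB Require Import structures.
From mathcomp Require Import all_boot all_order all_algebra.
From mathcomp Require Import all_classical all_reals all_analysis.
From mathcomp Require Import measurable_realfun.

Set Implicit Arguments.
Unset Strict Implicit.
Unset Printing Implicit Defensive.

Import Order.TTheory GRing.Theory Num.Theory.
Import numFieldNormedType.Exports.

Local Open Scope classical_set_scope.
Local Open Scope ring_scope.

(* The product sigma-algebra of R^n, generated by the coordinates; it is the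
   Borel sigma-algebra. *)
Section measurable_rV.
Context {R : realType} {n : nat}.

Let coor : 'I_n -> 'rV[R]_n -> measurableTypeR R := fun i x => x ord0 i.

Let rV_set0 : g_sigma_preimage coor set0.
Proof. exact: sigma_algebra0. Qed.

Let rV_setC A : g_sigma_preimage coor A -> g_sigma_preimage coor (~` A).
Proof. exact: sigma_algebraC. Qed.

Let rV_bigcup (F : (set 'rV[R]_n)^nat) :
  (forall i, g_sigma_preimage coor (F i)) ->
  g_sigma_preimage coor (\bigcup_i (F i)).
Proof. exact: sigma_algebra_bigcup. Qed.

HB.instance Definition _ := @isMeasurable.Build default_measure_display
  'rV[R]_n (g_sigma_preimage coor) rV_set0 rV_setC rV_bigcup.

End measurable_rV.


Section lebesgue_rV.
Context {R : realType}.

Lemma measurable_coord n (i : 'I_n) :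
  measurable_fun [set: 'rV[R]_n] (fun x => x ord0 i : measurableTypeR R).
Proof.
move=> _ Y mY; rewrite setTI; apply: sub_sigma_algebra => /=.
rewrite -bigcup_seq/=; exists i => /=; first by rewrite mem_index_enum.
by exists Y => //; rewrite setTI.
Qed.

Lemma measurable_fun_rVP d (T : measurableType d) n (f : T -> 'rV[R]_n) :
  (forall i, measurable_fun [set: T] (fun t => f t ord0 i : measurableTypeR R)) ->
  measurable_fun [set: T] f.
Proof.
move=> mf; suff : (g_sigma_preimage
    (fun i t => f t ord0 i : measurableTypeR R)) `<=` measurable.
  rewrite (g_sigma_preimage_comp
    (fun i (x : 'rV[R]_n) => x ord0 i : measurableTypeR R) f) => H _ A mA.
  by apply: H; exists A.
apply: smallest_sub; first exact: sigma_algebra_measurable.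
case: n => [|n] in f mf *; first by rewrite big_ord0.
rewrite -bigcup_mkord_ord; apply: bigcup_sub => i Ii.
by move=> A [B mB <-]; exact: mf.
Qed.

Definition rV_cons n (p : measurableTypeR R * 'rV[R]_n) : 'rV[R]_n.+1 :=
  \row_i oapp (p.2 ord0) p.1 (unlift ord0 i).

Definition rV_uncons n (x : 'rV[R]_n.+1) : measurableTypeR R * 'rV[R]_n :=
  (x ord0 ord0, \row_i x ord0 (lift ord0 i)).

Lemma rV_consK n : cancel (@rV_cons n) (@rV_uncons n).
Proof.
move=> [a v]; rewrite /rV_uncons mxE unlift_none /=; congr pair.
by apply/rowP => i; rewrite !mxE liftK.
Qed.

Lemma rV_unconsK n : cancel (@rV_uncons n) (@rV_cons n).
Proof.
move=> x; apply/rowP => i; rewrite mxE.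
by case: unliftP => [j ->|->] /=; rewrite ?mxE.
Qed.

Lemma measurable_rV_cons n : measurable_fun setT (@rV_cons n).
Proof.
apply: measurable_fun_rVP => i; under eq_fun do rewrite mxE.
case: unliftP => [j _|_] /=; last exact: measurable_fst.
apply: (measurableT_comp (measurable_coord j)); exact: measurable_snd.
Qed.

Lemma measurable_rV_uncons n : measurable_fun setT (@rV_uncons n).
Proof.
apply/measurable_fun_pairP; split => /=; first exact: measurable_coord.
by apply: measurable_fun_rVP => i /=; under eq_fun do rewrite mxE;
  exact: measurable_coord.
Qed.

Section step.
Context {n : nat} (m : {sigma_finite_measure set 'rV[R]_n -> \bar R}).
Local Open Scope ereal_scope.

Definition lebesgue_rV_step : set 'rV[R]_n.+1 -> \bar R :=
  pushforward (@lebesgue_measure R \x m) (@rV_cons n).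

Let step0 : lebesgue_rV_step set0 = 0.
Proof. by rewrite /lebesgue_rV_step /pushforward preimage_set0 measure0. Qed.

Let step_ge0 A : 0 <= lebesgue_rV_step A.
Proof. exact: (measure_ge0 (@lebesgue_measure R \x m)). Qed.

Let step_additive : semi_sigma_additive lebesgue_rV_step.
Proof.
have mf := @measurable_rV_cons n.
move=> F mF tF mUF; rewrite /lebesgue_rV_step /pushforward preimage_bigcup.
apply: measure_semi_sigma_additive.
- by move=> k; rewrite -[X in measurable X]setTI; exact: mf.
- apply/trivIsetP => /= i j _ _ ij; rewrite -preimage_setI.
  by move/trivIsetP : tF => /(_ _ _ _ _ ij) ->//; rewrite preimage_set0.
- by rewrite -preimage_bigcup -[X in measurable X]setTI; exact: mf.
Qed.

HB.instance Definition _ := isMeasure.Build _ _ _ lebesgue_rV_step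
  step0 step_ge0 step_additive.

Let step_sigma_finite : sigma_finite setT lebesgue_rV_step.
Proof.
have /sigma_finiteP[F [TF ndF Foo]] := sigma_finiteT (@lebesgue_measure R).
have /sigma_finiteP[G [TG ndG Goo]] := sigma_finiteT m.
exists (fun k => @rV_uncons n @^-1` (F k `*` G k)).
  rewrite -preimage_bigcup (_ : \bigcup_k _ = setT) ?preimage_setT//.
  rewrite -setXTT TF TG predeqE => -[x y]; split => [[k _ [] ? ?]|].
    by split; exists k.
  move=> [/= [i _ Fix] [k _ Gky]]; exists (maxn i k) => //; split => /=.
    by move: x Fix; exact/subsetPset/ndF/leq_maxl.
  by move: y Gky; exact/subsetPset/ndG/leq_maxr.
move=> k; have [mF Fk] := Foo k; have [mG Gk] := Goo k; split.
  rewrite -[X in measurable X]setTI; apply: measurable_rV_uncons => //.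
  exact: measurableX.
rewrite /lebesgue_rV_step /pushforward -comp_preimage.
rewrite (_ : _ \o _ = id); last by apply/funext => p /=; rewrite rV_consK.
by rewrite preimage_id product_measure1E// lte_mul_pinfty// ge0_fin_numE.
Qed.

HB.instance Definition _ := Measure_isSigmaFinite.Build _ _ _ lebesgue_rV_step
  step_sigma_finite.

End step.

(* Lebesgue measure on R^n as the n-fold product of Lebesgue measure on R. *)
Fixpoint lebesgue_rV n : {sigma_finite_measure set 'rV[R]_n -> \bar R} :=
  if n is k.+1 then lebesgue_rV_step (lebesgue_rV k)
  else dirac (0 : 'rV[R]_0).

Lemma lebesgue_rV_box n (A : 'I_n -> set (measurableTypeR R)) :
  (forall i, measurable (A i)) ->
  lebesgue_rV n [set x | forall i, A i (x ord0 i)] =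
  (\big[mule/1]_i lebesgue_measure (A i))%E.
Proof.
elim: n => [|n IHn] in A * => mA.
  by rewrite big_ord0 /= diracE mem_set// => -[].
rewrite big_ord_recl -IHn; last by move=> i; exact: mA.
have mB : measurable [set x : 'rV[R]_n | forall i, A (lift ord0 i) (x ord0 i)].
  rewrite (_ : mkset _ = \bigcap_(i in [set: 'I_n])
      ((fun x : 'rV[R]_n => x ord0 i : measurableTypeR R) @^-1`
        A (lift ord0 i))).
    apply: fin_bigcap_measurable => // i _.
    by rewrite -[X in measurable X]setTI; exact: measurable_coord.
  by apply/seteqP; split => x /= Ax i; [move=> _; exact: Ax|exact: Ax].
rewrite -product_measure1E//= /lebesgue_rV_step /pushforward.
congr (_ \x _)%E; apply/seteqP; split => [[a v]|[a v] []] /=.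
  move=> H; split; first by have := H ord0; rewrite mxE unlift_none.
  by move=> i; have := H (lift ord0 i); rewrite mxE liftK.
by move=> A0 Av i; rewrite mxE; case: unliftP => [j ->|->] /=; [exact: Av|].
Qed.

End lebesgue_rV.

Section morrey.
Context {R : realType} {n : nat}.
Local Notation Rn := 'rV[R]_n.
Local Notation leb := (@lebesgue_rV R n).
Implicit Types (f g b w : Rn -> R) (B : set Rn) (p lam : R).

(* The library's norm on 'rV[R]_n is the sup norm. *)
Definition enorm (x : Rn) : R := Num.sqrt (\sum_i x ord0 i ^+ 2).

Definition eball (x : Rn) (r : R) : set Rn := [set y | enorm (x - y) < r].

Definition balls : set (set Rn) :=
  [set B | exists x r, 0 < r /\ B = eball x r].

Definition loc_integrable f : Prop :=
  measurable_fun setT f /\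
  forall B, balls B -> leb.-integrable B (EFin \o f).

Definition wmeasure w B : \bar R := (\int[leb]_(x in B) (w x)%:E)%E.

(* Positivity almost everywhere is part of being a weight here: as
   0 `^ (- s) = 0 in the library, the condition in Ap would not detect a zero
   set of positive measure. *)
Definition weight w : Prop :=
  [/\ forall x, 0 <= w x, {ae leb, forall x, 0 < w x} & loc_integrable w].

Definition Ap p w : Prop :=
  weight w /\
  exists K : R, forall B, balls B ->
    ((wmeasure w B / leb B) *
     (wmeasure (fun x => (w x `^ (- (p - 1)^-1))%R) B / leb B) `^ (p - 1)
       <= K%:E)%E.

Definition mean b B : R := fine (\int[leb]_(y in B) (b y)%:E / leb B)%E.

Definition bmo_norm b : \bar R :=
  ereal_sup [set (\int[leb]_(y in B) (`|b y - mean b B|)%:E / leb B)%E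
            | B in balls].

Definition BMO b : Prop := loc_integrable b /\ (bmo_norm b < +oo)%E.

Definition Lp_norm p w f : \bar R :=
  ((\int[leb]_x (`|f x| `^ p * w x)%:E) `^ p^-1)%E.

Definition morrey_norm p lam w f : \bar R :=
  ereal_sup
    [set (((\int[leb]_(x in B) (`|f x| `^ p * w x)%:E) /
            (wmeasure w B `^ lam)) `^ p^-1)%E
    | B in balls].

Definition space (N : (Rn -> R) -> \bar R) : set (Rn -> R) :=
  [set f | measurable_fun setT f /\ (N f < +oo)%E].

Definition bounded_on (N : (Rn -> R) -> \bar R)
    (T : (Rn -> R) -> (Rn -> R)) : Prop :=
  exists C : R, forall f, space N f ->
    measurable_fun setT (T f) /\ (N (T f) <= C%:E * N f)%E.

Definition sublinear_on (D : set (Rn -> R))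
    (T : (Rn -> R) -> (Rn -> R)) : Prop :=
  (forall f g x, D f -> D g ->
     `|T (fun y => f y + g y) x| <= `|T f x| + `|T g x|) /\
  (forall (c : R) f x, D f -> `|T (fun y => c * f y) x| = `|c| * `|T f x|).

Definition linear_on (D : set (Rn -> R))
    (T : (Rn -> R) -> (Rn -> R)) : Prop :=
  (forall f g x, D f -> D g -> T (fun y => f y + g y) x = T f x + T g x) /\
  (forall (c : R) f x, D f -> T (fun y => c * f y) x = c * T f x).

Definition measurable_functions : set (Rn -> R) :=
  [set f | measurable_fun setT f].

Definition supp f : set Rn := closure [set x | f x != 0].

Definition size_condition (T : (Rn -> R) -> (Rn -> R)) : Prop :=
  exists C : R, forall f,
    leb.-integrable setT (EFin \o f) -> compact (supp f) ->
    forall x, ~ supp f x ->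
    ((`|T f x|)%:E <= C%:E * \int[leb]_y (`|f y| / enorm (x - y) ^+ n)%:E)%E.

Definition commutator (T : (Rn -> R) -> (Rn -> R)) b : (Rn -> R) -> (Rn -> R) :=
  fun f x => b x * T f x - T (fun y => b y * f y) x.

(* The commutator formula b T(f) - T(b f) is meaningful for a sublinear T only
   formally, with the constant b(x) moved inside T; the result agrees with
   [commutator] when T is linear ([sublinear_commutatorE]).  Taking
   [commutator] literally for nonlinear T would make it depend on the sign of b:
   for the maximal operator and a constant b < 0 it gives 2 b T(f), not 0. *)
Definition sublinear_commutator (T : (Rn -> R) -> (Rn -> R)) b :
    (Rn -> R) -> (Rn -> R) :=
  fun f x => T (fun y => (b x - b y) * f y) x.

Lemma sublinear_commutatorE (T : (Rn -> R) -> (Rn -> R)) b f x :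
  linear_on measurable_functions T ->
  measurable_functions b -> measurable_functions f ->
  sublinear_commutator T b f x = commutator T b f x.
Proof.
move=> [TD TZ] mb mf.
have mbf : measurable_functions (fun y => b y * f y).
  exact: measurable_funM.
have mc (c : R) g : measurable_functions g ->
    measurable_functions (fun y => c * g y).
  by move=> mg; apply: measurable_funM.
rewrite /commutator -TZ// -mulN1r -TZ// -TD; [|exact: mc..].
by congr (T _ x); apply/funext => y; rewrite mulN1r mulrBl.
Qed.

Definition trunc f (k : nat) : Rn -> R :=
  fun y => f y * \1_(eball 0 k%:R) y.

(* An operator that is controlled on L^p(w) only has no prescribed values on
   M_{p,lam}(w) outside L^p(w).  Its boundedness on M_{p,lam}(w) is that of its
   extension by truncation, whose modulus is determined almost everywhere. *)
Definition bounded_on_morrey p lam w (T : (Rn -> R) -> (Rn -> R)) : Prop :=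
  exists S : (Rn -> R) -> (Rn -> R),
    [/\ sublinear_on (space (morrey_norm p lam w)) S,
        forall f, space (Lp_norm p w) f -> space (morrey_norm p lam w) f ->
          {ae leb, forall x, S f x = T f x},
        forall f, space (morrey_norm p lam w) f ->
          {ae leb, forall x,
            (fun k => `|T (trunc f k) x|) @ \oo --> `|S f x|}
      & bounded_on (morrey_norm p lam w) S].

End morrey.

(* Main.v *)
Require Import Defs.
From mathcomp Require Import all_boot all_order all_algebra.
From mathcomp Require Import all_classical all_reals all_analysis.
From mathcomp Require Import measurable_realfun ring lra.

(** Idea. A ball B(x0, r) splits f into the part f1 supported in B(x0, 2r), to
   which boundedness on L^p(w) applies, and the far part f2, for which the size
   condition gives a sum over the annuli around x0 of averages of |f|.  By
   Hoelder and A_p each average is at most a multiple of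
   ||f|| w(2^j B)^((lam - 1)/p); as A_p makes w doubling and reverse doubling,
   these numbers decrease geometrically in j and sum up to
   ||f|| w(B)^((lam - 1)/p).

   For the commutator the kernel has the extra factor
   |b(x) - b(y)| <= |b(x) - b_B| + |b(y) - b_B|, so one also needs
   int_B |b - b_B|^p w <= C w(B), and the same for the dual weight and exponent.
   This weighted John-Nirenberg inequality is proved directly by a stopping time
   on dyadic cubes: the cubes Q' of Q where |b_Q' - b_Q| first exceeds a multiple
   of the BMO norm fill at most half of Q, hence by A_p at most a fraction
   beta < 1 of the w-measure of Q, and one iterates.  Only the dyadic averages
   of b occur there; they converge to b almost everywhere along a subsequence,
   which follows from the pi-lambda theorem applied to the dyadic cubes.

   For f in the Morrey space the sequence |T (trunc f k) x| is Cauchy at every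
   x, by the size condition again, and its limit is the modulus of the
   extension of T. *)

Set Implicit Arguments.
Unset Strict Implicit.
Unset Printing Implicit Defensive.

Import Order.TTheory GRing.Theory Num.Theory.
Import numFieldNormedType.Exports.
Import HBSimple.

Local Open Scope classical_set_scope.
Local Open Scope ring_scope.

(** * Integrals of nonnegative functions *)

Section measurable_comp.
Context d (T : measurableType d) (R : realType) (D : set T).
Implicit Types f : T -> R.

(** The A_p condition enters only through [dual_weights], a product form symmetric under exchanging
    (p, w) with (q, s); doubling and the John-Nirenberg inequality are thus proved once and serve
    both weights. In the same way T and its commutator are one object, [kernel_op], whose multiplier
    has only to satisfy |kap x y| <= u x + v y with u and v adapted to each ball.

    The obstacle is that a Morrey function need not lie in L^p(w) nor have compact support, so the
    assumptions on T do not speak of it. The estimates are therefore made for functions vanishing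
    outside a ball about 0, with constants independent of its radius, and reach the whole space by
    Fatou's lemma. Sublinearity controls only | |T f| - |T g| |, which is why moduli and not values
    have limits.

    In the John-Nirenberg part the stopping time runs for finitely many generations, on conditional
    expectations of b. All sums stay finite, and a bound uniform in the number of generations passes
    to b itself, again by Fatou. *)

Lemma measurable_fun_norm f : measurable_fun D f ->
  measurable_fun D (fun x => `|f x|).
Proof. by move=> mf; apply: measurableT_comp => //; exact: normr_measurable. Qed.

Lemma measurable_fun_powRl p f : measurable_fun D f ->
  measurable_fun D (fun x => f x `^ p).
Proof.
by move=> mf; exact: (measurableT_comp (measurable_powR _) mf).
Qed.

Lemma measurable_fun_exp f : measurable_fun D f ->
  measurable_fun D (fun x => expR (f x)).
Proof. by move=> mf; exact: (measurableT_comp (@measurable_expR _) mf). Qed.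

End measurable_comp.

Ltac mfun := repeat first
  [ assumption
  | lazymatch goal with
    | |- measurable_fun _ (fun x => _ + - _) => apply: measurable_funB
    | |- measurable_fun _ (fun x => _ + _) => apply: measurable_funD
    | |- measurable_fun _ (fun x => _ * _) => apply: measurable_funM
    | |- measurable_fun _ (fun x => `|_|) => apply: measurable_fun_norm
    | |- measurable_fun _ (fun x => _ `^ _) => apply: measurable_fun_powRl
    | |- measurable_fun _ (fun x => expR _) => apply: measurable_fun_exp
    | |- measurable_fun _ (fun x => \1_ _ x) => apply: measurable_indic
    | |- measurable_fun _ (fun x => (_)%:E) => apply/measurable_EFinP
    | |- measurable_fun _ (\1_ _) => apply: measurable_indic
    end
  | exact: measurable_cst ].

Ltac mside := intros; first
  [ done
  | (rewrite lee_fin; by eauto)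
  | (apply/measurable_EFinP; apply: measurable_funTS; by mfun) ].

Section nonneg_integral.
Context d (T : measurableType d) (R : realType).
Variable mu : {measure set T -> \bar R}.
Implicit Types (E A B : set T) (f g w s : T -> R).
Local Notation I E f := (\int[mu]_(x in E) (f x)%:E)%E.

Lemma EFin_integral_ge0 E f : (forall x, 0 <= f x) -> (0 <= I E f)%E.
Proof. by move=> f0; apply: integral_ge0 => x _; rewrite lee_fin. Qed.

Lemma EFin_integral_le E f g : measurable E -> measurable_fun setT f ->
  measurable_fun setT g -> (forall x, 0 <= f x) -> (forall x, E x -> f x <= g x) ->
  (I E f <= I E g)%E.
Proof.
by move=> mE mf mg f0 fg; apply: ge0_le_integral; mside.
Qed.

Lemma EFin_integral_subset A B f : measurable A -> measurable B -> measurable_fun setT f ->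
  (forall x, 0 <= f x) -> A `<=` B -> (I A f <= I B f)%E.
Proof.
by move=> mA mB mf f0 AB; apply: ge0_subset_integral; mside.
Qed.

Lemma EFin_integralZ E f k : measurable E -> measurable_fun setT f -> (forall x, 0 <= f x) ->
  0 <= k -> (I E (fun x => k * f x)%R = k%:E * I E f)%E.
Proof.
move=> mE mf f0 k0; rewrite -ge0_integralZl_EFin//; mside.
Qed.

Lemma EFin_integralD E f g : measurable E -> measurable_fun setT f -> measurable_fun setT g ->
  (forall x, 0 <= f x) -> (forall x, 0 <= g x) ->
  (I E (fun x => f x + g x)%R = I E f + I E g)%E.
Proof.
move=> mE mf mg f0 g0; rewrite -ge0_integralD//; mside.
Qed.

Lemma EFin_integral_setU A B f : measurable A -> measurable B -> measurable_fun setT f ->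
  (forall x, 0 <= f x) -> [disjoint A & B] -> (I (A `|` B) f = I A f + I B f)%E.
Proof.
move=> mA mB mf f0 dAB; apply: ge0_integral_setU; mside.
Qed.

Lemma EFin_integral_cst E k : measurable E -> (I E (fun=> k) = k%:E * mu E)%E.
Proof. by move=> mE; rewrite -integral_cst. Qed.

Lemma EFin_integral_indic E f : measurable E -> (I E f = I setT (fun x => f x * \1_E x))%E.
Proof.
move=> mE; rewrite integral_mkcond; apply: eq_integral => x _.
by rewrite patchE indicE; case: (x \in E); rewrite ?mulr1 ?mulr0.
Qed.

Lemma powR_add_le p (a b : R) : 0 < p -> 0 <= a -> 0 <= b ->
  (a + b) `^ p <= 2 `^ p * (a `^ p + b `^ p).
Proof.
move=> p0 a0 b0.
wlog ab : a b a0 b0 / a <= b.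
  move=> h; have [ab|/ltW ba] := leP a b; first exact: h.
  by rewrite addrC (addrC (a `^ p)); exact: h.
apply: (@le_trans _ _ ((2 * b) `^ p)).
  by apply: ge0_ler_powR; rewrite ?nnegrE ?(ltW p0)//; lra.
by rewrite powRM// ler_wpM2l ?powR_ge0// lerDr powR_ge0.
Qed.

Lemma powR_invK p (a : R) : 0 < p -> 0 <= a -> (a `^ p^-1) `^ p = a.
Proof. by move=> p0 a0; rewrite -powRrM mulVf ?gt_eqF// powRr1. Qed.

(* The product of the two weights to the powers 1/p and 1/q is 1, so the usual
   Hoelder inequality for F w^(1/p) and G s^(1/q) has no weight on the left. *)
Lemma weighted_hoelder p q w s E f g :
  0 < p -> 0 < q -> p^-1 + q^-1 = 1 -> measurable E ->
  measurable_fun setT w -> measurable_fun setT s ->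
  (forall x, 0 <= w x) -> (forall x, 0 <= s x) ->
  {ae mu, forall x, w x `^ p^-1 * s x `^ q^-1 = 1} ->
  measurable_fun setT f -> measurable_fun setT g ->
  (forall x, 0 <= f x) -> (forall x, 0 <= g x) ->
  (I E (fun x => f x * g x)%R <=
    (I E (fun x => f x `^ p * w x)%R) `^ p^-1 *
    (I E (fun x => g x `^ q * s x)%R) `^ q^-1)%E.
Proof.
move=> p0 q0 pq mE mw ms w0 s0 ws mf mg f0 g0.
pose F x := f x * w x `^ p^-1 * \1_E x; pose G x := g x * s x `^ q^-1 * \1_E x.
have mF : measurable_fun setT F by rewrite /F; mfun.
have mG : measurable_fun setT G by rewrite /G; mfun.
have := hoelder mu mF mG p0 q0 pq.
rewrite Lnorm1 unlock.
have E1 : (\int[mu]_x `|(EFin \o (F \* G)%R) x| = I E (fun x => f x * g x)%R)%E.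
  rewrite (EFin_integral_indic _ mE); apply: ge0_ae_eq_integral => //.
  - by apply: measurableT_comp => //; apply/measurable_EFinP; apply: measurable_funM.
  - by mfun.
  - by move=> x _; rewrite lee_fin !mulr_ge0// indicE.
  - apply: filterS ws => x wsx _ /=; congr EFin.
    rewrite /F /G ger0_norm ?mulr_ge0 ?powR_ge0 ?indicE ?ler0n//.
    case: (x \in E); last by rewrite !mulr0.
    by rewrite !mulr1 mulrACA wsx mulr1.
have E2 (r : R) (h v : T -> R) : 0 < r -> (forall x, 0 <= h x) -> (forall x, 0 <= v x) ->
    (\int[mu]_x (`|(EFin \o (fun x => h x * v x `^ r^-1 * \1_E x)%R) x| `^ r) =
     I E (fun x => h x `^ r * v x)%R)%E.
  move=> r0 h0 v0; rewrite (EFin_integral_indic _ mE); apply: eq_integral => x _ /=.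
  rewrite ger0_norm ?mulr_ge0 ?powR_ge0//.
  have [|] := boolP (x \in E) => xE; rewrite indicE ?xE ?(negbTE xE) /= ?mulr1 ?mulr0.
    by rewrite powRM ?powR_ge0// -powRrM mulVf ?gt_eqF// powRr1.
  by rewrite powR0 // gt_eqF.
by rewrite E1 -(E2 _ _ _ p0 f0 w0) -(E2 _ _ _ q0 g0 s0).
Qed.

End nonneg_integral.

Section ae_limits.
Context d (T : measurableType d) (R : realType).
Variable mu : {measure set T -> \bar R}.
Local Notation I E f := (\int[mu]_(x in E) (f x)%:E)%E.

Lemma limn_einf_le (u : (\bar R)^nat) M :
  (forall k, u k <= M)%E -> (limn_einf u <= M)%E.
Proof.
move=> uM; rewrite limn_einf_lim; apply: lime_le; first exact: is_cvg_einfs.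
apply: nearW => k; apply: le_trans (uM k).
by apply: ereal_inf_lbound; exists k => /=.
Qed.

Lemma cvge0_le (u : (\bar R)^nat) (e : R) : u @ \oo --> 0%E -> 0 < e ->
  exists k, (u k <= e%:E)%E.
Proof.
move=> u0 e0; apply: contrapT => /forallNP hn.
have : (e%:E <= limn u)%E.
  apply: lime_ge; first by apply/cvg_ex; exists 0%E.
  by apply: nearW => k; have := hn k; move/negP; rewrite -ltNge => /ltW.
by rewrite (cvg_lim _ u0)// lee_fin leNgt e0.
Qed.

Lemma fatou_le (E : set T) (f : nat -> T -> R) (g : T -> R) M :
  measurable E -> (forall k, measurable_fun setT (f k)) -> measurable_fun setT g ->
  (forall k x, 0 <= f k x) -> (forall x, 0 <= g x) ->
  {ae mu, forall x, E x -> f ^~ x @ \oo --> g x} ->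
  (forall k, I E (f k) <= M)%E -> (I E g <= M)%E.
Proof.
move=> mE mf mg f0 g0 fg fM.
have mfE k : measurable_fun E (fun x => (f k x)%:E).
  by apply/measurable_EFinP; exact: measurable_funTS.
have h := fatou mu mE mfE (fun k x _ => f0 k x).
apply: le_trans (limn_einf_le fM); apply: le_trans h.
rewrite (@ge0_ae_eq_integral _ _ _ mu E (fun x => (g x)%:E)
  (fun x => limn_einf (fun k => (f k x)%:E)))//.
- by apply/measurable_EFinP; exact: measurable_funTS.
- rewrite /limn_einf; apply: measurableT_comp => //.
  apply: measurable_fun_limn_esup => k.
  by apply: measurableT_comp => //; exact: mfE.
- by move=> x _; rewrite lee_fin.
- move=> x Ex; rewrite limn_einf_lim; apply: lime_ge; first exact: is_cvg_einfs.
  by apply: nearW => k; apply: le_ereal_inf_tmp => _ [m /= _ <-]; rewrite lee_fin.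
- apply: filterS fg => x fgx Ex.
  have [-> //] : (limn_einf (fun k => (f k x)%:E) = (g x)%:E) *
                 (limn_esup (fun k => (f k x)%:E) = (g x)%:E).
  by apply: cvg_limn_einf_sup; apply: cvg_EFin; [exact: nearW|exact: fgx].
Qed.

(** The sum of the [f k] has finite integral, so it is finite almost everywhere, and the terms of a
    convergent series tend to 0. *)
Lemma ae_cvg_summable (E : set T) (f : nat -> T -> R) :
  measurable E -> (forall k, measurable_fun setT (f k)) ->
  (forall k x, 0 <= f k x) ->
  (forall k, I E (f k) <= (1 / (2 ^ k.+1)%:R)%:E)%E ->
  {ae mu, forall x, E x -> f ^~ x @ \oo --> (0 : R)}.
Proof.
move=> mE mf f0 fs.
have mfE k : measurable_fun E (fun x => (f k x)%:E).
  by apply/measurable_EFinP; exact: measurable_funTS.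
have f0E k x : E x -> (0 <= (f k x)%:E)%E by rewrite lee_fin.
pose S x := (\sum_(k <oo) (f k x)%:E)%E.
have S0 x : (0 <= S x)%E by apply: nneseries_ge0 => k _ _; rewrite lee_fin.
have iS : mu.-integrable E S.
  apply/integrableP; split; first by apply: ge0_emeasurable_sum => // k x Ex _; rewrite lee_fin.
  under eq_integral do rewrite gee0_abs//.
  rewrite /S integral_nneseries//.
  apply: (@le_lt_trans _ _ 1%E); last exact: ltry.
  apply: le_trans (epsilon_trick0 xpredT (@ler01 R)).
  by apply: lee_nneseries => k _; [move=> *; exact: EFin_integral_ge0|exact: fs].
apply: filterS (integrable_ae mE iS) => x + Ex => /(_ Ex) Sfin.
apply: cvg_series_cvg_0; apply: nondecreasing_is_cvgn.
  by apply: nondecreasing_series.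
exists (fine (S x)) => _ [m _ <-]; rewrite -lee_fin fineK// /series/= -sumEFin.
by apply: nneseries_lim_ge => k _ _; rewrite lee_fin.
Qed.

End ae_limits.

(** * Euclidean balls and cubes *)

Section euclidean.
Context {R : realType} {n : nat}.
Local Notation Rn := 'rV[R]_n.
Local Notation leb := (@lebesgue_rV R n).
Implicit Types (x y z : Rn) (r : R).

Lemma enorm_ge0 x : 0 <= enorm x.
Proof. exact: sqrtr_ge0. Qed.

Lemma enorm_sqr x : enorm x ^+ 2 = \sum_i x ord0 i ^+ 2.
Proof. by rewrite sqr_sqrtr// sumr_ge0// => i _; rewrite sqr_ge0. Qed.

Lemma enormN x : enorm (- x) = enorm x.
Proof. by rewrite /enorm; congr Num.sqrt; apply: eq_bigr => i _; rewrite mxE sqrrN. Qed.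

Lemma enormB x y : enorm (x - y) = enorm (y - x).
Proof. by rewrite -enormN opprB. Qed.

Lemma enorm0 : enorm (0 : Rn) = 0.
Proof.
by rewrite /enorm big1 ?sqrtr0// => i _; rewrite mxE expr0n.
Qed.

(** Lagrange's identity: the double sum of the squares of [a i * b j - a j * b i] is twice the
    difference of the two sides. *)
Lemma sum_cauchy_schwarz (I : finType) (a b : I -> R) :
  (\sum_i a i * b i) ^+ 2 <= (\sum_i a i ^+ 2) * (\sum_i b i ^+ 2).
Proof.
have h : 0 <= \sum_i \sum_j (a i * b j - a j * b i) ^+ 2.
  by apply: sumr_ge0 => i _; apply: sumr_ge0 => j _; rewrite sqr_ge0.
have e : \sum_i \sum_j (a i * b j - a j * b i) ^+ 2 =
    2 * ((\sum_i a i ^+ 2) * (\sum_i b i ^+ 2)) - 2 * (\sum_i a i * b i) ^+ 2.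
  have -> : 2 * ((\sum_i a i ^+ 2) * (\sum_i b i ^+ 2)) =
      \sum_i \sum_j (a i ^+ 2 * b j ^+ 2 + a j ^+ 2 * b i ^+ 2).
    rewrite [RHS](eq_bigr _ (fun i _ => big_split _ _ _ _ _)) big_split/=.
    rewrite [X in _ = _ + X]exchange_big/= -mulr2n mulr_natl.
    by rewrite big_distrlr.
  rewrite expr2 big_distrlr/= mulr_sumr -sumrB; apply: eq_bigr => i _.
  by rewrite mulr_sumr -sumrB; apply: eq_bigr => j _; ring.
by move: h; rewrite e; lra.
Qed.

Lemma enormD x y : enorm (x + y) <= enorm x + enorm y.
Proof.
have h0 : 0 <= enorm x + enorm y by rewrite addr_ge0 ?enorm_ge0.
rewrite -(@ler_pXn2r _ 2)// ?nnegrE ?enorm_ge0//.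
rewrite sqrrD !enorm_sqr.
have -> : \sum_i (x + y) ord0 i ^+ 2 =
    \sum_i x ord0 i ^+ 2 + (\sum_i x ord0 i * y ord0 i) *+ 2 + \sum_i y ord0 i ^+ 2.
  rewrite -sumrMnl -!big_split/=; apply: eq_bigr => i _.
  by rewrite mxE sqrrD.
rewrite lerD2r lerD2l lerMn2r/=.
rewrite (le_trans (ler_norm _))//.
rewrite -(@ler_pXn2r _ 2)// ?nnegrE ?mulr_ge0 ?enorm_ge0//.
rewrite -normrX ger0_norm ?sqr_ge0// exprMn !enorm_sqr.
exact: sum_cauchy_schwarz.
Qed.

Lemma enorm_triangle y x z : enorm (x - z) <= enorm (x - y) + enorm (y - z).
Proof. by rewrite (le_trans _ (enormD _ _))// addrA subrK. Qed.

Lemma coord_le_enorm x i : `|x ord0 i| <= enorm x.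
Proof.
rewrite -(@ler_pXn2r _ 2)// ?nnegrE ?enorm_ge0// enorm_sqr.
rewrite -normrX ger0_norm ?sqr_ge0// (bigD1 i)//= lerDl.
by rewrite sumr_ge0// => j _; rewrite sqr_ge0.
Qed.

Lemma enorm_le_sum x : enorm x <= \sum_i `|x ord0 i|.
Proof.
rewrite -(@ler_pXn2r _ 2)// ?nnegrE ?enorm_ge0 ?sumr_ge0// enorm_sqr.
pose K (u v : R) := 0 <= v /\ u <= v ^+ 2.
suff : K (\sum_i x ord0 i ^+ 2) (\sum_i `|x ord0 i|) by case.
apply: (big_ind2 K) => [|a b c e [b0 ab] [e0 ce]|i _]; rewrite /K.
- by rewrite expr0n.
- by split; [exact: addr_ge0|rewrite sqrrD; nra].
- by split=> //; rewrite -normrX ger0_norm ?sqr_ge0.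
Qed.

Lemma enorm_le_max x r : (forall i, `|x ord0 i| <= r) -> enorm x <= n%:R * r.
Proof.
move=> xr; rewrite (le_trans (enorm_le_sum x))//.
rewrite (le_trans (ler_sum _ (fun i _ => xr i)))//.
by rewrite sumr_const card_ord mulr_natl.
Qed.

Lemma measurable_enorm_sub x : measurable_fun setT (fun y : Rn => enorm (x - y)).
Proof.
apply: (measurableT_comp (f := @Num.sqrt R)).
  by apply: continuous_measurable_fun; exact: sqrt_continuous.
have -> : (fun y : Rn => \sum_i (x - y) ord0 i ^+ 2) =
    (fun y => \sum_i (x ord0 i - y ord0 i) ^+ 2).
  by apply/funext => y; apply: eq_bigr => i _; rewrite !mxE.
apply: measurable_sum => i; apply: measurable_funX; apply: measurable_funB => //.
exact: measurable_coord.
Qed.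

Lemma measurable_eball x r : measurable (eball x r).
Proof.
rewrite /eball -[X in measurable X]setTI.
have -> : [set y | enorm (x - y) < r] =
    (fun y : Rn => enorm (x - y)) @^-1` `]-oo, r[%classic.
  by apply/seteqP; split => y /=; rewrite in_itv.
exact: measurable_enorm_sub.
Qed.

Lemma eball_center x r : 0 < r -> eball x r x.
Proof. by rewrite /eball /= subrr enorm0. Qed.

Lemma eballE x r y : eball x r y = (enorm (x - y) < r) :> Prop.
Proof. by []. Qed.

Lemma eball_subset x y r s : enorm (y - x) + r <= s -> eball x r `<=` eball y s.
Proof.
move=> h z; rewrite !eballE => xz.
by rewrite (le_lt_trans (enorm_triangle x _ _))//; lra.
Qed.

Lemma eball_le x r s : r <= s -> eball x r `<=` eball x s.
Proof. by move=> rs y; rewrite !eballE => /lt_le_trans; exact. Qed.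

Lemma open_eball x r : open (eball x r).
Proof.
rewrite openE => y /= xy; apply/nbhs_ballP.
have n0 : 0 < n%:R + 1 :> R by rewrite ltr_wpDl.
(* Neighbourhoods are those of the sup norm, and [enorm] is at most n times it; n + 1 keeps the
   inequality strict and the denominator nonzero. *)
have d0 : 0 < (r - enorm (x - y)) / (n%:R + 1).
  by rewrite divr_gt0// subr_gt0.
exists ((r - enorm (x - y)) / (n%:R + 1)) => //= z [_ yz].
rewrite eballE (le_lt_trans (enorm_triangle y _ _))//.
have : enorm (y - z) <= n%:R * ((r - enorm (x - y)) / (n%:R + 1)).
  apply: enorm_le_max => i; rewrite !mxE; apply: ltW; exact: yz.
have : ((r - enorm (x - y)) / (n%:R + 1)) * (n%:R + 1) = r - enorm (x - y).
  by rewrite divfK// gt_eqF.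
rewrite mulrDr mulr1 mulrC; lra.
Qed.

Lemma compact_supp (f : Rn -> R) r : (forall x, ~ eball 0 r x -> f x = 0) ->
  compact (supp f).
Proof.
move=> fr.
pose K := [set v : Rn | forall i, v ord0 i \in `[(- r), r]].
have cK : compact K.
  apply: (@rV_compact _  _ (fun=> `[(- r), r]%classic)).
  by move=> _; exact: segment_compact.
apply: (subclosed_compact _ cK); first exact: closed_closure.
rewrite /supp closureE; apply: smallest_sub.
  by apply: compact_closed => //; exact: norm_hausdorff.
move=> v /= fv i; rewrite in_itv/= -ler_norml.
have : eball 0 r v by apply: contrapT => /fr v0; rewrite v0 eqxx in fv.
rewrite eballE sub0r enormN => /ltW; apply: le_trans; exact: coord_le_enorm.
Qed.

Lemma notin_supp (f : Rn -> R) x r : 0 < r -> (forall y, eball x r y -> f y = 0) ->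
  ~ supp f x.
Proof.
move=> r0 fr /(_ (eball x r)) [].
  by apply: open_nbhs_nbhs; split; [exact: open_eball|exact: eball_center].
by move=> y [/= fy0 /fr fy]; rewrite fy eqxx in fy0.
Qed.

(** Half-open sides make the 2^n halves of a cube an exact partition, not one up to null sets. *)
Definition cube (a : Rn) (l : R) : set Rn :=
  [set x | forall i, a ord0 i <= x ord0 i < a ord0 i + l].

Lemma cubeE a l : cube a l =
  [set x | forall i, `[a ord0 i, (a ord0 i + l)[%classic (x ord0 i)].
Proof. by apply/seteqP; split => x /= h i; move: (h i); rewrite in_itv. Qed.

Lemma measurable_cube a l : measurable (cube a l).
Proof.
have -> : cube a l = \bigcap_(i in [set: 'I_n])
    ((fun x : Rn => x ord0 i : measurableTypeR R) @^-1`
        `[a ord0 i, (a ord0 i + l)[%classic).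
  apply/seteqP; split => x /= h i; first by move=> _; move: (h i); rewrite /= in_itv.
  by have := h i I; rewrite /= in_itv.
apply: fin_bigcap_measurable => // i _.
by rewrite -[X in measurable X]setTI; exact: measurable_coord.
Qed.

Lemma lebesgue_cube a l : 0 < l -> leb (cube a l) = (l ^+ n)%:E.
Proof.
move=> l0; rewrite cubeE.
rewrite (@lebesgue_rV_box R n (fun i => `[a ord0 i, (a ord0 i + l)[%classic))//.
under eq_bigr => i _.
  rewrite lebesgue_measure_itv/= lte_fin ltrDl l0 -EFinD addrC addKr.
  over.
by rewrite prodEFin prodr_const card_ord.
Qed.

Lemma eball_sub_cube x r : 0 < r -> eball x r `<=` cube (\row_i (x ord0 i - r)) (2 * r).
Proof.
move=> r0 y; rewrite eballE => xy i.
have := le_lt_trans (coord_le_enorm _ _) xy => /(_ i).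
by rewrite !mxE ltr_norml => /andP[? ?]; apply/andP; split; lra.
Qed.

Lemma cube_sub_eball x r : 0 < r ->
  cube (\row_i (x ord0 i - r / (2 * n%:R))) (r / n%:R) `<=` eball x r.
Proof.
move=> r0 y cy; rewrite eballE.
have [n0|n0] := posnP n.
  rewrite (le_lt_trans (enorm_le_sum _))// big1// => -[i Hi] _; exfalso.
  by move: Hi; rewrite [in X in (_ < X)%N]n0.
have n0' : 0 < n%:R :> R by rewrite ltr0n.
have : enorm (x - y) <= n%:R * (r / (2 * n%:R)).
  apply: enorm_le_max => i; have := cy i; rewrite !mxE => /andP[h1 h2].
  have e : r / n%:R = r / (2 * n%:R) + r / (2 * n%:R) by field; rewrite gt_eqF.
  by rewrite e in h2; rewrite ler_norml; lra.
have -> : n%:R * (r / (2 * n%:R)) = r / 2 by field; rewrite gt_eqF.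
by move=> h; rewrite (le_lt_trans h)//; lra.
Qed.

Lemma lebesgue_eball_le x r : 0 < r -> (leb (eball x r) <= ((2 * r) ^+ n)%:E)%E.
Proof.
move=> r0; rewrite -(lebesgue_cube (\row_i (x ord0 i - r))) ?mulr_gt0//.
apply: le_measure; rewrite ?inE; [exact: measurable_eball|exact: measurable_cube|].
exact: eball_sub_cube.
Qed.

Lemma lebesgue_eball_ge x r : (0 < n)%N -> 0 < r ->
  (((r / n%:R) ^+ n)%:E <= leb (eball x r))%E.
Proof.
move=> n0 r0; rewrite -(lebesgue_cube (\row_i (x ord0 i - r / (2 * n%:R)))).
  apply: le_measure; rewrite ?inE; [exact: measurable_cube|exact: measurable_eball|].
  exact: cube_sub_eball.
by rewrite divr_gt0// ltr0n.
Qed.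

End euclidean.

(** * Muckenhoupt weights *)

Section dual_weights.
Context {R : realType} {n : nat}.
Local Notation Rn := 'rV[R]_n.
Local Notation leb := (@lebesgue_rV R n).
Implicit Types (x y z : Rn) (p q r K : R) (w s f g : Rn -> R) (E Q : set Rn).

Lemma lebesgue_eball_lty x r : (leb (eball x r) < +oo)%E.
Proof.
have h : (leb (eball x (`|r| + 1)) < +oo)%E.
  have r1 : 0 < `|r| + 1 by rewrite ltr_wpDl.
  by rewrite (le_lt_trans (lebesgue_eball_le x r1)) ?ltry.
apply: le_lt_trans h; apply: le_measure; rewrite ?inE; try exact: measurable_eball.
by apply: eball_le; rewrite (le_trans (ler_norm _))// lerDl.
Qed.

(* For w in A_p this holds with q the conjugate exponent and s = w^(-1/(p-1));
   in this form the condition is symmetric in (p, w) and (q, s). *)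
Record dual_weights p q w s K : Prop := DualWeights {
  dw_p : 0 < p; dw_q : 0 < q; dw_pq : p^-1 + q^-1 = 1;
  dw_mw : measurable_fun setT w; dw_ms : measurable_fun setT s;
  dw_w0 : forall x, 0 <= w x; dw_s0 : forall x, 0 <= s x;
  dw_ae : {ae leb, forall x, w x `^ p^-1 * s x `^ q^-1 = 1};
  dw_finw : forall x r, (wmeasure w (eball x r) < +oo)%E;
  dw_fins : forall x r, (wmeasure s (eball x r) < +oo)%E;
  dw_K : 0 < K;
  dw_muck : forall x r, 0 < r ->
    (wmeasure w (eball x r) `^ p^-1 * wmeasure s (eball x r) `^ q^-1 <=
     K%:E * leb (eball x r))%E }.

Lemma dual_weights_sym p q w s K : dual_weights p q w s K ->
  dual_weights q p s w K.
Proof.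
move=> [p0 q0 pq mw ms w0 s0 ws fw fs K0 muck]; split => //.
- by rewrite addrC.
- by apply: filterS ws => x; rewrite mulrC.
- by move=> x r r0; rewrite muleC muck.
Qed.

(** The Hoelder inequality for f = g = 1. It is the counterpart of [dw_muck], which bounds the same
    product from above on balls. *)
Lemma lebesgue_le_dual p q w s E :
  0 < p -> 0 < q -> p^-1 + q^-1 = 1 -> measurable E ->
  measurable_fun setT w -> measurable_fun setT s ->
  (forall x, 0 <= w x) -> (forall x, 0 <= s x) ->
  {ae leb, forall x, w x `^ p^-1 * s x `^ q^-1 = 1} ->
  (leb E <= wmeasure w E `^ p^-1 * wmeasure s E `^ q^-1)%E.
Proof.
move=> p0 q0 pq mE mw ms w0 s0 ws.
have m1 : measurable_fun setT (fun _ : Rn => 1 : R) by exact: measurable_cst.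
have := weighted_hoelder p0 q0 pq mE mw ms w0 s0 ws
  m1 m1 (fun=> ler01) (fun=> ler01).
under eq_integral do rewrite mulr1.
rewrite EFin_integral_cst// mul1e => /le_trans; apply.
rewrite /wmeasure; under eq_integral do rewrite powR1 mul1r.
by under [X in (_ * X `^ _)%E]eq_integral do rewrite powR1 mul1r.
Qed.

Lemma lebesgue_eball_gt0 x r : (0 < n)%N -> 0 < r -> (0 < leb (eball x r))%E.
Proof.
move=> n0 r0; apply: lt_le_trans (lebesgue_eball_ge x n0 r0).
by rewrite lte_fin exprn_gt0// divr_gt0// ltr0n.
Qed.

(** Local integrability of the dual weight is not part of the definition of A_p: it comes out of the
    A_p bound once w(B) > 0 is known. *)
Lemma Ap_dual_weights p w : (0 < n)%N -> 1 < p -> Ap p w ->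
  exists K, dual_weights p (p / (p - 1)) w (fun x => w x `^ (- (p - 1)^-1)) K.
Proof.
move=> n0 p1 [[w0 wae [mw wloc]] [K Kmuck]].
have p0 : 0 < p by lra.
have p10 : 0 < p - 1 by lra.
have pE : (p / (p - 1))^-1 = (p - 1) / p by rewrite invf_div.
have pq : p^-1 + (p / (p - 1))^-1 = 1 by rewrite pE; field; rewrite gt_eqF.
have q0 : 0 < p / (p - 1) by rewrite divr_gt0.
set s := fun x => _.
have ms : measurable_fun setT s by rewrite /s; mfun.
have s0 x : 0 <= s x by exact: powR_ge0.
have ws : {ae leb, forall x, w x `^ p^-1 * s x `^ (p / (p - 1))^-1 = 1}.
  apply: filterS wae => x wx; rewrite /s -powRrM -powRD.
    suff -> : p^-1 + - (p - 1)^-1 * (p / (p - 1))^-1 = 0 by rewrite powRr0.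
    by rewrite pE; field; rewrite !gt_eqF.
  by apply/implyP => _; rewrite gt_eqF.
have wB x r : 0 < r -> exists a, 0 < a /\ wmeasure w (eball x r) = a%:E.
  move=> r0.
  have : wmeasure w (eball x r) \is a fin_num.
    have Bb : balls (eball x r) by exists x, r.
    by apply: integrable_fin_num (wloc _ Bb); exact: measurable_eball.
  have := lebesgue_le_dual p0 q0 pq (measurable_eball x r) mw ms w0 s0 ws.
  have := EFin_integral_ge0 leb (eball x r) w0; rewrite -/(wmeasure w (eball x r)).
  case: (wmeasure w _) => // a a0 hab _; exists a; split => //.
  rewrite lt_neqAle -lee_fin a0 andbT; apply/eqP => a00; move: hab; rewrite -a00.
  (* Since 0 times +oo is 0, w(B) = 0 forces B to be null even before s(B) is known to be finite. *)
  rewrite poweR0r ?invr_neq0 ?gt_eqF// mul0e.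
  by rewrite leNgt lebesgue_eball_gt0.
have sB x r : 0 < r -> exists a, 0 <= a /\ wmeasure s (eball x r) = a%:E.
  move=> r0; have [a [a0 wa]] := wB x r r0.
  have := Kmuck (eball x r) (ex_intro _ x (ex_intro _ r (conj r0 erefl))).
  have := lebesgue_eball_gt0 x n0 r0; have := lebesgue_eball_lty x r.
  rewrite wa; case: (leb (eball x r)) => // v _ v0.
  have := EFin_integral_ge0 leb (eball x r) s0; rewrite -/(wmeasure s (eball x r)).
  rewrite -/s.
  case: (wmeasure s _) => //; first by move=> b b0 _; exists b; split.
  (* If s(B) were infinite, the product in A_p would be a positive number times +oo and could not be
     bounded by K. *)
  move=> _; rewrite lte_fin in v0.
  rewrite inver gt_eqF// gt0_mulye ?lte_fin ?invr_gt0// poweRyr ?gt_eqF//.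
  by rewrite gt0_muley// -EFinM lte_fin divr_gt0.
exists (`|K| `^ p^-1 + 1); split => //.
- move=> x r; have [r0|r0] := ltP 0 r; first by have [a [_ ->]] := wB x r r0; rewrite ltry.
  suff -> : eball x r = set0 by rewrite /wmeasure integral_set0 ltry.
  by apply/seteqP; split => y //; rewrite eballE ltNge (le_trans r0)// enorm_ge0.
- move=> x r; have [r0|r0] := ltP 0 r; first by have [a [_ ->]] := sB x r r0; rewrite ltry.
  suff -> : eball x r = set0 by rewrite /wmeasure integral_set0 ltry.
  by apply/seteqP; split => y //; rewrite eballE ltNge (le_trans r0)// enorm_ge0.
- move=> x r r0; have [a [a0 wa]] := wB x r r0; have [b [b0 sb]] := sB x r r0.
  have := Kmuck (eball x r) (ex_intro _ x (ex_intro _ r (conj r0 erefl))).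
  have := lebesgue_eball_gt0 x n0 r0; have := lebesgue_eball_lty x r.
  rewrite -/s wa sb; case: (leb (eball x r)) => // v _; rewrite lte_fin => v0.
  rewrite inver gt_eqF// !poweR_EFin -!EFinM !lee_fin => h.
  (* The p-th root turns the exponents 1 and p - 1 into 1/p and 1/q; the volumes recombine through
     v^(1/p) v^(1/q) = v. *)
  have h1 : (a / v * (b / v) `^ (p - 1)) `^ p^-1 <= `|K| `^ p^-1.
    apply: ge0_ler_powR; rewrite ?invr_ge0 ?(ltW p0) ?nnegrE//.
      by rewrite mulr_ge0 ?powR_ge0// divr_ge0// ltW.
    by rewrite (le_trans h)// ler_norm.
  have v1 : v `^ p^-1 * v `^ (p / (p - 1))^-1 = v.
    by rewrite -powRD ?pq ?powRr1 ?(ltW v0)// oner_eq0.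
  have ha : a `^ p^-1 = (a / v) `^ p^-1 * v `^ p^-1.
    by rewrite -powRM ?divr_ge0 ?(ltW v0) ?(ltW a0)// divfK// gt_eqF.
  have hb : b `^ (p / (p - 1))^-1 = (b / v) `^ (p / (p - 1))^-1 * v `^ (p / (p - 1))^-1.
    by rewrite -powRM ?divr_ge0 ?(ltW v0)// divfK// gt_eqF.
  rewrite ha hb mulrACA v1 ler_wpM2r ?(ltW v0)//.
  rewrite (@le_trans _ _ (`|K| `^ p^-1)) ?lerDl//; apply: le_trans h1.
  rewrite pE [leRHS]powRM ?powR_ge0 ?divr_ge0 ?(ltW v0) ?(ltW a0)//.
  by rewrite -powRrM.
Qed.

End dual_weights.

(** * Doubling and reverse doubling of Muckenhoupt weights *)

Section doubling.
Context {R : realType} {n : nat}.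
Local Notation Rn := 'rV[R]_n.
Local Notation leb := (@lebesgue_rV R n).
Local Notation vol E := (fine (leb E)).
Local Notation wr w E := (fine (wmeasure w E)).
Variables (p q K : R) (w s : Rn -> R).
Hypothesis n0 : (0 < n)%N.
Hypothesis H : dual_weights p q w s K.
Implicit Types (x y z : Rn) (r : R) (E Q : set Rn).

Lemma lebesgue_sub_eball E x r : measurable E -> E `<=` eball x r ->
  leb E = (vol E)%:E.
Proof.
move=> mE EB; rewrite fineK// ge0_fin_numE//.
apply: le_lt_trans (lebesgue_eball_lty x r).
by apply: le_measure; rewrite ?inE//; exact: measurable_eball.
Qed.

Lemma wmeasure_sub_eball E x r : measurable E -> E `<=` eball x r ->
  wmeasure w E = (wr w E)%:E.
Proof.
move=> mE EB; rewrite fineK// ge0_fin_numE.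
  apply: le_lt_trans (dw_finw H x r); rewrite /wmeasure.
  by apply: EFin_integral_subset; [|exact: measurable_eball|exact: dw_mw H|exact: dw_w0 H|].
by apply: EFin_integral_ge0; exact: dw_w0 H.
Qed.

Lemma fine_wmeasure_ge0 E : 0 <= wr w E.
Proof. by apply: fine_ge0; apply: EFin_integral_ge0; exact: dw_w0 H. Qed.

Lemma fine_wmeasure_le E Q x r : measurable E -> measurable Q -> E `<=` Q ->
  Q `<=` eball x r -> wr w E <= wr w Q.
Proof.
move=> mE mQ EQ QB; rewrite -lee_fin -(wmeasure_sub_eball mQ QB).
rewrite -(wmeasure_sub_eball mE (subset_trans EQ QB)).
by apply: EFin_integral_subset => //; [exact: dw_mw H|exact: dw_w0 H].
Qed.

(** Chain |E| <= w(E)^(1/p) s(E)^(1/q) <= w(E)^(1/p) s(B)^(1/q), multiply by w(Q)^(1/p) <=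
    w(B)^(1/p) and apply A_p on B. With balls for E and Q this gives doubling; with a large part E
    of a cell Q it gives the A_infinity property. *)
Lemma vol_powR_le E Q x r : 0 < r -> measurable E -> measurable Q ->
  E `<=` eball x r -> Q `<=` eball x r ->
  vol E * wr w Q `^ p^-1 <= K * vol (eball x r) * wr w E `^ p^-1.
Proof.
move=> r0 mE mQ EB QB; set B := eball x r.
have mB : measurable B by exact: measurable_eball.
have Eh := lebesgue_le_dual (dw_p H) (dw_q H) (dw_pq H) mE (dw_mw H) (dw_ms H)
  (dw_w0 H) (dw_s0 H) (dw_ae H).
have pi : 0 <= p^-1 by rewrite invr_ge0 ltW// (dw_p H).
have qi : 0 <= q^-1 by rewrite invr_ge0 ltW// (dw_q H).
suff h : ((vol E)%:E * (wr w Q)%:E `^ p^-1 <=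
    K%:E * (vol B)%:E * (wr w E)%:E `^ p^-1)%E by rewrite -lee_fin; exact: h.
rewrite -(wmeasure_sub_eball mE EB).
rewrite -(wmeasure_sub_eball mQ QB) -(lebesgue_sub_eball mE EB).
rewrite -(lebesgue_sub_eball mB (@subset_refl _ B)).
have h1 : (wmeasure s E `^ q^-1 <= wmeasure s B `^ q^-1)%E.
  apply: gt0_ler_poweR => //; rewrite ?in_itv/= ?andbT ?leey ?EFin_integral_ge0//; try exact: dw_s0 H.
  by apply: EFin_integral_subset => //; [exact: dw_ms H|exact: dw_s0 H].
have h2 : (wmeasure w Q `^ p^-1 <= wmeasure w B `^ p^-1)%E.
  apply: gt0_ler_poweR => //; rewrite ?in_itv/= ?andbT ?leey ?EFin_integral_ge0//; try exact: dw_w0 H.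
  by apply: EFin_integral_subset => //; [exact: dw_mw H|exact: dw_w0 H].
apply: (@le_trans _ _ ((wmeasure w E `^ p^-1 * wmeasure s B `^ q^-1) * wmeasure w B `^ p^-1)%E).
  apply: lee_pmul => //; rewrite ?poweR_ge0//.
  apply: (le_trans Eh); apply: lee_pmul => //; rewrite ?poweR_ge0//.
rewrite -muleA muleC; apply: lee_wpmul2r; first exact: poweR_ge0.
by rewrite muleC (dw_muck H).
Qed.

Lemma vol_gt0 x r : 0 < r -> 0 < vol (eball x r).
Proof.
move=> r0; rewrite -lte_fin.
rewrite -(lebesgue_sub_eball (measurable_eball x r) (@subset_refl _ _)).
exact: lebesgue_eball_gt0.
Qed.

Lemma vol_le x r : 0 < r -> vol (eball x r) <= (2 * r) ^+ n.
Proof.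
move=> r0; rewrite -lee_fin.
rewrite -(lebesgue_sub_eball (measurable_eball x r) (@subset_refl _ _)).
exact: lebesgue_eball_le.
Qed.

Lemma vol_ge x r : 0 < r -> (r / n%:R) ^+ n <= vol (eball x r).
Proof.
move=> r0; rewrite -lee_fin.
rewrite -(lebesgue_sub_eball (measurable_eball x r) (@subset_refl _ _)).
exact: lebesgue_eball_ge.
Qed.

Lemma fine_wmeasure_eball_gt0 x r : 0 < r -> 0 < wr w (eball x r).
Proof.
move=> r0; rewrite lt_neqAle fine_wmeasure_ge0 andbT eq_sym; apply/eqP => w0.
have := lebesgue_le_dual (dw_p H) (dw_q H) (dw_pq H) (measurable_eball x r)
  (dw_mw H) (dw_ms H) (dw_w0 H) (dw_s0 H) (dw_ae H).
rewrite (wmeasure_sub_eball (measurable_eball x r) (@subset_refl _ _)) w0.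
rewrite poweR0r ?invr_neq0 ?gt_eqF ?(dw_p H)// mul0e leNgt.
by rewrite lebesgue_eball_gt0.
Qed.

Lemma doubling th : 0 < th -> exists D, 0 < D /\
  forall x r y t, 0 < t -> r <= th * t -> eball y t `<=` eball x r ->
    wr w (eball x r) <= D * wr w (eball y t).
Proof.
(* (2 th n)^n bounds the volume ratio of the two balls: (2 r)^n from the circumscribed cube over (t
   / n)^n from the inscribed one. *)
move=> th0; exists ((K * (2 * th * n%:R) ^+ n) `^ p).
have nR : 0 < n%:R :> R by rewrite ltr0n.
have pp := dw_p H.
have c0 : 0 < K * (2 * th * n%:R) ^+ n.
  by rewrite mulr_gt0 ?(dw_K H)// exprn_gt0// !mulr_gt0.
split; first by rewrite powR_gt0.
move=> x r y t t0 rt sub.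
have r0 : 0 < r.
  have : eball x r y by apply: sub; exact: eball_center.
  by rewrite eballE; apply: le_lt_trans; exact: enorm_ge0.
have mt := measurable_eball y t; have mr := measurable_eball x r.
have := vol_powR_le r0 mt mr sub (@subset_refl _ _).
set W := wr w _; set V := wr w _ => h.
have W0 : 0 <= W by exact: fine_wmeasure_ge0.
have V0 : 0 <= V by exact: fine_wmeasure_ge0.
have tn : 0 < (t / n%:R) ^+ n by rewrite exprn_gt0// divr_gt0.
have h1 : (t / n%:R) ^+ n * W `^ p^-1 <=
    (t / n%:R) ^+ n * ((K * (2 * th * n%:R) ^+ n) * V `^ p^-1).
  apply: (@le_trans _ _ (vol (eball y t) * W `^ p^-1)).
    by rewrite ler_wpM2r ?powR_ge0// vol_ge.
  apply: (le_trans h); rewrite mulrA ler_wpM2r ?powR_ge0//.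
  rewrite mulrCA -exprMn ler_wpM2l ?(ltW (dw_K H))//.
  rewrite (le_trans (vol_le _ r0))//.
  have -> : t / n%:R * (2 * th * n%:R) = 2 * (th * t) by field; rewrite gt_eqF.
  by rewrite lerXn2r ?nnegrE ?mulr_ge0 ?(ltW r0) ?(ltW th0) ?(ltW t0)// ler_pM2l.
have {h1} : W `^ p^-1 <= (K * (2 * th * n%:R) ^+ n) * V `^ p^-1.
  by rewrite -(ler_pM2l tn).
move=> /(@ge0_ler_powR _ p (ltW pp) _ _).
rewrite !nnegrE powR_ge0 mulr_ge0 ?powR_ge0 ?(ltW c0)// => /(_ isT isT).
rewrite (powR_invK pp W0) (powRM p (ltW c0) (powR_ge0 V p^-1)) (powR_invK pp V0).
exact: id.
Qed.

(** The shell between the two balls contains a ball of radius r / 2, centred at distance 3 r / 2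
    from x. By doubling it carries at least the fraction 1 / D of w(B(x, 2 r)), which B(x, r) has to
    miss. *)
Lemma reverse_doubling : exists rho, 0 < rho < 1 /\
  forall x r, 0 < r -> wr w (eball x r) <= rho * wr w (eball x (2 * r)).
Proof.
(* 4 is the ratio of the radii 2 r and r / 2. *)
have [D [D0 hD]] := @doubling 4 ltac:(lra).
have key x r : 0 < r -> wr w (eball x r) <= (1 - D^-1) * wr w (eball x (2 * r)).
  move=> r0; pose i0 := Ordinal n0.
  pose e : Rn := \row_i (if i == i0 then 3 / 2 * r else 0).
  have ee : enorm e = 3 / 2 * r.
    rewrite /enorm (bigD1 i0)//= big1 ?mxE ?eqxx ?addr0.
      by rewrite sqrtr_sqr ger0_norm//; lra.
    by move=> i /negbTE ii0; rewrite mxE ii0 expr0n.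
  have sub1 : eball (x - e) (r / 2) `<=` eball x (2 * r).
    by apply: eball_subset; rewrite opprB addrCA subrr addr0 ee; lra.
  have sub2 : eball x r `<=` eball x (2 * r) by apply: eball_le; lra.
  have dis : [disjoint eball x r & eball (x - e) (r / 2)].
    apply/disj_setPS => y []; rewrite !eballE => h1 h2.
    have := enorm_triangle y x (x - e).
    by rewrite (enormB y) opprB addrCA subrr addr0 ee; lra.
  have mB : measurable (eball x r) := measurable_eball _ _.
  have mE : measurable (eball (x - e) (r / 2)) := measurable_eball _ _.
  have m2 : measurable (eball x (2 * r)) := measurable_eball _ _.
  have h1 : wr w (eball x r) + wr w (eball (x - e) (r / 2)) <= wr w (eball x (2 * r)).
    rewrite -lee_fin EFinD -(wmeasure_sub_eball mB sub2) -(wmeasure_sub_eball mE sub1).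
    rewrite -(wmeasure_sub_eball m2 (@subset_refl _ _)) /wmeasure.
    rewrite -EFin_integral_setU//; [|exact: dw_mw H|exact: dw_w0 H].
    apply: EFin_integral_subset => //; [exact: measurableU|exact: dw_mw H|exact: dw_w0 H|].
    by rewrite subUset.
  have r20 : 0 < r / 2 by lra.
  have h2 : wr w (eball x (2 * r)) <= D * wr w (eball (x - e) (r / 2)).
    by apply: hD => //; lra.
  have : D^-1 * wr w (eball x (2 * r)) <= wr w (eball (x - e) (r / 2)).
    by rewrite ler_pdivrMl.
  lra.
exists (1 - D^-1); split => //.
(* Positivity of the factor is read off from [key] on one ball, both weights there being
   positive. *)
have /(key 0) := ltr01 : (0 : R) < 1.
have := fine_wmeasure_eball_gt0 0 (ltr01 : (0 : R) < 1).
have : 0 < wr w (eball 0 (2 * 1)) by apply: fine_wmeasure_eball_gt0; lra.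
have : 0 < D^-1 by rewrite invr_gt0.
set a := wr w _; set b := wr w _ => D1 b0 a0 h.
rewrite ltrBlDr ltrDl D1 andbT.
by rewrite -(pmulr_lgt0 _ b0); exact: lt_le_trans h.
Qed.

Lemma reverse_doubling_iter : exists rho, 0 < rho < 1 /\
  forall x r j, 0 < r -> wr w (eball x r) <= rho ^+ j * wr w (eball x (2 ^+ j * r)).
Proof.
have [rho [/andP[rho0 rho1] h]] := reverse_doubling.
exists rho; split; first by rewrite rho0.
move=> x r j r0; elim: j => [|j IH]; first by rewrite !expr0 !mul1r.
rewrite (le_trans IH)// exprSr -mulrA ler_wpM2l ?exprn_ge0 ?(ltW rho0)//.
by rewrite exprS -mulrA h// mulr_gt0// exprn_gt0.
Qed.

End doubling.

(** * Averages over a tree of cells *)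

Section average.
Context d (T : measurableType d) (R : realType).
Variable mu : {measure set T -> \bar R}.
Local Notation I E f := (\int[mu]_(x in E) (f x)%:E)%E.

(** For [leb] this is the same term as [mean], so that balls and cells share the lemmas below. *)
Definition average (b : T -> R) (E : set T) : R := fine (I E b / mu E)%E.

Lemma integrable_EFin_cst E k : measurable E -> (mu E < +oo)%E ->
  mu.-integrable E (fun=> k%:E).
Proof.
move=> mE Efin; apply/integrableP; split; first exact: measurable_cst.
rewrite (_ : (fun _ => _) = cst (`|k|%:E))//.
rewrite integral_cst// lte_mul_pinfty ?lee_fin//.
Qed.

(** The left side is the modulus of the integral of [b - c] over [E]. *)
Lemma average_dev b E c : measurable E -> (0 < mu E)%E -> (mu E < +oo)%E ->
  mu.-integrable E (EFin \o b) ->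
  ((`|average b E - c|)%:E * mu E <= I E (fun x => `|b x - c|)%R)%E.
Proof.
move=> mE E0 Efin ib.
have vE : mu E = (fine (mu E))%:E by rewrite fineK// ge0_fin_numE.
have v0 : 0 < fine (mu E) by rewrite -lte_fin -vE.
have iE : (I E b = (fine (I E b))%:E)%E by rewrite fineK//; exact: integrable_fin_num.
have ic : mu.-integrable E (EFin \o (fun=> c)) by exact: integrable_EFin_cst.
have h : (I E (fun x => b x - c)%R = ((average b E - c)%R)%:E * mu E)%E.
  rewrite (_ : (I E (fun x => b x - c)%R = \int[mu]_(x in E) ((b x)%:E - ((fun=> c) x)%:E))%E)//.
  rewrite integralB_EFin// integral_cst// /average iE vE inver gt_eqF//=.
  rewrite -!EFinM -EFinB; congr EFin; rewrite /= mulrBl divfK// gt_eqF//.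
have -> : ((`|average b E - c|)%:E * mu E = `|I E (fun x => b x - c)%R|)%E.
  by rewrite h abseM (gee0_abs (ltW E0)).
apply: (le_trans (le_abse_integral mu mE _)) => //.
case/integrableP : ib => mb _.
apply/measurable_EFinP; apply: measurable_funB => //.
exact/measurable_EFinP.
Qed.

End average.

(** * The stopping time: exponential integrability of conditional expectations *)

Section tree.
Context d (T : measurableType d) (R : realType).
Variable mu : {measure set T -> \bar R}.
Variables (I : finType) (node : Type) (dom : node -> set T) (ch : node -> I -> node).
Local Notation IN E f := (\int[mu]_(x in E) (f x)%:E)%E.
Hypothesis mdom : forall q, measurable (dom q).
Hypothesis dom_ch : forall q, dom q = \big[setU/set0]_(i : I) dom (ch q i).
Hypothesis tdom : forall q, trivIset setT (fun i => dom (ch q i)).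

Lemma dom_ch_sub q i : dom (ch q i) `<=` dom q.
Proof. by rewrite (dom_ch q) -bigcup_seq => x ?; exists i => //=; rewrite mem_index_enum. Qed.

Lemma integral_pieces q (F : I -> set T) (f : T -> R) :
  (forall i, measurable (F i)) -> (forall i, F i `<=` dom (ch q i)) ->
  measurable_fun setT f -> (forall x, 0 <= f x) ->
  (IN (\big[setU/set0]_(i : I) F i) f = \sum_(i : I) IN (F i) f)%E.
Proof.
move=> mF Fsub mf f0; rewrite ge0_integral_bigsetU//.
- exact: index_enum_uniq.
- apply/trivIsetP => i j _ _ ij.
  have /trivIsetP/(_ _ _ Logic.I Logic.I ij) h := @tdom q.
  by rewrite -subset0 => x [/Fsub xi /Fsub xj]; rewrite -h.
- by apply/measurable_EFinP; exact: measurable_funTS.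
- by move=> x _; rewrite lee_fin.
Qed.

Lemma integral_children q (f : T -> R) :
  measurable_fun setT f -> (forall x, 0 <= f x) ->
  (IN (dom q) f = \sum_(i : I) IN (dom (ch q i)) f)%E.
Proof.
move=> mf f0; rewrite {1}(dom_ch q); by apply: (@integral_pieces q) => // i; exact: subset_refl.
Qed.

Variable b : T -> R.

(** On [dom q], the conditional expectation of [b] given the cells m generations below [q]. *)
Fixpoint cond_exp (m : nat) (q : node) : T -> R :=
  if m is k.+1 then fun x => \sum_(i : I) \1_(dom (ch q i)) x * cond_exp k (ch q i) x
  else fun=> average mu b (dom q).

Lemma measurable_cond_exp m q : measurable_fun setT (cond_exp m q).
Proof.
elim: m q => [|m IH] q /=; first exact: measurable_cst.
apply: measurable_sum => i; apply: measurable_funM; last exact: IH.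
exact: measurable_indic.
Qed.

Lemma cond_expS m q i x : dom (ch q i) x ->
  cond_exp m.+1 q x = cond_exp m (ch q i) x.
Proof.
move=> xi /=; rewrite (bigD1 i)//= indicE mem_set// mul1r big1 ?addr0// => j ji.
rewrite indicE memNset ?mul0r// => xj.
have /trivIsetP/(_ _ _ Logic.I Logic.I ji)/seteqP[+ _] := @tdom q.
by move/(_ x); apply.
Qed.

Variable w : T -> R.
Hypotheses (mw : measurable_fun setT w) (w0 : forall x, 0 <= w x).
Hypothesis mb : measurable_fun setT b.
Hypothesis ib : forall q, mu.-integrable (dom q) (EFin \o b).
Hypothesis dom_gt0 : forall q, (0 < mu (dom q))%E.
Hypothesis dom_fin : forall q, (mu (dom q) < +oo)%E.
Variables (N D be c : R).
Hypotheses (N0 : 0 < N) (D0 : 0 < D) (be0 : 0 <= be) (c0 : 0 <= c).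
Hypothesis bmo : forall q,
  (IN (dom q) (fun x => `|b x - average mu b (dom q)|)%R <= N%:E * mu (dom q))%E.
Hypothesis size_ch : forall q i, (mu (dom q) <= D%:E * mu (dom (ch q i)))%E.
Hypothesis Ainf : forall q E, measurable E -> E `<=` dom q ->
  (2%:E * mu E <= mu (dom q))%E -> (IN E w <= be%:E * IN (dom q) w)%E.

Local Notation A q := (average mu b (dom q)).
(** By Chebyshev the threshold 2 N leaves at most half of a cell to the stopped cells. [jump] bounds
    the change of the average from a cell to a child: the deviation N is diluted by the volume ratio
    D. *)
Let lam := 2 * N.
Let jump := D * N.

(* The union of the maximal cells below q, within m generations, on which the
   average of b is further than lam from v. *)
Fixpoint stopped (m : nat) (q : node) (v : R) : set T :=
  if m is k.+1 then
    \big[setU/set0]_(i : I)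
      (if lam < `|A (ch q i) - v| then dom (ch q i) else stopped k (ch q i) v)
  else set0.

Let stop_piece m q v i :=
  if lam < `|A (ch q i) - v| then dom (ch q i) else stopped m (ch q i) v.

Lemma measurable_stopped m q v : measurable (stopped m q v).
Proof.
elim: m q => [|m IH] q //=; apply: bigsetU_measurable => i _.
by case: ifP.
Qed.

Lemma stopped_sub m q v : stopped m q v `<=` dom q.
Proof.
elim: m q => [|m IH] q //=; rewrite (dom_ch q) -!bigcup_seq.
apply: subset_bigcup => i _; by case: ifP => _; [exact: subset_refl|exact: IH].
Qed.

Lemma measurable_stop_piece m q v i : measurable (stop_piece m q v i).
Proof. by rewrite /stop_piece; case: ifP => // _; exact: measurable_stopped. Qed.

Lemma stop_piece_sub m q v i : stop_piece m q v i `<=` dom (ch q i).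
Proof. by rewrite /stop_piece; case: ifP => _; [exact: subset_refl|exact: stopped_sub]. Qed.

Lemma integral_stoppedS m q v (f : T -> R) : measurable_fun setT f -> (forall x, 0 <= f x) ->
  (IN (stopped m.+1 q v) f = \sum_(i : I) IN (stop_piece m q v i) f)%E.
Proof.
move=> mf f0; apply: (@integral_pieces q) => //.
  by move=> i; exact: measurable_stop_piece.
by move=> i; exact: stop_piece_sub.
Qed.

Let mdev v : measurable_fun setT (fun x => `|b x - v|).
Proof. by mfun. Qed.

(** Chebyshev's inequality on each maximal cell, where the average is further than [lam] from [v].
    The value [v] is arbitrary because it stays that of the root while the recursion descends. *)
Lemma stopped_le m q v :
  (lam%:E * mu (stopped m q v) <= IN (stopped m q v) (fun x => `|b x - v|)%R)%E.
Proof.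
have lam0 : 0 <= lam by rewrite mulr_ge0// ltW.
elim: m q => [|m IH] q; first by rewrite /= measure0 mule0 integral_set0.
have -> : mu (stopped m.+1 q v) = (IN (stopped m.+1 q v) (fun=> 1%R))%E.
  by rewrite EFin_integral_cst ?mul1e//; exact: measurable_stopped.
rewrite integral_stoppedS// integral_stoppedS// ge0_sume_distrr; last first.
  by move=> i _; exact: EFin_integral_ge0.
apply: lee_sum => i _; rewrite EFin_integral_cst ?mul1e; last exact: measurable_stop_piece.
rewrite /stop_piece; case: ifP => [h|_]; last exact: IH.
apply: le_trans (average_dev v _ _ _ _) => //.
by apply: lee_wpmul2r => //; rewrite lee_fin ltW.
Qed.

Lemma stopped_half m q : (2%:E * mu (stopped m q (A q)) <= mu (dom q))%E.
Proof.
have h := stopped_le m q (A q).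
have : (lam%:E * mu (stopped m q (A q)) <= N%:E * mu (dom q))%E.
  apply: (le_trans h); apply: le_trans (bmo q).
  by apply: EFin_integral_subset => //; [exact: measurable_stopped|exact: stopped_sub].
by rewrite /lam mulrC EFinM -muleA lee_pmul2l.
Qed.

Lemma average_jump q i : `|A (ch q i) - A q| <= jump.
Proof.
have := average_dev (A q) (mdom (ch q i)) (dom_gt0 _) (dom_fin _) (ib _).
move=> /le_trans/(_ (EFin_integral_subset mu (mdom (ch q i)) (mdom q)
  (mdev (A q)) _ (@dom_ch_sub q i)))-/(_ (fun=> normr_ge0 _)).
move=> /le_trans/(_ (bmo q)) /le_trans.
have : (N%:E * mu (dom q) <= jump%:E * mu (dom (ch q i)))%E.
  by rewrite /jump mulrC EFinM -muleA lee_pmul2l.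
move=> /[swap] /[apply].
by rewrite lee_pmul2r ?lee_fin// ge0_fin_numE.
Qed.

Local Notation X m q v :=
  (IN (dom q) (fun x => expR (c * `|cond_exp m q x - v|) * w x)%R).
Let X_mf m q v : measurable_fun setT (fun x => expR (c * `|cond_exp m q x - v|) * w x).
Proof. by mfun; exact: measurable_cond_exp. Qed.
Let X_f0 m q v x : 0 <= expR (c * `|cond_exp m q x - v|) * w x.
Proof. by rewrite mulr_ge0// expR_ge0. Qed.

Lemma exp_integralS m q v : (X m.+1 q v = \sum_(i : I) X m (ch q i) v)%E.
Proof.
rewrite (integral_children q (X_mf m.+1 q v) (X_f0 m.+1 q v)).
apply: eq_bigr => i _; apply: eq_integral => x.
by rewrite inE => xi; rewrite (cond_expS _ xi).
Qed.

Lemma exp_integral_shift m q u v k : `|u - v| <= k ->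
  (X m q v <= (expR (c * k))%:E * X m q u)%E.
Proof.
move=> uv; rewrite -EFin_integralZ// ?expR_ge0//.
apply: EFin_integral_le => //; first by mfun; exact: measurable_cond_exp.
move=> x _; rewrite mulrA ler_wpM2r// -expRD ler_expR -mulrDr ler_wpM2l//.
by rewrite (le_trans (ler_distD u _ _))//; lra.
Qed.

Let g := expR (c * (lam + jump)).
Hypothesis g1 : g * be < 1.
(** The solution of M = expR (c lam) + g be M: a stopped cell costs the factor g, and the stopped
    cells carry at most the fraction be of the weight. *)
Let M := expR (c * lam) / (1 - g * be).

(* Outside the stopped cells the integrand is at most exp (c lam); on a stopped
   cell of a generation i, the estimate for m - i generations applies, the
   average having moved by at most lam + jump. *)
Lemma exp_tree_bound m q : (X m q (A q) <= M%:E * IN (dom q) w)%E.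
Proof.
have lam0 : 0 <= lam by rewrite mulr_ge0// ltW.
have jump0 : 0 <= jump by rewrite mulr_ge0// ltW.
have g0 : 0 <= g by exact: expR_ge0.
have M0 : 0 <= M by rewrite divr_ge0 ?expR_ge0// subr_ge0 ltW.
(* Two statements have to go through the induction: one for a fixed [v] inherited from an ancestor,
   used on cells that are not stopped, and its consequence for the cell's own average, used after
   restarting on a stopped cell. *)
have aux_main (k : nat) (q0 : node) :
    (forall v : R, (`|A q0 - v| <= lam)%R ->
       (X k q0 v <= (expR (c * lam))%:E * IN (dom q0) w +
                  (g * M)%:E * IN (stopped k q0 v) w)%E) ->
    (X k q0 (A q0) <= M%:E * IN (dom q0) w)%E.
  move=> /(_ (A q0)); rewrite subrr normr0 => /(_ lam0) /le_trans; apply.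
  apply: (@le_trans _ _ ((expR (c * lam))%:E * IN (dom q0) w +
      (g * M)%:E * (be%:E * IN (dom q0) w))%E).
    apply: leeD => //; apply: lee_wpmul2l; first by rewrite lee_fin mulr_ge0.
    apply: Ainf; [exact: measurable_stopped|exact: stopped_sub|exact: stopped_half].
  have h1 : (0 <= (expR (c * lam))%:E)%E by rewrite lee_fin expR_ge0.
  have h2 : (0 <= (g * M * be)%:E)%E by rewrite lee_fin; apply: mulr_ge0 => //; exact: mulr_ge0.
  rewrite muleA -EFinM -(ge0_muleDl _ h1 h2) -EFinD.
  apply: lee_wpmul2r; first exact: EFin_integral_ge0.
  rewrite lee_fin.
  have e : expR (c * lam) = M * (1 - g * be) by rewrite /M divfK// gt_eqF// subr_gt0.
  by rewrite e le_eqVlt; apply/orP; left; apply/eqP; ring.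
apply: (aux_main); elim: m q => [|m IH] q v Av.
  rewrite /= integral_set0 mule0 adde0.
  rewrite -(EFin_integralZ mu (mdom q) mw w0 (expR_ge0 _)).
  apply: EFin_integral_le => //; [exact: (X_mf 0)|by mfun|exact: (X_f0 0 q)|move=> x _].
  by rewrite ler_wpM2r// ler_expR ler_wpM2l.
rewrite exp_integralS (integral_stoppedS _ _ _ mw w0) (integral_children q mw w0).
rewrite !ge0_sume_distrr; try by move=> i _; exact: EFin_integral_ge0.
rewrite -big_split/=; apply: lee_sum => i _.
rewrite /stop_piece; case: ifP => [h|/negbT]; last by rewrite -leNgt => /IH.
(* The cell is stopped but its parent is not, so its average exceeds the threshold by at most one
   jump. *)
have Aiv : `|A (ch q i) - v| <= lam + jump.
  by rewrite (le_trans (ler_distD (A q) _ _))//; have := average_jump q i; lra.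
apply: le_trans (exp_integral_shift m (ch q i) Aiv) _.
rewrite -/g EFinM -muleA; apply: le_trans (leeDr _ _).
  apply: lee_wpmul2l; first by rewrite lee_fin.
  by apply: (aux_main); exact: IH.
by rewrite mule_ge0 ?lee_fin ?expR_ge0//; exact: EFin_integral_ge0.
Qed.

End tree.

(** * Convergence of the averages over the tree in L^1 *)

Section tree_convergence.
Context d (T : measurableType d) (R : realType).
Variable mu : {measure set T -> \bar R}.
Variables (I : finType) (node : Type) (dom : node -> set T) (ch : node -> I -> node).
Local Notation IN E f := (\int[mu]_(x in E) (f x)%:E)%E.
Hypothesis mdom : forall q, measurable (dom q).
Hypothesis dom_ch : forall q, dom q = \big[setU/set0]_(i : I) dom (ch q i).
Hypothesis tdom : forall q, trivIset setT (fun i => dom (ch q i)).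
Hypothesis dom_gt0 : forall q, (0 < mu (dom q))%E.
Hypothesis dom_fin : forall q, (mu (dom q) < +oo)%E.
Implicit Types (g h b : T -> R) (q : node) (m : nat).

Local Notation E_ := (cond_exp mu dom ch).
Local Notation A g q := (average mu g (dom q)).
Local Notation dev m q g := (IN (dom q) (fun x => `|g x - E_ g m q x|)%R).

Let nice q g := measurable_fun setT g /\ mu.-integrable (dom q) (EFin \o g).

Let dsub := dom_ch_sub dom_ch.

Lemma nice_ch q i g : nice q g -> nice (ch q i) g.
Proof. by move=> [mg ig]; split => //; apply: integrableS ig => //; exact: dsub. Qed.

Lemma niceB q g h : nice q g -> nice q h -> nice q (fun x => g x - h x).
Proof.
move=> [mg ig] [mh ih]; split; first by mfun.
rewrite (_ : _ \o _ = (EFin \o g) \- (EFin \o h))%E//; exact: integrableB.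
Qed.

Lemma niceZ q g k : nice q g -> nice q (fun x => k * g x).
Proof.
move=> [mg ig]; split; first by mfun.
rewrite (_ : _ \o _ = (fun x => k%:E * (EFin \o g) x))%E//; exact: integrableZl.
Qed.

Lemma nice_cst q (k : R) : nice q (fun=> k).
Proof. by split; [exact: measurable_cst|exact: integrable_EFin_cst]. Qed.

Lemma nice_indic q (E : set T) : measurable E -> nice q \1_E.
Proof.
move=> mE; split; first exact: measurable_indic.
have [_ i1] := nice_cst q 1; apply: le_integrable i1 => //.
  by apply/measurable_EFinP; apply: measurable_funTS; exact: measurable_indic.
move=> x _ /=; rewrite lee_fin normr1 indicE.
by case: (x \in E); rewrite ?normr1 ?normr0.
Qed.

Lemma integrable_fineK q g : nice q g -> IN (dom q) g = (fine (IN (dom q) g))%:E.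
Proof. by move=> [_ ig]; rewrite fineK//; exact: integrable_fin_num. Qed.

Lemma averageE q g : nice q g ->
  A g q = fine (IN (dom q) g) / fine (mu (dom q)).
Proof.
move=> ng; rewrite /average (integrable_fineK ng).
have vE : mu (dom q) = (fine (mu (dom q)))%:E by rewrite fineK// ge0_fin_numE.
have v0 : 0 < fine (mu (dom q)) by rewrite -lte_fin -vE.
by rewrite vE inver gt_eqF.
Qed.

Lemma averageB q g h : nice q g -> nice q h ->
  A (fun x => g x - h x) q = A g q - A h q.
Proof.
move=> ng nh; rewrite !averageE//; last exact: niceB.
rewrite -mulrBl; congr (_ / _).
have [mg ig] := ng; have [mh ih] := nh.
transitivity (fine (\int[mu]_(x in dom q) ((g x)%:E - (h x)%:E))%E) => //.
by rewrite (integralB_EFin _ ig ih)// (integrable_fineK ng) (integrable_fineK nh).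
Qed.

Lemma averageZ q g k : nice q g -> A (fun x => k * g x) q = k * A g q.
Proof.
move=> ng; rewrite !averageE//; last exact: niceZ.
rewrite mulrA; congr (_ / _).
have [mg ig] := ng.
transitivity (fine (\int[mu]_(x in dom q) (k%:E * (EFin \o g) x))%E) => //.
by rewrite integralZl//= (integrable_fineK ng).
Qed.

Lemma average_cst q g k : (forall x, dom q x -> g x = k) -> A g q = k.
Proof.
move=> gk; rewrite /average.
have -> : IN (dom q) g = (k%:E * mu (dom q))%E.
  by rewrite -EFin_integral_cst//; apply: eq_integral => x; rewrite inE => /gk ->.
have vE : mu (dom q) = (fine (mu (dom q)))%:E by rewrite fineK// ge0_fin_numE.
have v0 : 0 < fine (mu (dom q)) by rewrite -lte_fin -vE.
by rewrite vE inver gt_eqF//= mulfK// gt_eqF.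
Qed.

Lemma measurable_dev g m q : measurable_fun setT g ->
  measurable_fun setT (fun x => `|g x - E_ g m q x|).
Proof. by move=> mg; mfun; exact: measurable_cond_exp. Qed.

Lemma devS m q g : measurable_fun setT g ->
  (dev m.+1 q g = \sum_(i : I) dev m (ch q i) g)%E.
Proof.
move=> mg; rewrite (integral_children mu mdom dom_ch tdom)//; last exact: measurable_dev.
apply: eq_bigr => i _; apply: eq_integral => x.
by rewrite inE => xi; rewrite (cond_expS _ tdom _ _ xi).
Qed.

Lemma devB m q g h : nice q g -> nice q h ->
  (dev m q (fun x => g x - h x)%R <= dev m q g + dev m q h)%E.
Proof.
elim: m q => [|m IH] q ng nh.
  rewrite /= averageB// -EFin_integralD//; last 2 first.
  - by have [mg _] := ng; mfun.
  - by have [mh _] := nh; mfun.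
  apply: EFin_integral_le => //.
  - by have [mg _] := ng; have [mh _] := nh; mfun.
  - by have [mg _] := ng; have [mh _] := nh; mfun.
  move=> x _; have -> : g x - h x - (A g q - A h q) = (g x - A g q) - (h x - A h q) by ring.
  exact: ler_normB.
have [mg _] := ng; have [mh _] := nh.
rewrite !devS//; last by mfun.
rewrite -big_split/=; apply: lee_sum => i _.
by apply: IH; exact: nice_ch.
Qed.

Lemma devZ m q g k : nice q g -> (dev m q (fun x => k * g x)%R = `|k|%:E * dev m q g)%E.
Proof.
elim: m q => [|m IH] q ng; have [mg _] := ng.
  rewrite /= averageZ// -EFin_integralZ//; last by mfun.
  by apply: eq_integral => x _; rewrite -mulrBr normrM.
rewrite !devS//; last by mfun.
rewrite ge0_sume_distrr; last by move=> i _; exact: EFin_integral_ge0.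
by apply: eq_bigr => i _; apply: IH; exact: nice_ch.
Qed.

(** Averaging is a contraction of L^1. That the bound does not depend on m is what makes
    [approximable] closed under L^1 limits. *)
Lemma dev_le m q g : nice q g ->
  (dev m q g <= 2%:E * IN (dom q) (fun x => `|g x|)%R)%E.
Proof.
elim: m q => [|m IH] q ng; have [mg ig] := ng.
  apply: (@le_trans _ _ (IN (dom q) (fun x => `|g x| + `|A g q|)%R)).
    apply: EFin_integral_le => //; [by mfun|by mfun|move=> x _ /=]; exact: ler_normB.
  rewrite EFin_integralD//; [|by mfun].
  rewrite EFin_integral_cst//.
  have := average_dev 0 (mdom q) (dom_gt0 q) (dom_fin q) ig.
  rewrite subr0; under eq_integral do rewrite subr0.
  move=> h; rewrite (_ : 2%:E = 1%:E + 1%:E)%E//.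
  rewrite ge0_muleDl ?lee_fin// mul1e.
  exact: leeD.
have mng : measurable_fun setT (fun x => `|g x|) by mfun.
rewrite devS// (integral_children mu mdom dom_ch tdom _ mng)//.
rewrite ge0_sume_distrr; last by move=> i _; exact: EFin_integral_ge0.
by apply: lee_sum => i _; apply: IH; exact: nice_ch.
Qed.

Lemma dev_cst m q g k : measurable_fun setT g -> (forall x, dom q x -> g x = k) ->
  dev m q g = 0%E.
Proof.
move=> mg; elim: m q => [|m IH] q gk.
  apply: integral0_eq => x xq /=.
  by rewrite (average_cst gk) gk// subrr normr0.
rewrite devS// big1// => i _; apply: IH => x xi; apply: gk; exact: dsub xi.
Qed.

(** Convergence is asked in L^1 and not almost everywhere: this form survives differences and
    limits, hence the pi-lambda argument and the passage to simple functions. *)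
Definition approximable q g :=
  forall e : R, 0 < e -> exists m0, forall m, (m0 <= m)%N -> (dev m q g <= e%:E)%E.

Lemma approximableB q g h : nice q g -> nice q h ->
  approximable q g -> approximable q h -> approximable q (fun x => g x - h x).
Proof.
move=> ng nh ag ah e e0; have e20 : 0 < e / 2 by lra.
have [m0 h0] := ag _ e20; have [m1 h1] := ah _ e20.
exists (maxn m0 m1) => m; rewrite geq_max => /andP[k0 k1].
apply: (le_trans (devB m ng nh)); rewrite [e in leRHS]splitr EFinD.
by apply: leeD; [exact: h0|exact: h1].
Qed.

Lemma approximableZ q g k : nice q g -> approximable q g ->
  approximable q (fun x => k * g x).
Proof.
move=> ng ag e e0; have k0 : 0 < `|k| + 1 by rewrite ltr_wpDl.
have [m0 h0] := ag _ (divr_gt0 e0 k0); exists m0 => m /h0 h.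
rewrite devZ//; apply: (@le_trans _ _ ((`|k| + 1)%:E * (e / (`|k| + 1))%:E)%E).
  by apply: lee_pmul => //; rewrite ?lee_fin ?lerDl//; exact: EFin_integral_ge0.
by rewrite -EFinM mulrC divfK// gt_eqF.
Qed.

Lemma approximable_cst q g k : measurable_fun setT g ->
  (forall x, dom q x -> g x = k) -> approximable q g.
Proof.
by move=> mg gk e e0; exists 0%N => m _; rewrite (dev_cst _ mg gk) lee_fin ltW.
Qed.

Lemma approximable_lim q g : nice q g ->
  (forall e : R, 0 < e -> exists h, [/\ nice q h, approximable q h &
     (IN (dom q) (fun x => `|g x - h x|)%R <= e%:E)%E]) ->
  approximable q g.
Proof.
move=> ng lim e e0; have e40 : 0 < e / 4 by lra.
have e20 : 0 < e / 2 by lra.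
have [h [nh ah gh]] := lim _ e40.
have [m0 h0] := ah _ e20; exists m0 => m /h0 hm.
have -> : (e%:E = (e / 2)%:E + (e / 2)%:E)%E by rewrite -EFinD -splitr.
have e4 : ((e / 2)%:E = 2%:E * (e / 4)%:E)%E by rewrite -EFinM; congr EFin; field.
have nhg : nice q (fun x => h x - g x) by exact: niceB.
have gE : g = (fun x => h x - (h x - g x)) by apply/funext => x; ring.
have devg k : k = (fun x => h x - (h x - g x)) ->
  (dev m q k <= dev m q h + dev m q (fun x => h x - g x)%R)%E by move=> ->; exact: devB.
apply: (le_trans (devg _ gE)).
apply: leeD; first exact: hm.
apply: (le_trans (dev_le m nhg)).
rewrite e4; apply: lee_wpmul2l => //; apply: le_trans gh.
by under eq_integral do rewrite distrC.
Qed.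

Lemma approximable_children q g : measurable_fun setT g ->
  (forall i, approximable (ch q i) g) -> approximable q g.
Proof.
move=> mg ai e e0.
(* The [+ 1] keeps the denominator positive without asking [I] to be inhabited. *)
have c0 : 0 < #|I|%:R + 1 :> R by rewrite ltr_wpDl.
have [M hM] := choice (fun i => ai i _ (divr_gt0 e0 c0)).
(* One generation more than the children ask for, as it is spent on reaching them. *)
exists (\max_(i : I) M i).+1 => -[//|m]; rewrite ltnS => Mm.
rewrite devS//; apply: (@le_trans _ _ (\sum_(i : I) (e / (#|I|%:R + 1))%:E)%E).
  apply: lee_sum => i _; apply: hM; apply: leq_trans Mm; exact: leq_bigmax.
rewrite sumEFin lee_fin sumr_const -[leLHS]mulr_natl mulrCA ler_piMr ?(ltW e0)//.
by rewrite ler_pdivrMr// mul1r lerDl.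
Qed.

(** The indicator of a cell is constant on every cell of its own generation or a later one, so its
    deviation is eventually 0. *)
Lemma approximable_descendant q s : approximable q (\1_(dom (foldl ch q s))).
Proof.
elim: s q => [|i s IH] q /=.
  apply: (@approximable_cst _ _ 1) => [|x xq]; first exact: measurable_indic.
  by rewrite indicE mem_set.
have mi : measurable_fun setT (\1_(dom (foldl ch (ch q i) s)) : T -> R).
  exact: measurable_indic.
apply: approximable_children => // j.
have [<-|ij] := eqVneq i j; first exact: IH.
apply: (@approximable_cst _ _ 0) => // x xj.
rewrite indicE memNset// => xs.
have xi : dom (ch q i) x.
  by elim: s (ch q i) xs {IH mi} => //= k s IH q' /IH; exact: dsub.
have /trivIsetP/(_ _ _ Logic.I Logic.I ij)/seteqP[+ _] := @tdom q.
by move/(_ x); apply.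
Qed.

(** Two cells are nested or disjoint; adjoining the empty set makes this a pi-system. *)
Definition descendants q : set (set T) :=
  [set E | E = set0 \/ exists s, E = dom (foldl ch q s)].

Lemma descendant_sub q s : dom (foldl ch q s) `<=` dom q.
Proof. by elim: s q => [q|i s IH q x /IH] /=; [exact: subset_refl|exact: dsub]. Qed.

Lemma setI_closed_descendants q : setI_closed (descendants q).
Proof.
move=> E F [->|[s ->]]; first by rewrite set0I; left.
case=> [->|[t ->]]; first by rewrite setI0; left.
elim: s q t => [|i s IH] q t /=.
  by right; exists t; apply/setIidPr; exact: descendant_sub.
case: t => [|j t] /=.
  by right; exists (i :: s); apply/setIidPl; exact: (@descendant_sub q (i :: s)).
have [<-|ij] := eqVneq i j.
  by have [->|[u ->]] := IH (ch q i) t; [left|right; exists (i :: u)].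
left; rewrite -subset0 => x [/descendant_sub xi /descendant_sub xj].
by have /trivIsetP/(_ _ _ Logic.I Logic.I ij) <- := @tdom q.
Qed.

(** Only the trace on [dom q] is asked for, since the cells below [q] do not separate points outside
    of it. *)
Hypothesis generated : forall q E, measurable E -> <<s descendants q >> (E `&` dom q).

Lemma approximable_indic q E : measurable E -> approximable q (\1_E).
Proof.
move=> mE.
pose H := [set F : set T | measurable F /\ approximable q (\1_F)].
have lH : lambda_system setT H.
  split.
  - by move=> F _ x _.
  - split; first exact: measurableT.
    apply: (@approximable_cst _ _ 1) => [|x _]; first exact: measurable_indic.
    by rewrite indicE in_setT.
  - move=> F G GF [mF aF] [mG aG]; split; first exact: measurableD.
    rewrite (_ : \1_(F `\` G) = fun x => \1_F x - \1_G x).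
      by apply: approximableB => //; exact: nice_indic.
    apply/funext => x; rewrite !indicE in_setD.
    have [xG|xG] := boolP (x \in G); last by rewrite andbT subr0.
    by rewrite (_ : x \in F) ?subrr//; move: xG; rewrite !inE; exact: GF.
  - move=> F ndF HF; have mF k : measurable (F k) by have [] := HF k.
    have mU : measurable (\bigcup_k F k) by exact: bigcupT_measurable.
    split; first exact: mU.
    apply: approximable_lim; first exact: nice_indic.
    move=> e e0.
    have mFq k : measurable (F k `&` dom q) by exact: measurableI.
    (* Continuity from below of [mu] inside [dom q] makes the indicators converge in L^1. *)
    have cv : (mu \o (fun k => F k `&` dom q)) @ \oo --> mu (\bigcup_k (F k `&` dom q)).
      apply: nondecreasing_cvg_mu => //; first exact: bigcupT_measurable.
      by move=> k l kl; apply/subsetPset; apply: setSI; apply/subsetPset; exact: ndF.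
    have lef k : (mu (F k `&` dom q) < +oo)%E.
      by apply: le_lt_trans (dom_fin q); apply: le_measure; rewrite ?inE.
    have leU : (mu (\bigcup_k (F k `&` dom q)) < +oo)%E.
      apply: le_lt_trans (dom_fin q); apply: le_measure; rewrite ?inE//.
        exact: bigcupT_measurable.
      by move=> x [k _ []].
    have [k hk] : exists k, (mu (\bigcup_k (F k `&` dom q)) - e%:E <= mu (F k `&` dom q))%E.
      apply: contrapT => /forallNP hn.
      have : (mu (\bigcup_k (F k `&` dom q)) <= mu (\bigcup_k (F k `&` dom q)) - e%:E)%E.
        rewrite -{1}(cvg_lim _ cv)//; apply: lime_le.
          by apply/cvg_ex; exists (mu (\bigcup_k (F k `&` dom q))).
        by apply: nearW => k; have := hn k; move/negP; rewrite -ltNge => /ltW.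
      rewrite leNgt => /negP; apply.
      by rewrite lteBlDr// lteDl ?lte_fin// ge0_fin_numE.
    exists (\1_(F k)); split; [exact: nice_indic|by have [] := HF k|].
    rewrite [leLHS](_ : _ = mu ((\bigcup_k (F k `&` dom q)) `\` (F k `&` dom q))).
      rewrite measureD//; last exact: bigcupT_measurable.
      rewrite (_ : _ `&` _ = F k `&` dom q); last first.
        by apply/setIidPr => x ?; exists k.
      have fk : mu (F k `&` dom q) \is a fin_num by rewrite ge0_fin_numE.
      by move: hk; rewrite leeBlDr// => hk; rewrite leeBlDr// addeC.
    have mD : measurable (\bigcup_k (F k `&` dom q) `\` (F k `&` dom q)).
      by apply: measurableD => //; exact: bigcupT_measurable.
    rewrite -[RHS]mul1e -(EFin_integral_cst mu 1 mD) (EFin_integral_indic mu _ mD).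
    rewrite (EFin_integral_indic mu (fun x => `|\1_(\bigcup_i F i) x - \1_(F k) x|) (mdom q)).
    apply: eq_integral => x _; congr EFin.
    rewrite !indicE in_setD mul1r in_setI.
    have [xq|xq] := boolP (x \in dom q); rewrite ?andbT ?andbF ?mulr1 ?mulr0.
      have -> : (x \in \bigcup_k (F k `&` dom q)) = (x \in \bigcup_k F k).
        apply/idP/idP; rewrite !inE => -[j _]; first by case=> ? _; exists j.
        by exists j => //; split => //; rewrite inE in xq.
      have [xk|xk] := boolP (x \in F k).
        rewrite (_ : x \in _) ?subrr ?normr0//= ?andbF//.
        by rewrite !inE in xk *; exists k.
      by rewrite subr0 andbT; case: (_ \in _); rewrite ?normr1 ?normr0.
    by rewrite memNset// => -[j _ [_ /mem_set xq']]; rewrite xq' in xq.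
have GH : descendants q `<=` H.
  move=> F [->|[s ->]]; split;
    [exact: measurable0| |exact: mdom|exact: approximable_descendant].
  apply: (@approximable_cst _ _ 0) => [|x _]; first exact: measurable_indic.
  by rewrite indicE in_set0.
have [_ aE] := lambda_system_subset (@setI_closed_descendants q) lH GH
  (fun _ _ => @subsetT _ _) (@generated q _ mE).
have n1 := nice_indic q mE; have n2 := nice_indic q (measurableI _ _ mE (mdom q)).
have n3 := niceB n2 n1.
(* The pi-lambda theorem gives the trace of [E] only; the bracket vanishes on [dom q], where alone
   deviations are measured. *)
rewrite (_ : \1_E = fun x => \1_(E `&` dom q) x - (\1_(E `&` dom q) x - \1_E x)).
  apply: (approximableB n2 n3 aE); apply: (@approximable_cst _ _ 0) => [|x xq].
    by case: n3.
  by rewrite !indicE in_setI (mem_set xq) andbT subrr.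
by apply/funext => x; rewrite opprB addrC subrK.
Qed.

Lemma approximableD q g h : nice q g -> nice q h ->
  approximable q g -> approximable q h ->
  nice q (fun x => g x + h x) /\ approximable q (fun x => g x + h x).
Proof.
move=> ng nh ag ah.
have nh1 := niceZ (-1) nh; have ah1 := approximableZ (-1) nh ah.
rewrite (_ : (fun x => g x + h x) = (fun x => g x - -1 * h x)).
  by split; [exact: niceB|exact: approximableB ah1].
by apply/funext => x; rewrite mulN1r opprK.
Qed.

Lemma approximable_sum q (J : Type) (s : seq J) (F : J -> T -> R) :
  (forall j, nice q (F j) /\ approximable q (F j)) ->
  nice q (fun x => \sum_(j <- s) F j x) /\ approximable q (fun x => \sum_(j <- s) F j x).
Proof.
move=> nF; elim: s => [|j s [ns as_]].
  under eq_fun do rewrite big_nil.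
  by split; [exact: nice_cst|apply: (@approximable_cst _ _ 0) => // *; exact: measurable_cst].
under eq_fun do rewrite big_cons.
have [nj aj] := nF j; exact: (approximableD nj ns aj as_).
Qed.

Lemma approximable_sfun q (h : {sfun T >-> R}) : approximable q (fun x => h x).
Proof.
have hE : (fun x => h x) =
    (fun x => \sum_(y <- finmap.enum_fset (fset_set (range h))) (y * \1_(h @^-1` [set y]) x)).
  by apply/funext => x; rewrite {1}fimfunE fsbig_finite.
have [] := @approximable_sum q _ (finmap.enum_fset (fset_set (range h)))
  (fun y x => y * \1_(h @^-1` [set y]) x).
  move=> y; have my : measurable (h @^-1` [set y]) by exact: measurable_funPTI.
  have ny := nice_indic q my.
  split; first exact: (niceZ y ny).
  exact: (approximableZ y ny (approximable_indic q my)).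
by move=> _; rewrite -hE.
Qed.

Lemma approximable_nice q g : nice q g -> approximable q g.
Proof.
move=> ng; apply: (approximable_lim ng) => e e0.
have [mg ig] := ng.
have [h [ih _ hg]] := approximation_sfun_integrable (mdom q) ig.
have [k hk] := cvge0_le hg e0.
exists (h k); split; [by split; [exact: measurable_funPT|exact: ih]|exact: approximable_sfun|].
exact: hk.
Qed.

Lemma exp_integral_limit q g (w : T -> R) c v M :
  measurable_fun setT w -> (forall x, 0 <= w x) -> nice q g ->
  (forall m, IN (dom q) (fun x => expR (c * `|E_ g m q x - v|) * w x)%R <= M)%E ->
  (IN (dom q) (fun x => expR (c * `|g x - v|) * w x)%R <= M)%E.
Proof.
move=> mw w0 ng hM; have [mg ig] := ng.
have ag := approximable_nice ng.
(* A subsequence with summable L^1 errors converges almost everywhere, and the exponential is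
   continuous, so Fatou applies to the uniform bound [M]. *)
have ex k : exists m, (dev m q g <= (1 / (2 ^ k.+1)%:R)%:E)%E.
  have [|m0 hm] := ag (1 / (2 ^ k.+1)%:R); first by rewrite divr_gt0// ltr0n expn_gt0.
  by exists m0; apply: hm.
have [phi hphi] := choice ex.
have cv := ae_cvg_summable (mdom q) (fun k => measurable_dev (phi k) q mg)
  (fun k x => normr_ge0 _) hphi.
apply: (@fatou_le _ _ _ mu (dom q)
  (fun k x => expR (c * `|E_ g (phi k) q x - v|) * w x)).
- exact: mdom.
- by move=> k; mfun; exact: measurable_cond_exp.
- by mfun.
- by move=> k x; rewrite mulr_ge0// expR_ge0.
- by move=> x; rewrite mulr_ge0// expR_ge0.
2: by move=> k; exact: hM.
apply: filterS cv => x + xq => /(_ xq) cvx.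
have cvE : (fun k => E_ g (phi k) q x) @ \oo --> g x.
  apply/cvgrPdist_lt => e e0; move/cvgr0Pnorm_lt : cvx => /(_ e e0).
  by apply: filterS => k; rewrite normr_id.
apply: cvgM; last exact: cvg_cst.
apply: continuous_cvg; first exact: continuous_expR.
apply: cvgM; first exact: cvg_cst.
by apply: cvg_norm; apply: cvgB => //; exact: cvg_cst.
Qed.

End tree_convergence.

(** * Dyadic cubes *)

Section dyadic.
Context {R : realType} {n : nat}.
Local Notation Rn := 'rV[R]_n.
Local Notation leb := (@lebesgue_rV R n).
Local Notation node := (Rn * {posnum R})%type.
Local Notation I := {ffun 'I_n -> bool}.

(** The side is a positive number by type, because the tree hypotheses ask every node to have
    positive measure. *)
Definition cell (q : node) : set Rn := cube q.1 q.2%:num.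

(** [e i] tells whether the upper half of the i-th side is taken. *)
Definition subcell (q : node) (e : I) : node :=
  (\row_i (q.1 ord0 i + (if e i then q.2%:num / 2 else 0)), (q.2%:num / 2)%:pos).

Lemma measurable_cell q : measurable (cell q).
Proof. exact: measurable_cube. Qed.

Lemma lebesgue_cell q : leb (cell q) = (q.2%:num ^+ n)%:E.
Proof. exact: lebesgue_cube. Qed.

Lemma lebesgue_cell_gt0 q : (0 < leb (cell q))%E.
Proof. by rewrite lebesgue_cell lte_fin exprn_gt0. Qed.

Lemma lebesgue_cell_lty q : (leb (cell q) < +oo)%E.
Proof. by rewrite lebesgue_cell ltry. Qed.

Lemma lebesgue_subcell q e :
  (leb (cell q) <= ((2 : R) ^+ n)%:E * leb (cell (subcell q e)))%E.
Proof.
by rewrite !lebesgue_cell -EFinM lee_fin -exprMn /= mulrC divfK.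
Qed.

Lemma subcell_coord q e x i : cell (subcell q e) x ->
  if e i then q.1 ord0 i + q.2%:num / 2 <= x ord0 i < q.1 ord0 i + q.2%:num
  else q.1 ord0 i <= x ord0 i < q.1 ord0 i + q.2%:num / 2.
Proof.
move=> /(_ i); rewrite !mxE /=; case: (e i); last by rewrite addr0.
by rewrite -addrA -splitr.
Qed.

Lemma subcell_sub q e : cell (subcell q e) `<=` cell q.
Proof.
move=> x xe i; have := subcell_coord i xe.
have l0 : 0 < q.2%:num by [].
by case: (e i) => /andP[h1 h2]; apply/andP; split; lra.
Qed.

Lemma cell_subcell q x : cell q x -> exists e, cell (subcell q e) x.
Proof.
move=> xq; exists [ffun i => q.1 ord0 i + q.2%:num / 2 <= x ord0 i] => i.
rewrite !mxE ffunE; have /andP[h1 h2] := xq i.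
case: ifPn => [h|]; first by rewrite h /= -addrA -splitr.
by rewrite -ltNge addr0 => h; rewrite h1.
Qed.

Lemma cell_bigcup q : cell q = \big[setU/set0]_(e : I) cell (subcell q e).
Proof.
rewrite -bigcup_seq; apply/seteqP; split => x.
  by move/cell_subcell => [e xe]; exists e => //=; rewrite mem_index_enum.
by move=> [e _]; exact: subcell_sub.
Qed.

Lemma trivIset_subcell q : trivIset setT (fun e => cell (subcell q e)).
Proof.
move=> e f _ _ [x [xe xf]]; apply/ffunP => i.
have := subcell_coord i xe; have := subcell_coord i xf.
by case: (e i) (f i) => -[] //= /andP[? ?] /andP[? ?]; exfalso; lra.
Qed.

Lemma cell_descendant m q x : cell q x -> exists s : seq I,
  cell (foldl subcell q s) x /\ (foldl subcell q s).2%:num = q.2%:num / 2 ^+ m.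
Proof.
elim: m q => [|m IH] q xq; first by exists [::] => /=; rewrite expr0 divr1.
have [e xe] := cell_subcell xq; have [s [xs hs]] := IH _ xe.
exists (e :: s); split => //=; rewrite hs /= exprS invfM mulrA.
by [].
Qed.

Local Notation desc q := (descendants cell subcell q).

(** Each point of the set lies in a descendant of side less than its distance to the hyperplane,
    which is thus contained in the half-space. There are countably many descendants; pickling of
    finite sequences indexes them by the natural numbers. *)
Lemma sigma_cell_lt q i (c : R) :
  <<s desc q >> (cell q `&` [set x | x ord0 i < c]).
Proof.
pose F (s : seq I) : set Rn :=
  if `[< cell (foldl subcell q s) `<=` [set x | x ord0 i < c] >]
  then cell (foldl subcell q s) else set0.
pose G k := if unpickle k is Some s then F s else set0.
have GE s : G (pickle s) = F s by rewrite /G pickleK.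
have -> : cell q `&` [set x | x ord0 i < c] = \bigcup_k G k.
  apply/seteqP; split => x.
    move=> [xq /= xc].
    have d0 : 0 < c - x ord0 i by rewrite subr_gt0.
    have [m hm] : exists m, q.2%:num / 2 ^+ m < c - x ord0 i.
      have := @cvg_geometric R q.2%:num 2^-1.
      rewrite ger0_norm ?invr_ge0// invf_lt1// ltr1n => /(_ isT).
      move/cvgr0Pnorm_lt => /(_ _ d0)[m _ hm]; exists m.
      have := hm m (leqnn m); rewrite /geometric/= exprVn.
      by apply: le_lt_trans; exact: ler_norm.
    have [s [xs hs]] := cell_descendant m xq.
    exists (pickle s) => //; rewrite GE /F asboolT// => y ys /=.
    have /andP[h1 h2] := ys i; have /andP[h3 h4] := xs i.
    by move: h2 hm; rewrite -hs; lra.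
  move=> [k _]; rewrite /G; case: unpickle => // s; rewrite /F; case: asboolP => // h xs.
  split; last exact: h.
  exact: (descendant_sub cell_bigcup xs).
apply: sigma_algebra_bigcup => k; rewrite /G; case: unpickle => [s|]; last exact: sigma_algebra0.
rewrite /F; case: asboolP => _; last exact: sigma_algebra0.
by apply: sub_sigma_algebra; right; exists s.
Qed.

(** The map that is the identity on the cell and 0 elsewhere has measurable coordinates for the
    generated sigma-algebra, hence is measurable into R^n; [E] agrees with its preimage inside the
    cell. *)
Lemma sigma_cells q (E : set Rn) : measurable E -> <<s desc q >> (E `&` cell q).
Proof.
move=> mE.
have mq : <<s desc q >> (cell q).
  by apply: sub_sigma_algebra; right; exists [::].
pose f (t : g_sigma_algebraType (desc q)) : Rn :=
  if t \in (cell q : set Rn) then (t : Rn) else 0.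
have mf : measurable_fun setT f.
  apply: measurable_fun_rVP => i.
  apply: (measurability _ (RGenInftyO.measurableE R)) => _ [_ [c ->] <-].
  rewrite setTI.
  (* Outside the cell [f] is 0, which counts as less than [c] exactly when c > 0. *)
  have -> : (fun t => f t ord0 i) @^-1` `]-oo, c[%classic =
      (cell q `&` [set x | x ord0 i < c]) `|` (if 0 < c then ~` cell q else set0).
    apply/seteqP; split => t; rewrite /f /= in_itv/=.
      case: ifPn => [/set_mem tq tc|/negP tq]; first by left.
      by rewrite mxE => ->; right; move=> /mem_set.
    case=> [[tq tc]|]; first by rewrite mem_set.
    by case: ifPn => // c0 tq; rewrite memNset// mxE.
  apply: (@measurableU _ (g_sigma_algebraType (desc q))); first exact: sigma_cell_lt.
  by case: ifPn => _; [exact: (@measurableC _ (g_sigma_algebraType (desc q)))|exact: measurable0].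
have -> : E `&` cell q = (setT `&` f @^-1` E) `&` cell q.
  rewrite setTI; apply/seteqP; split => t [tE tq]; split => //.
    by rewrite /preimage /f /= mem_set.
  by move: tE; rewrite /preimage /f /= mem_set.
apply: (@measurableI _ (g_sigma_algebraType (desc q))) => //.
exact: mf.
Qed.

End dyadic.

(** * The weighted John-Nirenberg inequality *)

Section john_nirenberg.
Context {R : realType} {n : nat}.
Local Notation Rn := 'rV[R]_n.
Local Notation leb := (@lebesgue_rV R n).
Local Notation node := (Rn * {posnum R})%type.
Local Notation IN E f := (\int[leb]_(x in E) (f x)%:E)%E.
Local Notation vol E := (fine (leb E)).
Local Notation wr w E := (fine (wmeasure w E)).

(** This is y <= exp y at y = c t / r, raised to the power r. *)
Lemma powR_le_expR (r c t : R) : 0 < r -> 0 < c -> 0 <= t ->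
  t `^ r <= (r / c) `^ r * expR (c * t).
Proof.
move=> r0 c0 t0.
have e : t = (r / c) * (c * t / r) by field; rewrite !gt_eqF.
have h0 : 0 <= c * t / r by rewrite divr_ge0 ?mulr_ge0 ?(ltW c0) ?(ltW r0).
have h1 : 0 <= r / c by rewrite divr_ge0 // ltW.
rewrite {1}e (powRM _ h1 h0) ler_wpM2l ?powR_ge0//.
have -> : expR (c * t) = expR (c * t / r) `^ r.
  by rewrite -expRM divfK// gt_eqF.
apply: ge0_ler_powR; rewrite ?nnegrE ?expR_ge0 ?(ltW r0)//.
by rewrite (le_trans _ (expR_ge1Dx _))// lerDr.
Qed.

Lemma average_dev2 (b : Rn -> R) E c : measurable E -> (0 < leb E)%E ->
  (leb E < +oo)%E -> measurable_fun setT b -> leb.-integrable E (EFin \o b) ->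
  (IN E (fun x => `|b x - average leb b E|)%R <=
   2%:E * IN E (fun x => `|b x - c|)%R)%E.
Proof.
move=> mE E0 Efin mb ib.
apply: (@le_trans _ _ (IN E (fun x => `|b x - c| + `|average leb b E - c|)%R)).
  apply: EFin_integral_le => //; [by mfun|by mfun|move=> x _].
  by rewrite (le_trans (ler_distD c _ _))// lerD2l distrC.
rewrite EFin_integralD//; [|by mfun].
rewrite EFin_integral_cst// (_ : 2%:E = 1%:E + 1%:E)%E//.
rewrite ge0_muleDl ?lee_fin// mul1e.
by apply: leeD => //; exact: average_dev.
Qed.

Lemma BMO_ball (b : Rn -> R) : (0 < n)%N -> BMO b -> exists N, 0 <= N /\
  forall x r, 0 < r ->
  (IN (eball x r) (fun y => `|b y - mean b (eball x r)|)%R <=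
   N%:E * leb (eball x r))%E.
Proof.
move=> n0 [lb bf].
have key x r : 0 < r -> (IN (eball x r) (fun y => `|b y - mean b (eball x r)|)%R
    / leb (eball x r) <= bmo_norm b)%E.
  by move=> r0; apply: ereal_sup_ubound; exists (eball x r) => //; exists x, r.
have div0 x r : 0 < r -> (0 <= IN (eball x r) (fun y => `|b y - mean b (eball x r)|)%R
    / leb (eball x r))%E.
  move=> r0; apply: mule_ge0; first exact: EFin_integral_ge0.
  by rewrite inve_ge0.
have Nfin : bmo_norm b \is a fin_num.
  rewrite ge0_fin_numE//; apply: le_trans (key 0 1 ltr01); exact: div0.
exists (fine (bmo_norm b)); split.
  by apply: fine_ge0; apply: le_trans (key 0 1 ltr01); exact: div0.
move=> x r r0; rewrite fineK//.
have vE := lebesgue_sub_eball (measurable_eball x r) (@subset_refl _ (eball x r)).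
have v0 := vol_gt0 n0 x r0.
have := key x r r0; rewrite vE inver gt_eqF// => h.
by rewrite -lee_pdivrMr//.
Qed.

Lemma cell_sub_eball (q : node) : cell q `<=` eball q.1 ((n%:R + 1) * q.2%:num).
Proof.
move=> x xq; rewrite eballE.
have : enorm (q.1 - x) <= n%:R * q.2%:num.
  apply: enorm_le_max => i; rewrite !mxE; have /andP[h1 h2] := xq i.
  by rewrite ler_norml; lra.
by have : 0 < q.2%:num by []; lra.
Qed.

Lemma vol_cell (q : node) : vol (cell q) = q.2%:num ^+ n.
Proof. by rewrite lebesgue_cell. Qed.

(** The volume ratio of a cell and of the ball about its corner that contains it. *)
Let D1 : R := (2 * (n%:R + 1)) ^+ n.
Let D1_gt0 : 0 < D1.
Proof. by rewrite exprn_gt0// mulr_gt0// ltr_wpDl. Qed.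

Lemma vol_eball_cell (q : node) :
  vol (eball q.1 ((n%:R + 1) * q.2%:num)) <= D1 * vol (cell q).
Proof.
have r0 : 0 < (n%:R + 1) * q.2%:num by rewrite mulr_gt0// ltr_wpDl.
by rewrite vol_cell /D1 -exprMn -mulrA; exact: vol_le.
Qed.

Lemma BMO_cell (b : Rn -> R) : (0 < n)%N -> BMO b -> exists N, 0 < N /\
  forall q : node, leb.-integrable (cell q) (EFin \o b) /\
  (IN (cell q) (fun y => `|b y - average leb b (cell q)|)%R <=
   N%:E * leb (cell q))%E.
Proof.
move=> n0 Hb; have [N [N0 hN]] := BMO_ball n0 Hb.
have [[mb ib] _] := Hb.
(* 2 for passing from the mean over the ball to the average over the cell, [D1] for the volumes,
   [+ 1] for strict positivity. *)
exists (2 * (N * D1) + 1); split.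
  by rewrite ltr_wpDl// !mulr_ge0// ltW.
move=> q; set B := eball q.1 ((n%:R + 1) * q.2%:num).
have r0 : 0 < (n%:R + 1) * q.2%:num by rewrite mulr_gt0// ltr_wpDl.
have mB : measurable B by exact: measurable_eball.
have mq := measurable_cell q.
have iq : leb.-integrable (cell q) (EFin \o b).
  apply: integrableS (ib B _) => //; first exact: cell_sub_eball.
  by exists q.1, ((n%:R + 1) * q.2%:num).
split => //.
apply: (le_trans (average_dev2 (mean b B) mq (lebesgue_cell_gt0 q) (lebesgue_cell_lty q) mb iq)).
apply: (@le_trans _ _ (2%:E * (N%:E * leb B))%E).
  apply: lee_wpmul2l => //; apply: le_trans (hN q.1 _ r0).
  by apply: EFin_integral_subset => //; [mfun|exact: cell_sub_eball].
have vE := lebesgue_sub_eball mB (@subset_refl _ B).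
rewrite vE lebesgue_cell -!EFinM lee_fin.
have := vol_eball_cell q; rewrite -/B vol_cell => h.
have l0 : 0 <= q.2%:num ^+ n by rewrite exprn_ge0.
apply: (@le_trans _ _ (2 * (N * D1) * q.2%:num ^+ n)); last by rewrite ler_wpM2r// lerDl.
by rewrite -!mulrA ler_wpM2l// ler_wpM2l.
Qed.

Variables (p q K : R) (w s : Rn -> R).
Hypothesis n0 : (0 < n)%N.
Hypothesis H : dual_weights p q w s K.

(* A_p applied to the complement of E, which fills at least half of the cell. *)
Lemma Ainf_cell : exists be, 0 <= be < 1 /\ forall (Q : node) E,
  measurable E -> E `<=` cell Q -> (2%:E * leb E <= leb (cell Q))%E ->
  (IN E w <= be%:E * IN (cell Q) w)%E.
Proof.
have half (a c e : R) : e = a + c -> 2 * a <= e -> e <= 2 * c by lra.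
have pp := dw_p H; have K0 := dw_K H.
(* The power bounds w(Q) / w(F) for the complement F of E in the cell; [+ 1] makes th >= 1, so that
   1 - 1 / th lies in [0, 1). *)
pose th := (2 * K * D1) `^ p + 1.
have th1 : 1 <= th by rewrite lerDr powR_ge0.
have th0 : 0 < th by lra.
exists (1 - th^-1); split.
  by rewrite subr_ge0 invf_le1// th1 ltrBlDr ltrDl invr_gt0.
move=> Q E mE EQ E2.
pose B := eball Q.1 ((n%:R + 1) * Q.2%:num).
have r0 : 0 < (n%:R + 1) * Q.2%:num by rewrite mulr_gt0// ltr_wpDl.
have QB : cell Q `<=` B by exact: cell_sub_eball.
have mQ := measurable_cell Q.
pose F := cell Q `\` E.
have mF : measurable F by exact: measurableD.
have FQ : F `<=` cell Q by exact: subDsetl.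
have FB := subset_trans FQ QB; have EB := subset_trans EQ QB.
have EF : E `|` F = cell Q by rewrite /F setDUK.
have dEF : [disjoint E & F] by apply/disj_setPS => x [Ex []].
have wQ : wr w (cell Q) = wr w E + wr w F.
  apply: EFin_inj; rewrite EFinD -(wmeasure_sub_eball H mQ QB).
  rewrite -(wmeasure_sub_eball H mE EB) -(wmeasure_sub_eball H mF FB).
  by rewrite -EF /wmeasure EFin_integral_setU//; [exact: dw_mw H|exact: dw_w0 H].
have vQ : vol (cell Q) = vol E + vol F.
  apply: EFin_inj; rewrite EFinD -(lebesgue_sub_eball mQ QB).
  rewrite -(lebesgue_sub_eball mE EB) -(lebesgue_sub_eball mF FB).
  by rewrite -EF measureU//; move: dEF; rewrite /disj_set => /eqP.
have E2' : 2 * vol E <= vol (cell Q).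
  by rewrite -lee_fin EFinM -(lebesgue_sub_eball mE EB) -(lebesgue_sub_eball mQ QB).
have vQ0 : 0 < vol (cell Q) by rewrite vol_cell exprn_gt0.
have h := vol_powR_le H r0 mF mQ FB QB.
have h1 : wr w (cell Q) `^ p^-1 <= 2 * K * D1 * wr w F `^ p^-1.
  rewrite -(ler_pM2l vQ0).
  apply: (@le_trans _ _ (2 * (vol F * wr w (cell Q) `^ p^-1))).
    by rewrite mulrA; apply: ler_wpM2r; [exact: powR_ge0|exact: half vQ E2'].
  apply: (@le_trans _ _ (2 * (K * vol B * wr w F `^ p^-1))).
    by rewrite ler_wpM2l.
  apply: (@le_trans _ _ (2 * (K * (D1 * vol (cell Q)) * wr w F `^ p^-1))).
    rewrite ler_wpM2l// ler_wpM2r ?powR_ge0// ler_wpM2l ?(ltW K0)//.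
    exact: vol_eball_cell.
  by rewrite le_eqVlt; apply/orP; left; apply/eqP; ring.
have h2 : wr w (cell Q) <= th * wr w F.
  have c0 : 0 <= 2 * K * D1 by rewrite !mulr_ge0// ltW.
  have W0 := fine_wmeasure_ge0 H (cell Q); have F0 := fine_wmeasure_ge0 H F.
  move: h1 => /(@ge0_ler_powR _ p (ltW pp) _ _).
  rewrite !nnegrE powR_ge0 mulr_ge0 ?powR_ge0// => /(_ isT isT).
  rewrite (powR_invK pp W0) (powRM p c0 (powR_ge0 _ p^-1)) (powR_invK pp F0).
  move=> /le_trans; apply.
  by rewrite ler_wpM2r// lerDl.
rewrite -/(wmeasure w E) -/(wmeasure w (cell Q)).
rewrite (wmeasure_sub_eball H mQ QB) (wmeasure_sub_eball H mE EB) -EFinM lee_fin.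
have hF : th^-1 * wr w (cell Q) <= wr w F by rewrite ler_pdivrMl.
by rewrite mulrBl mul1r [X in _ <= X - _]wQ -addrA lerDl subr_ge0.
Qed.

Lemma john_nirenberg_cell (b : Rn -> R) : BMO b -> exists c M,
  [/\ 0 < c, 0 <= M & forall Q : node,
  (IN (cell Q) (fun x => expR (c * `|b x - average leb b (cell Q)|) * w x)%R <=
    M%:E * IN (cell Q) w)%E].
Proof.
move=> Hb; have [N [N0 hN]] := BMO_cell n0 Hb.
have [be [/andP[be0 be1] hbe]] := Ainf_cell.
have [[mb _] _] := Hb.
pose D : R := 2 ^+ n.
have D0 : 0 < D by rewrite exprn_gt0.
pose S := 2 * N + D * N.
have S0 : 0 < S by rewrite addr_gt0 ?mulr_gt0.
have be10 : 0 < 1 + be by lra.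
have a1 : 1 < 2 / (1 + be) by rewrite ltr_pdivlMr//; lra.
(* Chosen so that expR (c S) = 2 / (1 + be), which exceeds 1 and still gives 2 be / (1 + be) < 1
   after multiplication by be. *)
pose c := ln (2 / (1 + be)) / S.
have c0 : 0 < c by rewrite divr_gt0// ln_gt0.
have gE : expR (c * S) = 2 / (1 + be).
  by rewrite /c divfK ?gt_eqF// lnK// posrE; lra.
have g1 : expR (c * (2 * N + D * N)) * be < 1.
  rewrite -/S gE mulrAC ltr_pdivrMr//; lra.
exists c, (expR (c * (2 * N)) / (1 - expR (c * (2 * N + D * N)) * be)); split => //.
  by rewrite divr_ge0 ?expR_ge0// subr_ge0 ltW.
move=> Q.
have mw := dw_mw H; have w0 := dw_w0 H.
have nQ : measurable_fun setT b /\ leb.-integrable (cell Q) (EFin \o b).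
  by split => //; have [] := hN Q.
apply: (exp_integral_limit measurable_cell cell_bigcup trivIset_subcell
  lebesgue_cell_gt0 lebesgue_cell_lty sigma_cells mw w0 nQ) => m.
apply: (exp_tree_bound measurable_cell cell_bigcup trivIset_subcell mw w0 mb
  _ lebesgue_cell_gt0 lebesgue_cell_lty N0 D0 be0 (ltW c0) _ _ hbe g1).
- by move=> Q'; have [] := hN Q'.
- by move=> Q'; have [] := hN Q'.
- exact: lebesgue_subcell.
Qed.

End john_nirenberg.

(** * From cells to balls *)

Section john_nirenberg_ball.
Context {R : realType} {n : nat}.
Local Notation Rn := 'rV[R]_n.
Local Notation leb := (@lebesgue_rV R n).
Local Notation node := (Rn * {posnum R})%type.
Local Notation IN E f := (\int[leb]_(x in E) (f x)%:E)%E.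
Local Notation vol E := (fine (leb E)).
Local Notation wr w E := (fine (wmeasure w E)).

Lemma mean_dev (b : Rn -> R) x r c (a : R) : (0 < n)%N -> 0 < r -> loc_integrable b ->
  (IN (eball x r) (fun y => `|b y - c|)%R <= a%:E)%E ->
  `|mean b (eball x r) - c| * vol (eball x r) <= a.
Proof.
move=> n0 r0 [mb ib] h.
have mB := measurable_eball x r.
have := average_dev c mB (lebesgue_eball_gt0 x n0 r0) (lebesgue_eball_lty x r)
  (ib _ (ex_intro _ x (ex_intro _ r (conj r0 erefl)))).
move=> /le_trans/(_ h) h'.
rewrite -lee_fin EFinM -(lebesgue_sub_eball mB (@subset_refl _ (eball x r))).
exact: h'.
Qed.

(** Each doubling of the radius moves the mean by a bounded amount, so the drift is linear in j. The
    decay of the tails absorbs such a factor. *)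
Lemma mean_doubling (b : Rn -> R) : (0 < n)%N -> BMO b -> exists C, 0 <= C /\
  forall x r j, 0 < r ->
    `|mean b (eball x (2 ^+ j * r)) - mean b (eball x r)| <= j%:R * C.
Proof.
move=> n0 Hb; have [N [N0 hN]] := BMO_ball n0 Hb.
have [lb _] := Hb; have [mb _] := lb.
have nR : 0 < n%:R :> R by rewrite ltr0n.
(* (4 n)^n bounds the ratio of volumes, (4 r)^n over (r / n)^n. *)
exists (N * (4 * n%:R) ^+ n); split; first by rewrite mulr_ge0// exprn_ge0.
have key x r : 0 < r -> `|mean b (eball x (2 * r)) - mean b (eball x r)| <= N * (4 * n%:R) ^+ n.
  move=> r0; have r20 : 0 < 2 * r by rewrite mulr_gt0.
  have v0 := vol_gt0 n0 x r0.
  have vE := lebesgue_sub_eball (measurable_eball x (2 * r)) (@subset_refl _ _).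
  rewrite distrC -(ler_pM2r v0).
  have := @mean_dev b x r (mean b (eball x (2 * r))) (N * vol (eball x (2 * r))) n0 r0 lb.
  move=> /(_ _)/le_trans; apply.
    rewrite EFinM -vE; apply: le_trans (hN x _ r20).
    apply: EFin_integral_subset => //; try exact: measurable_eball; first by mfun.
    by apply: eball_le; lra.
  rewrite -mulrA ler_wpM2l// (le_trans (vol_le x r20))//.
  rewrite (le_trans _ (ler_wpM2l _ (vol_ge n0 x r0)))// ?exprn_ge0 ?mulr_ge0//.
  rewrite -exprMn; have -> : 4 * n%:R * (r / n%:R) = 2 * (2 * r) by field; rewrite gt_eqF.
  by [].
move=> x r j r0; elim: j => [|j IH]; first by rewrite expr0 mul1r subrr normr0 mul0r.
have rj : 0 < 2 ^+ j * r by rewrite mulr_gt0// exprn_gt0.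
rewrite exprS -mulrA (le_trans (ler_distD (mean b (eball x (2 ^+ j * r))) _ _))//.
have k := key x _ rj; rewrite -[j.+1%:R]natr1 [leRHS]mulrDl mul1r.
by rewrite [leRHS]addrC lerD.
Qed.

Variables (p q K : R) (w s : Rn -> R).
Hypothesis n0 : (0 < n)%N.
Hypothesis H : dual_weights p q w s K.

Lemma john_nirenberg_ball (b : Rn -> R) e : BMO b -> 0 < e -> exists C, 0 <= C /\
  forall x r, 0 < r ->
  (IN (eball x r) (fun y => `|b y - mean b (eball x r)| `^ e * w y)%R <=
    C%:E * wmeasure w (eball x r))%E.
Proof.
move=> Hb e0.
have [c [M [c0 M0 hM]]] := john_nirenberg_cell n0 H Hb.
have [N [N0 hN]] := BMO_cell n0 Hb.
have [lb _] := Hb; have [mb _] := lb.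
have mw := dw_mw H; have w0 := dw_w0 H.
have nR : 0 < n%:R :> R by rewrite ltr0n.
(* The cube circumscribed to the ball has side 2 r and lies in a ball of radius (n + 1) 2 r about
   its corner; [doubling] compares the two balls although their centres differ. *)
have th0 : 0 < 2 * (n%:R + 1) :> R by rewrite mulr_gt0// ltr_wpDl.
have [D [D0 hD]] := doubling n0 H th0.
(* [C1] pays for the deviation from the average over the cube, [C2] for the distance of that average
   from the mean over the ball. *)
pose C1 := (e / c) `^ e * M * D.
pose C2 := (N * (2 * n%:R) ^+ n) `^ e.
have C10 : 0 <= C1 by rewrite !mulr_ge0 ?powR_ge0// ltW.
have C20 : 0 <= C2 by exact: powR_ge0.
exists (2 `^ e * (C1 + C2)); split.
  by rewrite mulr_ge0 ?powR_ge0// addr_ge0.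
move=> x r r0.
have r20 : 0 < 2 * r by rewrite mulr_gt0.
pose Q : node := (\row_i (x ord0 i - r), PosNum r20).
have l2 : Q.2%:num = 2 * r by [].
have BQ : eball x r `<=` cell Q by exact: eball_sub_cube.
have QB := cell_sub_eball (q := Q).
have mQ := measurable_cell Q; have mB := measurable_eball x r.
set m := mean b _; set A := average leb b (cell Q).
have [iQ bQ] := hN Q.
have v0 := vol_gt0 n0 x r0.
have mA : `|A - m| <= N * (2 * n%:R) ^+ n.
  rewrite distrC -(ler_pM2r v0).
  have := @mean_dev b x r A (N * vol (cell Q)) n0 r0 lb.
  move=> /(_ _)/le_trans; apply.
    rewrite EFinM -(lebesgue_sub_eball mQ QB); apply: le_trans bQ.
    by apply: EFin_integral_subset => //; mfun.
  rewrite vol_cell l2 -mulrA ler_wpM2l ?(ltW N0)//.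
  rewrite (le_trans _ (ler_wpM2l _ (vol_ge n0 x r0)))// ?exprn_ge0 ?mulr_ge0//.
  rewrite -exprMn; have -> : 2 * n%:R * (r / n%:R) = 2 * r by field; rewrite gt_eqF.
  by [].
have hQ : (IN (cell Q) (fun y => `|b y - A| `^ e * w y)%R <=
    (((e / c) `^ e * M)%R)%:E * wmeasure w (cell Q))%E.
  apply: (@le_trans _ _ (((e / c) `^ e)%:E *
     IN (cell Q) (fun y => expR (c * `|b y - A|) * w y)%R)%E).
    rewrite -EFin_integralZ ?powR_ge0//; last 2 first.
    - by mfun.
    - by move=> y; rewrite mulr_ge0// expR_ge0.
    apply: EFin_integral_le => //; [by mfun|by mfun|by move=> y; rewrite mulr_ge0// powR_ge0|].
    by move=> y _; rewrite mulrA ler_wpM2r// powR_le_expR.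
  by rewrite EFinM -muleA; apply: lee_wpmul2l; rewrite ?lee_fin ?powR_ge0//; exact: hM.
have hw : (wmeasure w (cell Q) <= D%:E * wmeasure w (eball x r))%E.
  have r1 : 2 * r <= 2 * (n%:R + 1) * r by nra.
  have h := hD Q.1 ((n%:R + 1) * Q.2%:num) x r r0 _ (subset_trans BQ QB).
  have hle : (n%:R + 1) * Q.2%:num <= 2 * (n%:R + 1) * r by rewrite l2 mulrCA mulrA.
  have {}h := h hle.
  rewrite (wmeasure_sub_eball H mQ QB).
  rewrite (wmeasure_sub_eball H mB (@subset_refl _ _)) -EFinM lee_fin.
  apply: le_trans h.
  exact: (fine_wmeasure_le H mQ (measurable_eball _ _) QB (@subset_refl _ _)).
apply: (@le_trans _ _ (IN (eball x r)
   (fun y => 2 `^ e * (`|b y - A| `^ e * w y + C2 * w y))%R)).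
  apply: EFin_integral_le => //; [by mfun|by mfun|by move=> y; rewrite mulr_ge0// powR_ge0|].
  move=> y _; rewrite -mulrDl mulrA ler_wpM2r//.
  apply: (@le_trans _ _ ((`|b y - A| + `|A - m|) `^ e)).
    apply: ge0_ler_powR; rewrite ?nnegrE ?addr_ge0 ?(ltW e0)//.
    exact: ler_distD.
  rewrite (le_trans (powR_add_le _ _ _))// ler_wpM2l ?powR_ge0// lerD2l.
  by apply: ge0_ler_powR; rewrite ?nnegrE ?(ltW e0)// (le_trans _ mA).
rewrite EFin_integralZ ?powR_ge0//; last 2 first.
- by mfun.
- by move=> y; rewrite addr_ge0// mulr_ge0// powR_ge0.
rewrite EFinM -muleA; apply: lee_wpmul2l; first by rewrite lee_fin powR_ge0.
rewrite EFin_integralD//; last 4 first.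
- by mfun.
- by mfun.
- by move=> y; rewrite mulr_ge0// powR_ge0.
- by move=> y; rewrite mulr_ge0.
rewrite EFin_integralZ// EFinD ge0_muleDl ?lee_fin//; apply: leeD => //.
apply: (@le_trans _ _ (IN (cell Q) (fun y => `|b y - A| `^ e * w y)%R)).
  apply: EFin_integral_subset => //; first by mfun.
  by move=> y; rewrite mulr_ge0// powR_ge0.
apply: (le_trans hQ); rewrite /C1 [(_ * D)%:E]EFinM -muleA; apply: lee_wpmul2l => //.
by rewrite lee_fin mulr_ge0// powR_ge0.
Qed.

End john_nirenberg_ball.

(** * Tails of singular kernels *)

Section geometric.
Context {R : realType}.

Lemma sum_geometric_le (a mu : R) k : 0 <= a -> 0 <= mu < 1 ->
  \sum_(0 <= i < k) a * mu ^+ i <= a / (1 - mu).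
Proof.
move=> a0 /andP[mu0 mu1]; have m0 : 0 < 1 - mu by rewrite subr_gt0.
rewrite ler_pdivlMr// -mulr_sumr -mulrA ler_piMr//.
have -> : (\sum_(0 <= i < k) mu ^+ i) * (1 - mu) = 1 - mu ^+ k.
  elim: k => [|k IH]; first by rewrite big_geq// mul0r expr0 subrr.
  by rewrite big_nat_recr//= mulrDl IH exprS; ring.
by rewrite lerBlDr lerDl exprn_ge0.
Qed.

Lemma nneseries_geometric_le (a mu : R) : 0 <= a -> 0 <= mu < 1 ->
  (\sum_(k <oo) (a * mu ^+ k)%:E <= (a / (1 - mu))%:E)%E.
Proof.
move=> a0 mu01; have /andP[mu0 _] := mu01.
apply: lime_le.
  by apply: is_cvg_nneseries => k _ _; rewrite lee_fin mulr_ge0// exprn_ge0.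
by apply: nearW => k; rewrite sumEFin lee_fin; exact: sum_geometric_le.
Qed.

(* Bernoulli: (1/mu)^j >= 1 + j (1/mu - 1), so a linear factor is absorbed by
   passing from kappa = mu^2 to mu. *)
Lemma linear_geometric_le (kappa : R) : 0 < kappa < 1 -> exists C mu,
  [/\ 0 <= C, 0 <= mu < 1 & forall j, (j.+3)%:R * kappa ^+ j.+2 <= C * mu ^+ j].
Proof.
move=> /andP[k0 k1]; pose mu := Num.sqrt kappa.
have mu0 : 0 < mu by rewrite sqrtr_gt0.
have mu2 : mu ^+ 2 = kappa by rewrite sqr_sqrtr// ltW.
have mu1 : mu < 1 by rewrite -(@ltr_pXn2r _ 2)// ?nnegrE ?(ltW mu0)// mu2 expr1n.
pose d := mu^-1 - 1.
have d0 : 0 < d by rewrite subr_gt0 invf_gt1.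
have bern (j : nat) : 1 + j%:R * d <= (mu ^+ j)^-1.
  elim: j => [|j IH]; first by rewrite mul0r addr0 expr0 invr1.
  rewrite exprS invfM -natr1 mulrDl mul1r.
  have -> : mu^-1 = 1 + d by rewrite /d; ring.
  have j0 : 0 <= (j%:R : R) by [].
  apply: (@le_trans _ _ ((1 + d) * (1 + j%:R * d))); last by rewrite ler_wpM2l//; lra.
  have : 0 <= j%:R * d * d by rewrite !mulr_ge0// ltW.
  by clear -d0; lra.
exists (3 + 1 / d), mu; split.
- by rewrite addr_ge0// divr_ge0// ltW.
- by rewrite (ltW mu0).
move=> j; have mj0 : 0 < mu ^+ j by rewrite exprn_gt0.
have h : (j.+3)%:R * mu ^+ j <= 3 + 1 / d.
  rewrite -ler_pdivlMr// (_ : j.+3%:R = 3 + j%:R); last by rewrite -natrD.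
  have b := bern j.
  have e : (3 + 1 / d) / mu ^+ j = 3 * (mu ^+ j)^-1 + 1 / d * (mu ^+ j)^-1 by rewrite mulrDl.
  rewrite e; have j0 : 0 <= (j%:R : R) by [].
  have jd : 0 <= j%:R * d by rewrite mulr_ge0// ltW.
  apply: lerD; first by lra.
  rewrite div1r mulrC ler_pdivlMr//; lra.
apply: (@le_trans _ _ (j.+3%:R * kappa ^+ j)).
  by rewrite ler_wpM2l// ler_wiXn2l ?(ltW k0) ?(ltW k1)// !leqW.
by rewrite -mu2 expr2 exprMn mulrA ler_wpM2r// ltW.
Qed.

Lemma invr_le_mul (a b k : R) : 0 < a -> 0 < b -> b <= k * a -> a^-1 <= k * b^-1.
Proof. by move=> a0 b0 h; rewrite ler_pdivlMr// mulrC ler_pdivrMr. Qed.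

Lemma ler_mul_regroup (m a b c d k l : R) : 0 <= m -> 0 <= a -> 0 <= b -> 0 <= c ->
  0 <= d -> a * d <= k -> b <= l -> m * (a * b) * (c * d) <= m * k * l * c.
Proof.
move=> m0 a0 b0 c0 d0 adk bl.
have -> : m * (a * b) * (c * d) = m * (a * d) * b * c by ring.
rewrite ler_wpM2r//; apply: ler_pM; rewrite ?mulr_ge0//.
by rewrite ler_wpM2l.
Qed.

End geometric.

Section tail.
Context {R : realType} {n : nat}.
Local Notation Rn := 'rV[R]_n.
Local Notation leb := (@lebesgue_rV R n).
Local Notation IN E f := (\int[leb]_(x in E) (f x)%:E)%E.
Local Notation vol E := (fine (leb E)).
Local Notation wr w E := (fine (wmeasure w E)).
Variables (p q K lam : R) (w s : Rn -> R).
Hypothesis n0 : (0 < n)%N.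
Hypothesis H : dual_weights p q w s K.
Hypothesis lam01 : 0 < lam < 1.

(** [M] stands for the p-th power of the Morrey norm. A plain real bound on all balls is easier to
    carry through integrals than a supremum with a root. *)
Definition morrey_bound (f : Rn -> R) (M : R) := forall x r, 0 < r ->
  (IN (eball x r) (fun y => `|f y| `^ p * w y)%R <=
    (M * wr w (eball x r) `^ lam)%:E)%E.

Let mw := dw_mw H.
Let ms := dw_ms H.
Let w0 := dw_w0 H.
Let s0 := dw_s0 H.
Let pp := dw_p H.
Let qq := dw_q H.

Lemma hoelder_ball (f v : Rn -> R) M V x r : measurable_fun setT f ->
  measurable_fun setT v -> (forall y, 0 <= v y) -> 0 <= M -> 0 <= V -> 0 < r ->
  (IN (eball x r) (fun y => `|f y| `^ p * w y)%R <= M%:E)%E ->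
  (IN (eball x r) (fun y => v y `^ q * s y)%R <= V%:E)%E ->
  (IN (eball x r) (fun y => v y * `|f y|)%R <= (M `^ p^-1 * V `^ q^-1)%:E)%E.
Proof.
move=> mf mv v0 M0 V0 r0 hM hV.
have mB := measurable_eball x r.
have mnf : measurable_fun setT (fun y => `|f y|) by mfun.
have h := weighted_hoelder pp qq (dw_pq H) mB mw ms w0 s0 (dw_ae H) mnf mv
  (fun=> normr_ge0 _) v0.
under eq_integral do rewrite mulrC.
apply: (le_trans h); rewrite EFinM -!poweR_EFin.
have pi : 0 <= p^-1 by rewrite invr_ge0 ltW.
have qi : 0 <= q^-1 by rewrite invr_ge0 ltW.
have i1 : (0 <= IN (eball x r) (fun y => `|f y| `^ p * w y)%R)%E.
  by apply: EFin_integral_ge0 => y; rewrite mulr_ge0// powR_ge0.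
have i2 : (0 <= IN (eball x r) (fun y => v y `^ q * s y)%R)%E.
  by apply: EFin_integral_ge0 => y; rewrite mulr_ge0// powR_ge0.
apply: lee_pmul; rewrite ?poweR_ge0//.
- by apply: gt0_ler_poweR => //; rewrite in_itv/= ?andbT ?leey ?lee_fin ?i1 ?M0.
- by apply: gt0_ler_poweR => //; rewrite in_itv/= ?andbT ?leey ?lee_fin ?i2 ?V0.
Qed.

Lemma muckenhoupt_eball x r : 0 < r ->
  wr w (eball x r) `^ p^-1 * wr s (eball x r) `^ q^-1 <= K * vol (eball x r).
Proof.
move=> r0.
suff h : ((wr w (eball x r))%:E `^ p^-1 * (wr s (eball x r))%:E `^ q^-1 <=
    K%:E * (vol (eball x r))%:E)%E by rewrite -lee_fin; exact: h.
have mB := measurable_eball x r.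
rewrite -(wmeasure_sub_eball H mB (@subset_refl _ _)).
rewrite -(wmeasure_sub_eball (dual_weights_sym H) mB (@subset_refl _ _)).
rewrite -(lebesgue_sub_eball mB (@subset_refl _ _)).
exact: dw_muck H _ _ r0.
Qed.

Lemma annuli (x : Rn) r : 0 < r -> ~` eball x (2 * r) =
  \bigcup_j (eball x (2 ^+ j.+2 * r) `\` eball x (2 ^+ j.+1 * r)).
Proof.
move=> r0; apply/seteqP; split => y.
  move=> ny.
  have [m hm] : exists m, eball x (2 ^+ m.+1 * r) y.
    have := @cvg_geometric R 1 2^-1.
    rewrite ger0_norm ?invr_ge0// invf_lt1// ltr1n => /(_ isT).
    have d0 : 0 < r / (enorm (x - y) + 1).
      by rewrite divr_gt0// ltr_wpDl// enorm_ge0.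
    move/cvgr0Pnorm_lt => /(_ _ d0)[m _ hm]; exists m.
    have := hm m (leqnn m); rewrite /geometric/= mul1r exprVn.
    move=> /(le_lt_trans (ler_norm _)).
    have e0 : 0 < enorm (x - y) + 1 by rewrite ltr_wpDl// enorm_ge0.
    have t0 : 0 < 2 ^+ m :> R by rewrite exprn_gt0.
    rewrite ltr_pdivlMr// mulrC ltr_pdivrMr// => h.
    have : 0 <= r * 2 ^+ m by rewrite mulr_ge0// ltW.
    rewrite eballE exprS (_ : 2 * 2 ^+ m * r = 2 * (r * 2 ^+ m)); last by ring.
    by lra.
  elim: m hm => [|m IH] hm; first by rewrite expr1 in hm.
  have [h|h] := pselect (eball x (2 ^+ m.+1 * r) y); first exact: IH.
  by exists m.
move=> [j _ [_ nj]] /= yb; apply: nj.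
apply: eball_le yb; rewrite ler_pM2r// -[leLHS]expr1.
by rewrite ler_weXn2l// ler1n.
Qed.

Lemma trivIset_annuli (x : Rn) r : 0 < r ->
  trivIset setT (fun j => eball x (2 ^+ j.+2 * r) `\` eball x (2 ^+ j.+1 * r)).
Proof.
move=> r0; apply/trivIsetP => i j _ _.
wlog ij : i j / (i < j)%N.
  move=> h ne; have [ij|ji|/eqP] := ltngtP i j; first exact: h.
    by rewrite setIC; apply: h => //; rewrite eq_sym.
  by rewrite (negbTE ne).
move=> _; rewrite -subset0 => y [[yi _] [_ nj]]; apply: nj.
apply: eball_le yi; rewrite ler_pM2r//.
by rewrite ler_weXn2l// ler1n.
Qed.

(** The weight [v] is 1 for T and a deviation of b from a mean for the commutator; its q-means may
    grow linearly in j. On the j-th annulus the kernel is at most (2^(j+1) r)^(-n), and Hoelder and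
    A_p on the enclosing ball do the rest. *)
Lemma tail_bound (Cv : R) : 0 <= Cv -> exists C, 0 <= C /\
  forall (f v : Rn -> R) M x r, measurable_fun setT f -> measurable_fun setT v ->
  (forall y, 0 <= v y) -> 0 <= M -> 0 < r -> morrey_bound f M ->
  (forall j, (IN (eball x (2 ^+ j * r)) (fun y => v y `^ q * s y)%R <=
     ((Cv * j.+1%:R) `^ q * wr s (eball x (2 ^+ j * r)))%:E)%E) ->
  (IN (~` eball x (2 * r)) (fun y => v y * `|f y| / enorm (x - y) ^+ n)%R <=
    (C * M `^ p^-1 * wr w (eball x r) `^ ((lam - 1) / p))%:E)%E.
Proof.
move=> Cv0.
have [rho [/andP[rho0 rho1] hrho]] := reverse_doubling_iter n0 H.
have /andP[lam0 lam1] := lam01.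
(* The exponent (lam - 1) / p of the weights is -th, so reverse doubling yields the ratio rho^th <
   1. This is where lam < 1 is used. *)
pose th := (1 - lam) / p.
have th0 : 0 < th by rewrite divr_gt0// subr_gt0.
pose kappa := rho `^ th.
have kappa01 : 0 < kappa < 1.
  have e1 : 1 `^ th = 1 :> R by rewrite powR1.
  rewrite powR_gt0//= -[ltRHS]e1.
  by apply: gt0_ltr_powR; rewrite ?nnegrE ?(ltW rho0).
have [C [mu [C0 mu01 hC]]] := linear_geometric_le kappa01.
have K0 := dw_K H.
(* 4^n relates the volume of the outer ball, of radius 2 a, to a^n, the bound of the kernel being
   a^(-n). *)
pose C1 := Cv * K * 4 ^+ n.
have C10 : 0 <= C1 by rewrite !mulr_ge0 ?exprn_ge0// ltW.
have mu1 : 0 < 1 - mu by case/andP: mu01; rewrite subr_gt0.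
exists (C1 * C / (1 - mu)); split; first by rewrite divr_ge0 ?(ltW mu1)//; exact: mulr_ge0.
move=> f v M x r mf mv v0 M0 r0 fM hv.
pose W j := wr w (eball x (2 ^+ j * r)).
have rj j : 0 < 2 ^+ j * r by rewrite mulr_gt0// exprn_gt0.
have W0 j : 0 < W j by exact: (fine_wmeasure_eball_gt0 n0 H x (rj j)).
pose g y := v y * `|f y| / enorm (x - y) ^+ n.
have mg : measurable_fun setT g.
  apply: measurable_funM; first by mfun.
  have -> : (fun y => (enorm (x - y) ^+ n)^-1) = (fun y => enorm (x - y) `^ (- n%:R)).
    by apply/funext => y; rewrite powR_invn// enorm_ge0.
  by apply: measurable_fun_powRl; exact: measurable_enorm_sub.
have g0 y : 0 <= g y.
  by rewrite /g mulr_ge0// ?invr_ge0 ?exprn_ge0 ?enorm_ge0// mulr_ge0.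
rewrite (annuli x r0) ge0_integral_bigcup; last 4 first.
- by move=> j; apply: measurableD; exact: measurable_eball.
- by apply/measurable_EFinP; exact: measurable_funTS.
- by move=> y _; rewrite lee_fin; exact: g0.
- exact: trivIset_annuli.
set MW := M `^ p^-1 * wr w (eball x r) `^ ((lam - 1) / p).
have MW0 : 0 <= MW by rewrite mulr_ge0// powR_ge0.
have -> : C1 * C / (1 - mu) * M `^ p^-1 * wr w (eball x r) `^ ((lam - 1) / p) =
    (C1 * MW * C) / (1 - mu) by rewrite /MW; ring.
have CMW : 0 <= C1 * MW * C by apply: mulr_ge0 => //; exact: mulr_ge0.
apply: le_trans (nneseries_geometric_le CMW mu01).
apply: lee_nneseries => j _; first by move=> *; exact: (EFin_integral_ge0 _ _ g0).
set a := 2 ^+ j.+1 * r.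
have a0 : 0 < a by exact: rj.
have aE : 2 ^+ j.+2 * r = 2 * a by rewrite /a exprS mulrA.
apply: (@le_trans _ _ (IN (eball x (2 ^+ j.+2 * r)) (fun y => (a ^+ n)^-1 * (v y * `|f y|))%R)).
  apply: (@le_trans _ _ (IN (eball x (2 ^+ j.+2 * r) `\` eball x a)
      (fun y => (a ^+ n)^-1 * (v y * `|f y|))%R)).
    apply: EFin_integral_le => //.
    - by apply: measurableD; exact: measurable_eball.
    - by mfun.
    move=> y [_]; rewrite eballE => /negP; rewrite -leNgt => ay.
    rewrite /g mulrC ler_wpM2r ?mulr_ge0// lef_pV2 ?posrE ?exprn_gt0//.
      by rewrite lerXn2r ?nnegrE ?(ltW a0)// enorm_ge0.
    exact: lt_le_trans ay.
  apply: EFin_integral_subset => //.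
  - by apply: measurableD; exact: measurable_eball.
  - exact: measurable_eball.
  - by mfun.
  - by move=> y; rewrite !mulr_ge0// invr_ge0 exprn_ge0// ltW.
rewrite EFin_integralZ//; last 4 first.
- exact: measurable_eball.
- by mfun.
- by move=> y; rewrite mulr_ge0.
- by rewrite invr_ge0 exprn_ge0// ltW.
have S0 : 0 <= wr s (eball x (2 ^+ j.+2 * r)) by exact: (fine_wmeasure_ge0 (dual_weights_sym H)).
have := hoelder_ball mf mv v0 _ _ (rj j.+2) (fM x _ (rj _)) (hv _).
rewrite -/(W j.+2) => /(_ _ _)h.
apply: (@le_trans _ _ (((a ^+ n)^-1)%:E * ((M * W j.+2 `^ lam) `^ p^-1 *
     ((Cv * j.+3%:R) `^ q * wr s (eball x (2 ^+ j.+2 * r))) `^ q^-1)%:E)%E).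
  apply: lee_wpmul2l; first by rewrite lee_fin invr_ge0 exprn_ge0// ltW.
  apply: h; first by rewrite mulr_ge0// powR_ge0.
  by rewrite mulr_ge0// powR_ge0.
rewrite -EFinM lee_fin.
rewrite (@powRM _ M) ?powR_ge0// (@powRM _ (_ `^ q)) ?powR_ge0// -!powRrM.
rewrite mulfV ?gt_eqF// powRr1 ?mulr_ge0//.
have hm := muckenhoupt_eball x (rj j.+2).
(* The first factor completes the A_p product with the dual weight, the second one decays in j. *)
have WE : W j.+2 `^ (lam / p) = W j.+2 `^ p^-1 * W j.+2 `^ ((lam - 1) / p).
  rewrite -powRD; last by apply/implyP => _; rewrite gt_eqF.
  by congr (_ `^ _); field; rewrite gt_eqF.
have hW : W j.+2 `^ ((lam - 1) / p) <= kappa ^+ j.+2 * wr w (eball x r) `^ ((lam - 1) / p).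
  have := hrho x r j.+2 r0; rewrite -/(W j.+2) => h1.
  have Wr0 := fine_wmeasure_eball_gt0 n0 H x r0.
  have e1 : (lam - 1) / p = - th by rewrite /th -mulNr opprB.
  rewrite e1 !powRN.
  have -> : kappa ^+ j.+2 = (rho ^+ j.+2) `^ th.
    by rewrite /kappa -powR_mulrn ?powR_ge0// -powRrM mulrC powRrM powR_mulrn// ltW.
  have R0 : 0 < rho ^+ j.+2 by rewrite exprn_gt0.
  apply: invr_le_mul; [exact: powR_gt0|exact: powR_gt0|].
  rewrite -(powRM th (ltW R0) (ltW (W0 _))).
  apply: ge0_ler_powR; rewrite ?nnegrE.
  - exact: ltW.
  - exact: ltW.
  - by apply: mulr_ge0; exact: ltW.
  - exact: h1.
rewrite WE.
have an : 0 < a ^+ n by rewrite exprn_gt0.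
have hv2 : vol (eball x (2 ^+ j.+2 * r)) <= 4 ^+ n * a ^+ n.
  apply: (le_trans (vol_le x (rj j.+2))).
  by rewrite aE mulrA -exprMn (_ : 2 * 2 = 4 :> R)//; rewrite -natrM.
have j30 : 0 <= j.+3%:R :> R by [].
apply: (@le_trans _ _ ((a ^+ n)^-1 * (M `^ p^-1 * (K * (4 ^+ n * a ^+ n)) *
   (kappa ^+ j.+2 * wr w (eball x r) `^ ((lam - 1) / p)) * (Cv * j.+3%:R)))).
  rewrite ler_wpM2l ?invr_ge0 ?(ltW an)//.
  apply: ler_mul_regroup; [exact: powR_ge0|exact: powR_ge0|exact: powR_ge0|
    exact: mulr_ge0|exact: powR_ge0| |exact: hW].
  by apply: (le_trans hm); rewrite ler_wpM2l ?(ltW K0).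
have -> : (a ^+ n)^-1 * (M `^ p^-1 * (K * (4 ^+ n * a ^+ n)) *
   (kappa ^+ j.+2 * wr w (eball x r) `^ ((lam - 1) / p)) * (Cv * j.+3%:R)) =
   C1 * MW * (j.+3%:R * kappa ^+ j.+2).
  by rewrite /C1 /MW; field; rewrite gt_eqF.
rewrite -[leRHS]mulrA; apply: ler_wpM2l; first exact: mulr_ge0.
exact: hC.
Qed.

End tail.

(** * Operators with a kernel bound *)

Section kernel_operator.
Context {R : realType} {n : nat}.
Local Notation Rn := 'rV[R]_n.
Local Notation leb := (@lebesgue_rV R n).
Local Notation IN E f := (\int[leb]_(x in E) (f x)%:E)%E.
Local Notation wr w E := (fine (wmeasure w E)).
Variables (p q K lam : R) (w s : Rn -> R).
Implicit Types (f g u v : Rn -> R) (x y : Rn) (c M r t : R).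
Hypothesis n0 : (0 < n)%N.
Hypothesis H : dual_weights p q w s K.
Hypothesis lam01 : 0 < lam < 1.
Local Notation morrey_bound := (morrey_bound p lam w).

Variables (T : (Rn -> R) -> (Rn -> R)) (kap : Rn -> Rn -> R) (Cu Cv : R).
Hypothesis Tsub : sublinear_on measurable_functions T.
Hypothesis Tsize : size_condition T.
Hypothesis mkap : forall x, measurable_fun setT (kap x).
Hypotheses (Cu0 : 0 <= Cu) (Cv0 : 0 <= Cv).
(** The two bounds are asymmetric on purpose: [u] depends on the point x of the ball and is
    integrated over that ball alone, while [v] depends on y and has to be controlled on all
    dilates. *)
Hypothesis kap_le : forall x0 r, 0 < r -> exists u v : Rn -> R,
  [/\ measurable_fun setT u /\ (forall x, 0 <= u x),
      measurable_fun setT v /\ (forall x, 0 <= v x),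
      forall x y, `|kap x y| <= u x + v y,
      (IN (eball x0 r) (fun x => u x `^ p * w x)%R <=
         Cu%:E * wmeasure w (eball x0 r))%E &
      forall j, (IN (eball x0 (2 ^+ j * r)) (fun y => v y `^ q * s y)%R <=
        ((Cv * j.+1%:R) `^ q * wr s (eball x0 (2 ^+ j * r)))%:E)%E].

(* The case kap = 1 is T itself, and kap x y = b x - b y is the commutator. *)
Definition kernel_op (f : Rn -> R) : Rn -> R :=
  fun x => T (fun y => kap x y * f y) x.
Local Notation N := kernel_op.

Let mw := dw_mw H.
Let ms := dw_ms H.
Let w0 := dw_w0 H.
Let s0 := dw_s0 H.
Let pp := dw_p H.
Let qq := dw_q H.
Let Hs := dual_weights_sym H.

Lemma measurable_kap_mul x f : measurable_fun setT f ->
  measurable_functions (fun y => kap x y * f y).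
Proof. by move=> mf; apply: measurable_funM. Qed.

Lemma kernel_opD f g x : measurable_fun setT f -> measurable_fun setT g ->
  `|N (fun y => f y + g y) x| <= `|N f x| + `|N g x|.
Proof.
move=> mf mg; rewrite /kernel_op.
have -> : (fun y => kap x y * (f y + g y)) =
    (fun y => (fun y => kap x y * f y) y + (fun y => kap x y * g y) y).
  by apply/funext => y; rewrite mulrDr.
by have [h _] := Tsub; apply: h; exact: measurable_kap_mul.
Qed.

Lemma kernel_opZ c f x : measurable_fun setT f ->
  `|N (fun y => c * f y) x| = `|c| * `|N f x|.
Proof.
move=> mf; rewrite /kernel_op.
have -> : (fun y => kap x y * (c * f y)) = (fun y => c * (fun y => kap x y * f y) y).
  by apply/funext => y; rewrite mulrCA.
by have [_ h] := Tsub; apply: h; exact: measurable_kap_mul.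
Qed.

(** The reverse triangle inequality, homogeneity at -1 giving the second half. It is the only
    comparison of values that a sublinear operator allows. *)
Lemma kernel_op_dist f g x : measurable_fun setT f -> measurable_fun setT g ->
  `| `|N f x| - `|N g x| | <= `|N (fun y => f y - g y) x|.
Proof.
move=> mf mg.
have mfg : measurable_fun setT (fun y => f y - g y) by mfun.
have mng : measurable_fun setT (fun y => -1 * (f y - g y)) by mfun.
have h1 := kernel_opD x mfg mg.
have e1 : (fun y => f y - g y + g y) = f by apply/funext => y; rewrite subrK.
rewrite e1 in h1.
have h2 := kernel_opD x mng mf.
have e2 : (fun y => -1 * (f y - g y) + f y) = g by apply/funext => y; ring.
rewrite e2 kernel_opZ// normrN1 mul1r in h2.
by rewrite ler_norml; lra.
Qed.

Lemma measurable_inv_enorm (x : Rn) : measurable_fun setT (fun y => (enorm (x - y) ^+ n)^-1).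
Proof.
have -> : (fun y => (enorm (x - y) ^+ n)^-1) = (fun y => enorm (x - y) `^ (- n%:R)).
  by apply/funext => y; rewrite powR_invn// enorm_ge0.
by apply: measurable_fun_powRl; exact: measurable_enorm_sub.
Qed.

Lemma integral_supp (g : Rn -> R) E : measurable E ->
  (forall y, ~ E y -> g y = 0) -> IN setT g = IN E g.
Proof.
move=> mE g0; rewrite (EFin_integral_indic leb g mE); apply: eq_integral => y _; congr EFin.
rewrite indicE; have [yE|yE] := boolP (y \in E); first by rewrite mulr1.
by rewrite mulr0 g0// => /mem_set yE'; rewrite yE' in yE.
Qed.

Lemma hoelder_ball_lty (f v : Rn -> R) M x r : measurable_fun setT f ->
  measurable_fun setT v -> (forall y, 0 <= v y) -> 0 < r ->
  0 <= M -> morrey_bound f M ->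
  (IN (eball x r) (fun y => v y `^ q * s y)%R < +oo)%E ->
  (IN (eball x r) (fun y => v y * `|f y|)%R < +oo)%E.
Proof.
move=> mf mv v0 r0 M0 fM Vfin.
have V0 : (0 <= IN (eball x r) (fun y => v y `^ q * s y)%R)%E.
  by apply: EFin_integral_ge0 => y; rewrite mulr_ge0// powR_ge0.
have VE : (IN (eball x r) (fun y => v y `^ q * s y)%R =
    (fine (IN (eball x r) (fun y => v y `^ q * s y)%R))%:E)%E.
  by rewrite fineK// ge0_fin_numE.
have MW0 : 0 <= M * wr w (eball x r) `^ lam by rewrite mulr_ge0// powR_ge0.
have := hoelder_ball H mf mv v0 MW0 (fine_ge0 V0) r0 (fM x r r0).
by rewrite -VE => /(_ (lexx _))/le_lt_trans; apply; exact: ltry.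
Qed.

(** The size condition asks for an integrable argument; that [kap x * f] is integrable follows from
    the Morrey bound by Hoelder, since [f] vanishes outside a ball. *)
Lemma kernel_op_size : exists C, 0 <= C /\ forall f M r x t,
  measurable_fun setT f -> 0 <= M -> morrey_bound f M -> 0 < r ->
  (forall y, ~ eball 0 r y -> f y = 0) ->
  0 < t -> (forall y, eball x t y -> f y = 0) ->
  ((`|N f x|)%:E <= C%:E * IN setT (fun y => `|kap x y * f y| / enorm (x - y) ^+ n)%R)%E.
Proof.
have [C hC] := Tsize; exists `|C|; split => // f M r x t mf M0 fM r0 fr t0 ft.
pose g y := kap x y * f y.
have mg : measurable_fun setT g by exact: measurable_kap_mul.
have gr y : ~ eball 0 r y -> g y = 0 by move=> /fr fy; rewrite /g fy mulr0.
have gt y : eball x t y -> g y = 0 by move=> /ft fy; rewrite /g fy mulr0.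
have mB : measurable (eball (0 : Rn) r) by exact: measurable_eball.
have ig : leb.-integrable setT (EFin \o g).
  apply/integrableP; split; first exact/measurable_EFinP.
  rewrite [ltLHS](_ : _ = IN (eball 0 r) (fun y => `|g y|)); last first.
    by apply: integral_supp => // y /gr ->; rewrite normr0.
  have [u [v [[mu u0] [mv v0] kuv _ hv]]] := kap_le 0 r0.
  apply: (@le_lt_trans _ _ (IN (eball 0 r) (fun y => u x * `|f y| + v y * `|f y|)%R)).
    apply: EFin_integral_le => //; [by mfun|by mfun|].
    by move=> y _; rewrite /g normrM -mulrDl ler_wpM2r.
  rewrite EFin_integralD//; last 4 first.
  - by mfun.
  - by mfun.
  - by move=> y; rewrite mulr_ge0.
  - by move=> y; rewrite mulr_ge0.
  have h0 := hv 0%N; rewrite expr0 mul1r in h0.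
  apply: lte_add_pinfty.
    (* Here x is fixed, so u x is a constant in the variable y. *)
    apply: (hoelder_ball_lty (v := fun=> u x) mf _ _ r0 M0 fM) => //.
    rewrite EFin_integralZ ?powR_ge0//.
    rewrite -/(wmeasure s _) (wmeasure_sub_eball Hs mB (@subset_refl _ _)).
    by rewrite -EFinM ltry.
  apply: (hoelder_ball_lty (v := v) mf mv v0 r0 M0 fM).
  exact: le_lt_trans h0 (ltry _).
have := hC g ig (compact_supp gr) x (notin_supp t0 gt).
move=> /le_trans; apply; apply: lee_wpmul2r.
  apply: EFin_integral_ge0 => y; rewrite mulr_ge0// invr_ge0 exprn_ge0// enorm_ge0 //.
by rewrite lee_fin ler_norm.
Qed.

Lemma kernel_tail : exists C, 0 <= C /\ forall f M x0 r,
  measurable_fun setT f -> 0 <= M -> morrey_bound f M -> 0 < r ->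
  exists u : Rn -> R, [/\ measurable_fun setT u, forall x, 0 <= u x,
    (IN (eball x0 r) (fun x => u x `^ p * w x)%R <=
         Cu%:E * wmeasure w (eball x0 r))%E &
    forall x, (IN (~` eball x0 (2 * r))
        (fun y => `|kap x y * f y| / enorm (x0 - y) ^+ n)%R <=
      (C * (u x + 1) * M `^ p^-1 * wr w (eball x0 r) `^ ((lam - 1) / p))%:E)%E].
Proof.
(* [Cv + 1] covers both uses of [tail_bound]: for [v], and for the constant 1 that accompanies u
   x. *)
have Cv1 : 0 <= Cv + 1 by rewrite addr_ge0.
have [C [C0 hC]] := tail_bound n0 H lam01 Cv1.
exists C; split => // f M x0 r mf M0 fM r0.
have [u [v [[mu u0] [mv v0] kuv hu hv]]] := kap_le x0 r0.
exists u; split => // x.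
have mE := measurableC (measurable_eball x0 (2 * r)).
have mi := measurable_inv_enorm x0.
have i0 (y : Rn) : 0 <= (enorm (x0 - y) ^+ n)^-1 by rewrite invr_ge0 exprn_ge0// enorm_ge0.
have S0 j : 0 <= wr s (eball x0 (2 ^+ j * r)) by exact: (fine_wmeasure_ge0 Hs).
have hv1 : (IN (~` eball x0 (2 * r)) (fun y => v y * `|f y| / enorm (x0 - y) ^+ n)%R <=
    (C * M `^ p^-1 * wr w (eball x0 r) `^ ((lam - 1) / p))%:E)%E.
  apply: hC => // j; apply: (le_trans (hv j)); rewrite lee_fin ler_wpM2r//.
  apply: ge0_ler_powR; rewrite ?nnegrE ?(ltW qq) ?mulr_ge0//.
  by rewrite ler_wpM2r// lerDl.
have h1 : (IN (~` eball x0 (2 * r)) (fun y => 1 * `|f y| / enorm (x0 - y) ^+ n)%R <=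
    (C * M `^ p^-1 * wr w (eball x0 r) `^ ((lam - 1) / p))%:E)%E.
  apply: (hC f (fun=> 1)) => // j.
  have mBj := measurable_eball x0 (2 ^+ j * r).
  under eq_integral do rewrite powR1 mul1r.
  rewrite -/(wmeasure s _) (wmeasure_sub_eball Hs mBj (@subset_refl _ _)) lee_fin.
  rewrite ler_peMl//.
  have e1 : 1 `^ q = 1 :> R by rewrite powR1.
  rewrite -[leLHS]e1; apply: ge0_ler_powR; rewrite ?nnegrE ?(ltW qq) ?mulr_ge0//.
  have : 1 <= j.+1%:R :> R by rewrite ler1n.
  have h0 : 0 <= Cv * j.+1%:R by rewrite mulr_ge0.
  by rewrite mulrDl mul1r; lra.
set A := C * M `^ p^-1 * _ in hv1 h1.
have -> : C * (u x + 1) * M `^ p^-1 * wr w (eball x0 r) `^ ((lam - 1) / p) =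
  u x * A + A by rewrite /A; ring.
apply: (@le_trans _ _ (IN (~` eball x0 (2 * r)) (fun y =>
   u x * (1 * `|f y| / enorm (x0 - y) ^+ n) + v y * `|f y| / enorm (x0 - y) ^+ n)%R)).
  apply: EFin_integral_le => //.
  - by have mk := mkap x; mfun.
  - by mfun.
  - by move=> y; rewrite mulr_ge0.
  move=> y _; rewrite mul1r mulrA -!mulrDl ler_wpM2r// normrM.
  by rewrite ler_wpM2r.
rewrite EFin_integralD//; last 4 first.
- by mfun.
- by mfun.
- by move=> y; rewrite !mulr_ge0.
- by move=> y; rewrite !mulr_ge0.
rewrite EFin_integralZ//; last 2 first.
- by mfun.
- by move=> y; rewrite !mulr_ge0.
rewrite EFinD EFinM; apply: leeD => //.
by apply: lee_wpmul2l; first by rewrite lee_fin.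
Qed.

Hypothesis Nbounded : bounded_on (Lp_norm p w) N.

Lemma kernel_op_Lp : exists C, 0 <= C /\ forall f, measurable_fun setT f ->
  (IN setT (fun x => `|f x| `^ p * w x)%R < +oo)%E ->
  measurable_fun setT (N f) /\
  (IN setT (fun x => `|N f x| `^ p * w x)%R <=
   C%:E * IN setT (fun x => `|f x| `^ p * w x)%R)%E.
Proof.
have [C hC] := Nbounded; exists (`|C| `^ p); split; first exact: powR_ge0.
move=> f mf ffin.
have p1 : 0 <= p^-1 by rewrite invr_ge0 ltW.
have [|mN hN] := hC f; first by split => //; exact: poweR_lty.
split => //; move: hN; rewrite /Lp_norm.
set a := integral _ _ _; set b := integral _ _ _ => hN.
have a0 : (0 <= a)%E by apply: EFin_integral_ge0 => x; rewrite mulr_ge0// powR_ge0.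
have b0 : (0 <= b)%E by apply: EFin_integral_ge0 => x; rewrite mulr_ge0// powR_ge0.
have root (c : \bar R) : (0 <= c)%E -> ((c `^ p^-1) `^ p = c)%E.
  by move=> c0; rewrite -poweRrM mulVf ?gt_eqF// poweRe1.
have h : (a `^ p^-1 <= `|C|%:E * b `^ p^-1)%E.
  apply: (le_trans hN); apply: lee_wpmul2r; first exact: poweR_ge0.
  by rewrite lee_fin ler_norm.
rewrite -(root a a0) -{1}(root b b0) -poweR_EFin -poweRM ?lee_fin ?poweR_ge0//.
apply: gt0_ler_poweR; rewrite ?(ltW pp) ?in_itv/= ?andbT ?leey ?poweR_ge0//.
by rewrite mule_ge0 ?lee_fin// poweR_ge0.
Qed.

Lemma Lp_lty f M r : morrey_bound f M -> 0 < r ->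
  (forall y, ~ eball 0 r y -> f y = 0) ->
  (IN setT (fun x => `|f x| `^ p * w x)%R < +oo)%E.
Proof.
move=> fM r0 fr.
rewrite (@integral_supp (fun x => `|f x| `^ p * w x) (eball 0 r)).
- exact: le_lt_trans (fM 0 r r0) (ltry _).
- exact: measurable_eball.
- by move=> y /fr ->; rewrite normr0 powR0 ?gt_eqF// mul0r.
Qed.

(** For x in the ball and y outside its double, |x0 - y| <= 2 |x - y|. The factor 2^n recentres the
    kernel at x0, after which x enters the tail only through [kap]. *)
Lemma kernel_op_size_far : exists C, 0 <= C /\ forall f M rho x0 r x,
  measurable_fun setT f -> 0 <= M -> morrey_bound f M -> 0 < rho ->
  (forall y, ~ eball 0 rho y -> f y = 0) -> 0 < r ->
  (forall y, eball x0 (2 * r) y -> f y = 0) -> eball x0 r x ->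
  ((`|N f x|)%:E <= C%:E * IN (~` eball x0 (2 * r))
    (fun y => `|kap x y * f y| / enorm (x0 - y) ^+ n)%R)%E.
Proof.
have [C1 [C10 h1]] := kernel_op_size.
exists (C1 * 2 ^+ n); split; first by rewrite !mulr_ge0// exprn_ge0.
move=> f M rho x0 r x mf M0 fM rho0 frho r0 f0 xr.
have xr' : eball x r `<=` eball x0 (2 * r).
  by apply: eball_subset; move: xr; rewrite eballE; lra.
have := h1 f M rho x r mf M0 fM rho0 frho r0 (fun y xy => f0 y (xr' y xy)).
set E := ~` eball x0 (2 * r).
have mE : measurable E by apply: measurableC; exact: measurable_eball.
have out y : ~ E y -> `|kap x y * f y| / enorm (x - y) ^+ n = 0.
  by move=> /contrapT/f0 ->; rewrite mulr0 normr0 mul0r.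
rewrite (integral_supp mE out).
move=> h; apply: (le_trans h).
have mk := mkap x.
have i0 (z y : Rn) : 0 <= (enorm (z - y) ^+ n)^-1 by rewrite invr_ge0 exprn_ge0// enorm_ge0.
have mi z := measurable_inv_enorm z.
rewrite EFinM -muleA.
apply: lee_wpmul2l; first by rewrite lee_fin.
have m1 : measurable_fun setT (fun y => `|kap x y * f y| / enorm (x0 - y) ^+ n).
  by apply: measurable_funM => //; mfun.
rewrite -EFin_integralZ//; last by move=> y; exact: mulr_ge0.
apply: EFin_integral_le => //.
- by apply: measurable_funM => //; mfun.
- by apply: measurable_funM.
- by move=> y; exact: mulr_ge0.
move=> y yE; rewrite mulrCA; apply: ler_wpM2l => //.
have yr : 2 * r <= enorm (x0 - y).
  by move: yE; rewrite /E /setC /= eballE => /negP; rewrite -leNgt.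
have e0 : 0 < enorm (x0 - y) by apply: lt_le_trans yr; rewrite mulr_gt0.
have tri := enorm_triangle x x0 y.
have e1 : enorm (x0 - y) / 2 <= enorm (x - y).
  by move: xr; rewrite eballE; lra.
have e2 : 0 < enorm (x - y) by apply: lt_le_trans e1; rewrite divr_gt0.
rewrite -(ler_pM2r (exprn_gt0 n e2)) mulVf ?gt_eqF ?exprn_gt0//.
rewrite -exprVn -!exprMn -[leLHS](expr1n _ n).
apply: lerXn2r; rewrite ?nnegrE// ?mulr_ge0 ?invr_ge0 ?(ltW e0) ?(ltW e2)//.
by rewrite mulrAC ler_pdivlMr// mul1r; lra.
Qed.

Lemma kernel_op_far_pointwise : exists C, 0 <= C /\ forall f M rho x0 r,
  measurable_fun setT f -> 0 <= M -> morrey_bound f M -> 0 < rho ->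
  (forall y, ~ eball 0 rho y -> f y = 0) -> 0 < r ->
  (forall y, eball x0 (2 * r) y -> f y = 0) ->
  exists u, [/\ measurable_fun setT u, forall x, 0 <= u x,
    (IN (eball x0 r) (fun x => u x `^ p * w x)%R <=
         Cu%:E * wmeasure w (eball x0 r))%E &
    forall x, eball x0 r x -> `|N f x| <=
      C * (u x + 1) * M `^ p^-1 * wr w (eball x0 r) `^ ((lam - 1) / p)].
Proof.
have [C1 [C10 h1]] := kernel_op_size_far; have [C2 [C20 h2]] := kernel_tail.
exists (C1 * C2); split; first exact: mulr_ge0.
move=> f M rho x0 r mf M0 fM rho0 frho r0 f0.
have [u [mu u0 hu hx]] := h2 f M x0 r mf M0 fM r0.
exists u; split => // x xr; rewrite -lee_fin.
apply: (le_trans (h1 f M rho x0 r x mf M0 fM rho0 frho r0 f0 xr)).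
rewrite -!mulrA EFinM; apply: lee_wpmul2l; first by rewrite lee_fin.
by apply: (le_trans (hx x)); rewrite -!mulrA.
Qed.

Lemma kernel_op_far : exists C, 0 <= C /\ forall f M rho x0 r,
  measurable_fun setT f -> 0 <= M -> morrey_bound f M -> 0 < rho ->
  (forall y, ~ eball 0 rho y -> f y = 0) -> 0 < r ->
  (forall y, eball x0 (2 * r) y -> f y = 0) ->
  (IN (eball x0 r) (fun x => `|N f x| `^ p * w x)%R <=
   (C * M * wr w (eball x0 r) `^ lam)%:E)%E.
Proof.
have [C [C0 hC]] := kernel_op_far_pointwise.
have [C' [C'0 hL]] := kernel_op_Lp.
exists (C `^ p * (2 `^ p * (Cu + 1))); split.
  by rewrite !mulr_ge0 ?powR_ge0// addr_ge0.
move=> f M rho x0 r mf M0 fM rho0 frho r0 f0.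
have [mN _] := hL f mf (Lp_lty fM rho0 frho).
have [u [mu u0 hu hx]] := hC f M rho x0 r mf M0 fM rho0 frho r0 f0.
have mB := measurable_eball x0 r.
set W := wr w (eball x0 r) in hx *.
have W0 : 0 < W by exact: (fine_wmeasure_eball_gt0 n0 H x0 r0).
have WE := wmeasure_sub_eball H mB (@subset_refl _ (eball x0 r)).
(* The p-th power of [A] contains W^(lam - 1); integration over the ball supplies the missing factor
   W. *)
pose A := C * (M `^ p^-1 * W `^ ((lam - 1) / p)).
have A0 : 0 <= A by rewrite mulr_ge0// mulr_ge0// powR_ge0.
have Ap : A `^ p = C `^ p * (M * W `^ (lam - 1)).
  rewrite /A powRM// ?mulr_ge0 ?powR_ge0// powRM ?powR_ge0//.
  rewrite -!powRrM mulVf ?gt_eqF// powRr1// -mulrA mulVf ?gt_eqF// mulr1.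
  by [].
apply: (@le_trans _ _ (IN (eball x0 r) (fun x => (A `^ p * 2 `^ p) * (u x `^ p * w x + w x))%R)).
  apply: EFin_integral_le => //; [by mfun|by mfun|by move=> x; rewrite mulr_ge0// powR_ge0|].
  move=> x /hx h.
  rewrite (_ : u x `^ p * w x + w x = (u x `^ p + 1) * w x); last by ring.
  rewrite mulrA ler_wpM2r//.
  apply: (@le_trans _ _ ((A * (u x + 1)) `^ p)).
    apply: ge0_ler_powR; rewrite ?nnegrE ?(ltW pp)//.
      by apply: mulr_ge0 => //; exact: addr_ge0.
    by apply: (le_trans h); rewrite /A le_eqVlt; apply/orP; left; apply/eqP; ring.
  rewrite powRM ?addr_ge0// -mulrA ler_wpM2l ?powR_ge0//.
  have := powR_add_le pp (u0 x) ler01.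
  by rewrite powR1.
rewrite EFin_integralZ//; last 3 first.
- by mfun.
- by move=> x; rewrite addr_ge0// mulr_ge0// powR_ge0.
- by rewrite mulr_ge0// powR_ge0.
rewrite EFin_integralD//; last 2 first.
- by mfun.
- by move=> x; rewrite mulr_ge0// powR_ge0.
rewrite -/(wmeasure w (eball x0 r)).
apply: (@le_trans _ _ ((A `^ p * 2 `^ p)%:E * ((Cu * W)%:E + W%:E))%E).
  apply: lee_wpmul2l; first by rewrite lee_fin mulr_ge0// powR_ge0.
  by rewrite EFinM -WE; apply: leeD.
rewrite -EFinD -EFinM lee_fin Ap.
have -> : W `^ lam = W `^ (lam - 1) * W.
  rewrite -{3}(powRr1 (ltW W0)) -powRD ?subrK//.
  by apply/implyP => _; rewrite gt_eqF.
by rewrite le_eqVlt; apply/orP; left; apply/eqP; ring.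
Qed.

Lemma morrey_bound_le f g M : measurable_fun setT f -> measurable_fun setT g ->
  (forall x, `|f x| <= `|g x|) -> morrey_bound g M -> morrey_bound f M.
Proof.
move=> mf mg fg gM x r r0; apply: le_trans (gM x r r0).
apply: EFin_integral_le; [exact: measurable_eball|by mfun|by mfun| |].
  by move=> y; rewrite mulr_ge0// powR_ge0.
move=> y _; rewrite ler_wpM2r//; apply: ge0_ler_powR; rewrite ?nnegrE ?(ltW pp)//.
Qed.

(** The radius [rho] makes the arguments admissible but does not enter the constant, so the bound
    holds for all truncations at once. *)
Lemma kernel_op_morrey : exists C, 0 <= C /\ forall f M rho,
  measurable_fun setT f -> 0 <= M -> morrey_bound f M -> 0 < rho ->
  (forall y, ~ eball 0 rho y -> f y = 0) ->
  measurable_fun setT (N f) /\ morrey_bound (N f) (C * M).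
Proof.
have [C1 [C10 h1]] := kernel_op_Lp; have [C2 [C20 h2]] := kernel_op_far.
(* The near part is bounded by a power of w(B(x0, 2 r)), which doubling with ratio 2 brings back to
   w(B(x0, r)). *)
have [D [D0 hD]] := doubling n0 H (ltr0Sn R 1).
exists (2 `^ p * (C1 * D `^ lam + C2)); split.
  by rewrite mulr_ge0 ?powR_ge0// addr_ge0// mulr_ge0// powR_ge0.
move=> f M rho mf M0 fM rho0 frho.
have [mN _] := h1 f mf (Lp_lty fM rho0 frho); split => // x0 r r0.
have r20 : 0 < 2 * r by rewrite mulr_gt0.
have mB := measurable_eball x0 r; have mB2 := measurable_eball x0 (2 * r).
have /andP[lam0 lam1] := lam01.
pose g y := f y * \1_(eball x0 (2 * r)) y.
pose h y := f y * \1_(~` eball x0 (2 * r)) y.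
have mg : measurable_fun setT g by rewrite /g; mfun.
have mh : measurable_fun setT h by rewrite /h; mfun; exact: measurableC.
have le_g y : `|g y| <= `|f y|.
  by rewrite /g indicE normrM; case: (_ \in _); rewrite ?normr1 ?normr0 ?mulr1 ?mulr0.
have le_h y : `|h y| <= `|f y|.
  by rewrite /h indicE normrM; case: (_ \in _); rewrite ?normr1 ?normr0 ?mulr1 ?mulr0.
have gM := morrey_bound_le mg mf le_g fM.
have hM := morrey_bound_le mh mf le_h fM.
have grho y : ~ eball 0 rho y -> g y = 0 by move=> /frho fy; rewrite /g fy mul0r.
have hrho y : ~ eball 0 rho y -> h y = 0 by move=> /frho fy; rewrite /h fy mul0r.
have h0 y : eball x0 (2 * r) y -> h y = 0.
  by move=> yB; rewrite /h indicE memNset ?mulr0// => /(_ yB).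
have fE : (fun y => g y + h y) = f.
  apply/funext => y; rewrite /g /h !indicE in_setC -mulrDr.
  by case: (_ \in _); rewrite /= ?addr0 ?add0r mulr1.
have [mNg hg] := h1 g mg (Lp_lty gM rho0 grho).
have [mNh _] := h1 h mh (Lp_lty hM rho0 hrho).
set W := wr w (eball x0 r).
have W0 : 0 < W by exact: (fine_wmeasure_eball_gt0 n0 H x0 r0).
apply: (@le_trans _ _ (IN (eball x0 r)
    (fun x => 2 `^ p * (`|N g x| `^ p * w x + `|N h x| `^ p * w x))%R)).
  apply: EFin_integral_le => //; [by mfun|by mfun|by move=> x; rewrite mulr_ge0// powR_ge0|].
  move=> x _; rewrite -mulrDl mulrA ler_wpM2r//.
  apply: (@le_trans _ _ ((`|N g x| + `|N h x|) `^ p)).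
    apply: ge0_ler_powR; rewrite ?nnegrE ?(ltW pp) ?addr_ge0//.
    by have := kernel_opD x mg mh; rewrite fE.
  exact: powR_add_le.
rewrite EFin_integralZ ?powR_ge0//; last 2 first.
- by mfun.
- by move=> x; rewrite addr_ge0// mulr_ge0// powR_ge0.
rewrite EFin_integralD//; last 4 first.
- by mfun.
- by mfun.
- by move=> x; rewrite mulr_ge0// powR_ge0.
- by move=> x; rewrite mulr_ge0// powR_ge0.
have -> : 2 `^ p * (C1 * D `^ lam + C2) * M * W `^ lam =
  2 `^ p * (C1 * (M * (D * W) `^ lam) + C2 * M * W `^ lam).
  by rewrite powRM ?(ltW D0) ?(ltW W0)//; ring.
rewrite EFinM; apply: lee_wpmul2l; first by rewrite lee_fin powR_ge0.
rewrite EFinD; apply: leeD; last exact: (h2 h M rho).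
apply: (@le_trans _ _ (IN setT (fun x => `|N g x| `^ p * w x)%R)).
  apply: EFin_integral_subset => //; first by mfun.
  by move=> x; rewrite mulr_ge0// powR_ge0.
apply: (le_trans hg); rewrite EFinM; apply: lee_wpmul2l; first by rewrite lee_fin.
rewrite (@integral_supp (fun x => `|g x| `^ p * w x) (eball x0 (2 * r)))//; last first.
  by move=> y yB; rewrite /g indicE memNset// mulr0 normr0 powR0 ?gt_eqF// mul0r.
apply: (le_trans (gM x0 _ r20)); rewrite lee_fin ler_wpM2l//.
apply: ge0_ler_powR; rewrite ?nnegrE ?(ltW lam0) ?mulr_ge0 ?(ltW D0) ?(ltW W0)//.
  exact: (fine_wmeasure_ge0 H).
apply: hD => //; apply: eball_le; lra.
Qed.

(** Both C I and a + C I are nondecreasing and bounded from index m1 on; their difference is a. *)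
Lemma cvgn_dist_le (a I : nat -> R) (C B : R) m1 :
  0 <= C -> (forall k, I k <= B) ->
  (forall m k, (m1 <= m)%N -> (m <= k)%N -> `|a k - a m| <= C * (I k - I m)) ->
  cvgn a.
Proof.
move=> C0 IB h.
pose v j := C * I (j + m1)%N; pose u j := a (j + m1)%N + v j.
have cv : cvgn v.
  apply: nondecreasing_is_cvgn.
    move=> i j ij; rewrite /v -subr_ge0 -mulrBr.
    by apply: le_trans (h _ _ (leq_addl _ _) _); rewrite ?leq_add2r.
  by exists (C * B) => _ [j _ <-]; rewrite /v ler_wpM2l.
have cu : cvgn u.
  apply: nondecreasing_is_cvgn.
    move=> i j ij; rewrite /u /v.
    have := h (i + m1)%N (j + m1)%N (leq_addl _ _).
    by rewrite leq_add2r => /(_ ij); rewrite ler_norml => /andP[+ _]; lra.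
  exists (a m1 + C * (B - I m1) + C * B) => _ [j _ <-]; rewrite /u.
  have h1 := h m1 (j + m1)%N (leqnn _) (leq_addl _ _).
  have h2 : C * I (j + m1)%N <= C * B by rewrite ler_wpM2l.
  by move: h1; rewrite ler_norml => /andP[_]; rewrite /v; lra.
have cuv : cvgn (u - v) by exact: is_cvgB.
have uvE : u - v = (fun j => a (j + m1)%N).
  by apply/funext => j; rewrite /u; change (a (j + m1)%N + v j - v j = a (j + m1)%N); rewrite addrK.
rewrite uvE in cuv; apply/cvg_ex; have [l hl] := (cvg_ex _).1 cuv.
by exists l; rewrite -(cvg_shiftn m1).
Qed.

Lemma trunc_le f k y : `|trunc f k y| <= `|f y|.
Proof.
by rewrite /trunc indicE normrM; case: (_ \in _);
  rewrite ?normr1 ?normr0 ?mulr1 ?mulr0.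
Qed.

Lemma measurable_trunc f k : measurable_fun setT f -> measurable_fun setT (trunc f k).
Proof. by move=> mf; rewrite /trunc; mfun; exact: measurable_eball. Qed.

(** The radius k + 1 instead of k is positive also for k = 0. *)
Lemma trunc_out f k y : ~ eball 0 (k%:R + 1) y -> trunc f k y = 0.
Proof.
move=> ny; rewrite /trunc indicE memNset ?mulr0// => yk; apply: ny.
by apply: eball_le yk; rewrite lerDl.
Qed.

Lemma trunc_in f k y : eball 0 k%:R y -> trunc f k y = f y.
Proof. by move=> yk; rewrite /trunc indicE mem_set ?mulr1. Qed.

(** Two late truncations agree near x, so the size condition bounds the change of modulus by the
    change of a tail integral, and these integrals increase to a finite limit by [kernel_tail]. *)
Lemma kernel_op_cvg f M x : measurable_fun setT f -> 0 <= M -> morrey_bound f M ->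
  cvgn (fun k => `|N (trunc f k) x|).
Proof.
move=> mf M0 fM.
have [C1 [C10 h1]] := kernel_op_size_far; have [C2 [C20 h2]] := kernel_tail.
(* [m0] exceeds |x|; truncations beyond 2 m0 differ only outside the double of a ball that contains
   x. *)
pose m0 := (Num.bound (enorm x)).+1; pose r : R := m0%:R.
have r0 : 0 < r by rewrite ltr0n.
have xr : eball 0 r x.
  rewrite eballE sub0r enormN /r (lt_le_trans (archi_boundP (enorm_ge0 x)))//.
  by rewrite ler_nat.
have [u [_ _ _ /(_ x) hx]] := h2 f M 0 r mf M0 fM r0.
set E := ~` eball 0 (2 * r) in hx.
have mE : measurable E by apply: measurableC; exact: measurable_eball.
set B := _ * _ in hx.
have mk := mkap x.
have i0 (z y : Rn) : 0 <= (enorm (z - y) ^+ n)^-1 by rewrite invr_ge0 exprn_ge0// enorm_ge0.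
have mi := measurable_inv_enorm 0.
pose G (g : Rn -> R) y := `|kap x y * g y| / enorm (0 - y) ^+ n.
have mG g : measurable_fun setT g -> measurable_fun setT (G g).
  by move=> mg; apply: measurable_funM => //; mfun.
have G0 g y : 0 <= G g y by apply: mulr_ge0.
have mt k := measurable_trunc k mf.
have Jfin k : (IN E (G (trunc f k)) <= B%:E)%E.
  apply: le_trans hx; apply: EFin_integral_le => //; [exact: mG|exact: mG|].
  move=> y _; apply: ler_wpM2r => //; rewrite [leLHS]normrM [leRHS]normrM.
  by apply: ler_wpM2l => //; exact: trunc_le.
have JE k : IN E (G (trunc f k)) = (fine (IN E (G (trunc f k))))%:E.
  rewrite fineK// ge0_fin_numE; last exact: EFin_integral_ge0.
  exact: le_lt_trans (Jfin k) (ltry _).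
apply: (@cvgn_dist_le _ (fun k => fine (IN E (G (trunc f k)))) C1 B (2 * m0)) => //.
  by move=> k; rewrite -lee_fin -JE.
move=> m k m1 mk'.
pose h y := trunc f k y - trunc f m y.
have mh : measurable_fun setT h by rewrite /h; mfun.
have mkR : m%:R <= k%:R :> R by rewrite ler_nat.
have hle y : `|h y| <= `|f y|.
  rewrite /h; have [ym|ym] := pselect (eball 0 m%:R y).
    by rewrite !trunc_in// ?subrr ?normr0//; exact: eball_le ym.
  by rewrite [trunc f m y]/trunc indicE (memNset ym) mulr0 subr0; exact: trunc_le.
have hM := morrey_bound_le mh mf hle fM.
have k0 : 0 < k%:R + 1 :> R by rewrite ltr_wpDl.
have hk y : ~ eball 0 (k%:R + 1) y -> h y = 0.
  move=> ny; rewrite /h !trunc_out ?subrr// => ym; apply: ny.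
  by apply: eball_le ym; rewrite lerD2r.
have hr y : eball 0 (2 * r) y -> h y = 0.
  move=> yr; have rm : 2 * r <= m%:R by rewrite /r -natrM ler_nat.
  have ym : eball 0 m%:R y by exact: eball_le yr.
  by rewrite /h !trunc_in ?subrr//; exact: eball_le ym.
have := h1 h M _ 0 r x mh M0 hM k0 hk r0 hr xr; rewrite -/(G h) -/E.
(* Exact additivity, as [trunc f m] and [h] live on disjoint sets; it turns the bound for [h] into a
   difference of two terms of one sequence. *)
have JD : IN E (G (trunc f k)) = (IN E (G (trunc f m)) + IN E (G h))%E.
  rewrite -EFin_integralD//; [|exact: mG|exact: mG].
  apply: eq_integral => y _; congr EFin; rewrite /G -mulrDl; congr (_ / _).
  rewrite (normrM _ (trunc f k y)) (normrM _ (trunc f m y)) (normrM _ (h y)).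
  rewrite -mulrDr; congr (_ * _); rewrite /h.
  have [ym|ym] := pselect (eball 0 m%:R y).
    by rewrite !trunc_in// ?subrr ?normr0 ?addr0//; exact: eball_le ym.
  by rewrite [trunc f m y]/trunc indicE (memNset ym) mulr0 subr0 normr0 add0r.
have hfin : IN E (G h) = (fine (IN E (G (trunc f k))) - fine (IN E (G (trunc f m))))%:E.
  have Gh0 : (0 <= IN E (G h))%E by exact: EFin_integral_ge0.
  have GhE : IN E (G h) = (fine (IN E (G h)))%:E.
    rewrite fineK// ge0_fin_numE//; apply: le_lt_trans (ltry (fine (IN E (G (trunc f k))))).
    by rewrite -JE JD leeDr//; exact: EFin_integral_ge0.
  rewrite JD GhE [X in (X + _)%E]JE -EFinD /=.
  by congr EFin; ring.
rewrite hfin -EFinM lee_fin; apply: le_trans.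
exact: kernel_op_dist.
Qed.

End kernel_operator.

(** * Extension by truncation *)

(** Continuity comes from the derivative of the power, available for l > 0 only; hence the separate
    case l = 0. *)
Lemma cvgn_powR {R : realType} (u : nat -> R) (l p : R) : 0 < p ->
  (forall k, 0 <= u k) -> u @ \oo --> l -> (fun k => u k `^ p) @ \oo --> l `^ p.
Proof.
move=> p0 u0 ul.
have l0 : 0 <= l.
  rewrite -(cvg_lim _ ul)//; apply: limr_ge; first by apply/cvg_ex; exists l.
  exact: nearW.
have [lp|] := ltP 0 l; last first.
  move=> l0'; have l00 : l = 0 by apply/eqP; rewrite eq_le l0' l0.
  rewrite l00 in ul *; rewrite powR0 ?gt_eqF//.
  apply/cvgr0Pnorm_lt => e e0.
  have e1 : 0 < e `^ p^-1 by exact: powR_gt0.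
  move/cvgr0Pnorm_lt : ul => /(_ _ e1); apply: filterS => k.
  rewrite !ger0_norm ?powR_ge0// => h.
  have -> : e = (e `^ p^-1) `^ p by rewrite -powRrM mulVf ?gt_eqF// powRr1// ltW.
  by apply: gt0_ltr_powR; rewrite ?nnegrE ?(ltW e1).
have cp : {for l, continuous (@powR R ^~ p)}.
  apply: differentiable_continuous; apply/derivable1_diffP.
  by apply: derivable_powR; rewrite in_itv/= lp.
exact: (continuous_cvg _ cp ul).
Qed.

Section morrey_extension.
Context {R : realType} {n : nat}.
Local Notation Rn := 'rV[R]_n.
Local Notation leb := (@lebesgue_rV R n).
Local Notation IN E f := (\int[leb]_(x in E) (f x)%:E)%E.
Local Notation wr w E := (fine (wmeasure w E)).
Variables (p q K lam : R) (w s : Rn -> R).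
Implicit Types (f g u v : Rn -> R) (x y : Rn) (c M r t : R).
Hypothesis n0 : (0 < n)%N.
Hypothesis H : dual_weights p q w s K.
Hypothesis lam01 : 0 < lam < 1.
Local Notation morrey_bound := (morrey_bound p lam w).
Variable N : (Rn -> R) -> (Rn -> R).
Hypothesis ND : forall f g x, measurable_fun setT f -> measurable_fun setT g ->
  `|N (fun y => f y + g y) x| <= `|N f x| + `|N g x|.
Hypothesis NZ : forall c f x, measurable_fun setT f ->
  `|N (fun y => c * f y) x| = `|c| * `|N f x|.
Hypothesis Ndist : forall f g x, measurable_fun setT f -> measurable_fun setT g ->
  `| `|N f x| - `|N g x| | <= `|N (fun y => f y - g y) x|.
Hypothesis NLp : exists C, 0 <= C /\ forall f, measurable_fun setT f ->
  (IN setT (fun x => `|f x| `^ p * w x)%R < +oo)%E ->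
  measurable_fun setT (N f) /\
  (IN setT (fun x => `|N f x| `^ p * w x)%R <=
   C%:E * IN setT (fun x => `|f x| `^ p * w x)%R)%E.
Hypothesis Nmorrey : exists C, 0 <= C /\ forall f M rho,
  measurable_fun setT f -> 0 <= M -> morrey_bound f M -> 0 < rho ->
  (forall y, ~ eball 0 rho y -> f y = 0) ->
  measurable_fun setT (N f) /\ morrey_bound (N f) (C * M).
Hypothesis Ncvg : forall f M x, measurable_fun setT f -> 0 <= M -> morrey_bound f M ->
  cvgn (fun k => `|N (trunc f k) x|).

Let mw := dw_mw H.
Let w0 := dw_w0 H.
Let pp := dw_p H.

Local Notation mnorm := (morrey_norm p lam w).
Local Notation space := Defs.space.

Lemma morrey_norm_le f M : 0 <= M -> morrey_bound f M -> (mnorm f <= (M `^ p^-1)%:E)%E.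
Proof.
move=> M0 fM; apply: ge_ereal_sup => _ [_ [x [r [r0 ->]]] <-].
have mB := measurable_eball x r.
have W0 := fine_wmeasure_eball_gt0 n0 H x r0.
rewrite (wmeasure_sub_eball H mB (@subset_refl _ _)) poweR_EFin.
have Wl : 0 < wr w (eball x r) `^ lam by exact: powR_gt0.
have I0 : (0 <= IN (eball x r) (fun y => `|f y| `^ p * w y)%R)%E.
  by apply: EFin_integral_ge0 => y; rewrite mulr_ge0// powR_ge0.
rewrite inver gt_eqF// -poweR_EFin; apply: gt0_ler_poweR.
- by rewrite invr_ge0 ltW.
- by rewrite in_itv/= leey andbT mule_ge0// lee_fin invr_ge0 ltW.
- by rewrite in_itv/= leey andbT lee_fin.
by rewrite lee_pdivrMr// -EFinM; exact: fM.
Qed.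

Lemma morrey_norm_bound f : (mnorm f < +oo)%E -> exists t,
  [/\ 0 <= t, mnorm f = t%:E & morrey_bound f (t `^ p)].
Proof.
move=> ffin.
have key x r : 0 < r -> (((IN (eball x r) (fun y => `|f y| `^ p * w y)%R) /
    (wmeasure w (eball x r) `^ lam)) `^ p^-1 <= mnorm f)%E.
  by move=> r0; apply: ereal_sup_ubound; exists (eball x r) => //; exists x, r.
have n0' : (0 <= mnorm f)%E by apply: le_trans (key 0 1 ltr01); exact: poweR_ge0.
have fE : mnorm f = (fine (mnorm f))%:E by rewrite fineK// ge0_fin_numE.
exists (fine (mnorm f)); split => //; first exact: fine_ge0.
move=> x r r0; have := key x r r0; rewrite fE /=.
have mB := measurable_eball x r.
have W0 := fine_wmeasure_eball_gt0 n0 H x r0.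
rewrite (wmeasure_sub_eball H mB (@subset_refl _ _)) poweR_EFin.
have Wl : 0 < wr w (eball x r) `^ lam by exact: powR_gt0.
have I0 : (0 <= IN (eball x r) (fun y => `|f y| `^ p * w y)%R)%E.
  by apply: EFin_integral_ge0 => y; rewrite mulr_ge0// powR_ge0.
rewrite inver gt_eqF// => h.
rewrite EFinM -lee_pdivrMr// -poweR_EFin.
set a := (_ * _)%E in h *.
have a0 : (0 <= a)%E by rewrite /a mule_ge0// lee_fin invr_ge0 ltW.
have -> : a = ((a `^ p^-1) `^ p)%E by rewrite -poweRrM mulVf ?gt_eqF// poweRe1.
apply: gt0_ler_poweR => //; rewrite ?(ltW pp) ?in_itv/= ?andbT ?leey ?poweR_ge0//.
by rewrite lee_fin fine_ge0.
Qed.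

Lemma morrey_boundD f g Mf Mg : measurable_fun setT f -> measurable_fun setT g ->
  morrey_bound f Mf -> morrey_bound g Mg ->
  morrey_bound (fun x => f x + g x) (2 `^ p * (Mf + Mg)).
Proof.
move=> mf mg fM gM x r r0; have mB := measurable_eball x r.
apply: (@le_trans _ _ (IN (eball x r)
    (fun x => 2 `^ p * (`|f x| `^ p * w x + `|g x| `^ p * w x))%R)).
  apply: EFin_integral_le => //; [by mfun|by mfun|by move=> y; rewrite mulr_ge0// powR_ge0|].
  move=> y _; rewrite -mulrDl mulrA ler_wpM2r//.
  apply: (@le_trans _ _ ((`|f y| + `|g y|) `^ p)); last exact: powR_add_le.
  by apply: ge0_ler_powR; rewrite ?nnegrE ?(ltW pp) ?addr_ge0// ler_normD.
rewrite EFin_integralZ ?powR_ge0//; last 2 first.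
- by mfun.
- by move=> y; rewrite addr_ge0// mulr_ge0// powR_ge0.
rewrite EFin_integralD//; last 4 first.
- by mfun.
- by mfun.
- by move=> y; rewrite mulr_ge0// powR_ge0.
- by move=> y; rewrite mulr_ge0// powR_ge0.
rewrite -mulrA EFinM; apply: lee_wpmul2l; first by rewrite lee_fin powR_ge0.
by rewrite mulrDl EFinD; apply: leeD; [exact: fM|exact: gM].
Qed.

Definition lim_trunc f x := limn (fun k => `|N (trunc f k) x|).

Lemma spaceP f : space mnorm f -> exists t,
  [/\ measurable_fun setT f, 0 <= t, mnorm f = t%:E & morrey_bound f (t `^ p)].
Proof.
by move=> [mf /morrey_norm_bound[t [t0 ft bt]]]; exists t.
Qed.

Lemma space_cvg f x : space mnorm f -> cvgn (fun k => `|N (trunc f k) x|).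
Proof.
by move=> /spaceP[t [mf t0 _ bt]]; apply: Ncvg bt => //; exact: powR_ge0.
Qed.

Lemma spaceD f g : space mnorm f -> space mnorm g -> space mnorm (fun x => f x + g x).
Proof.
move=> /spaceP[t [mf t0 _ bt]] /spaceP[t' [mg t'0 _ bt']].
split; first by mfun.
have M0 : 0 <= 2 `^ p * (t `^ p + t' `^ p).
  by rewrite mulr_ge0 ?addr_ge0 ?powR_ge0.
exact: le_lt_trans (morrey_norm_le M0 (morrey_boundD mf mg bt bt')) (ltry _).
Qed.

Lemma lim_trunc_ge0 f x : space mnorm f -> 0 <= lim_trunc f x.
Proof.
by move=> sf; apply: limr_ge; [exact: space_cvg|exact: nearW].
Qed.

Lemma lim_truncD f g x : space mnorm f -> space mnorm g ->
  lim_trunc (fun y => f y + g y) x <= lim_trunc f x + lim_trunc g x.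
Proof.
move=> sf sg; have [mf _] := sf; have [mg _] := sg.
rewrite /lim_trunc -limD; [|exact: space_cvg|exact: space_cvg].
apply: ler_lim.
- by apply: space_cvg; exact: spaceD.
- by apply: is_cvgD; exact: space_cvg.
apply: nearW => k.
have -> : trunc (fun y => f y + g y) k = (fun y => trunc f k y + trunc g k y).
  by apply/funext => y; rewrite /trunc mulrDl.
by apply: ND; exact: measurable_trunc.
Qed.

Lemma lim_truncZ c f x : space mnorm f ->
  lim_trunc (fun y => c * f y) x = `|c| * lim_trunc f x.
Proof.
move=> sf; have [mf _] := sf.
have e : (fun k => `|N (trunc (fun y => c * f y) k) x|) =
    (fun k => `|c| * `|N (trunc f k) x|).
  apply/funext => k.
  have -> : trunc (fun y => c * f y) k = (fun y => c * trunc f k y).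
    by apply/funext => y; rewrite /trunc mulrA.
  by apply: NZ; exact: measurable_trunc.
rewrite /lim_trunc e; apply/cvg_lim => //; apply: cvgM; first exact: cvg_cst.
exact: space_cvg.
Qed.

Lemma measurable_trunc_op f k : space mnorm f -> measurable_fun setT (N (trunc f k)).
Proof.
move=> /spaceP[t [mf t0 _ bt]]; have [C [C0 hC]] := Nmorrey.
have mt := measurable_trunc k mf.
have k0 : 0 < k%:R + 1 :> R by rewrite ltr_wpDl.
by have [] := hC _ _ _ mt (powR_ge0 t p)
  (morrey_bound_le H mt mf (trunc_le f k) bt) k0 (@trunc_out _ _ f k).
Qed.

Lemma measurable_lim_trunc f : space mnorm f -> measurable_fun setT (lim_trunc f).
Proof.
move=> sf; apply: (@measurable_fun_cvg _ _ _ _ (fun k x => `|N (trunc f k) x|)).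
  by move=> k; mfun; exact: measurable_trunc_op.
by move=> x _; exact: space_cvg.
Qed.

Lemma lim_trunc_bound : exists C, 0 <= C /\ forall f M, space mnorm f -> 0 <= M ->
  morrey_bound f M -> morrey_bound (lim_trunc f) (C * M).
Proof.
have [C [C0 hC]] := Nmorrey; exists C; split => // f M sf M0 fM x r r0.
have [mf _] := sf.
have mB := measurable_eball x r.
have mN k := measurable_trunc_op k sf.
have mL := measurable_lim_trunc sf.
apply: (@fatou_le _ _ _ leb (eball x r) (fun k y => `|N (trunc f k) y| `^ p * w y)) => //.
- by move=> k; mfun.
- by mfun.
- by move=> k y; rewrite mulr_ge0// powR_ge0.
- by move=> y; rewrite mulr_ge0// powR_ge0.
- apply: aeW => y _; apply: cvgM; last exact: cvg_cst.
  rewrite ger0_norm ?lim_trunc_ge0//; apply: cvgn_powR => //.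
  exact: space_cvg.
move=> k; have mt := measurable_trunc k mf.
have k0 : 0 < k%:R + 1 :> R by rewrite ltr_wpDl.
by have [_ h] := hC _ _ _ mt M0
  (morrey_bound_le H mt mf (trunc_le f k) fM) k0 (@trunc_out _ _ f k); exact: h.
Qed.

Lemma dual_weight_gt0 : {ae leb, forall x, 0 < w x}.
Proof.
apply: filterS (dw_ae H) => x h; rewrite lt_neqAle w0 andbT eq_sym.
apply/eqP => wx; move: h; rewrite wx powR0 ?invr_neq0 ?gt_eqF// mul0r => /eqP.
by rewrite eq_sym oner_eq0.
Qed.

Lemma trunc_tail f e : measurable_fun setT f ->
  (IN setT (fun x => `|f x| `^ p * w x)%R < +oo)%E -> 0 < e ->
  exists k, (IN setT (fun x => `|f x - trunc f k x| `^ p * w x)%R <= e%:E)%E.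
Proof.
move=> mf ffin e0.
have mt k := measurable_trunc k mf.
pose F x := `|f x| `^ p * w x.
have F0 x : 0 <= F x by rewrite mulr_ge0// powR_ge0.
have iF : leb.-integrable setT (EFin \o F).
  apply/integrableP; split; first by apply/measurable_EFinP; rewrite /F; mfun.
  by under eq_integral do rewrite /= ger0_norm//.
pose G k x := (`|f x - trunc f k x| `^ p * w x)%:E.
have mG k : measurable_fun setT (G k) by apply/measurable_EFinP; mfun.
have cG : {ae leb, forall x, setT x -> G ^~ x @ \oo --> 0%E}.
  apply: aeW => x _; apply: cvg_near_cst; exists (Num.bound (enorm x)) => // k /= hk.
  rewrite /G trunc_in ?subrr ?normr0 ?powR0 ?gt_eqF// ?mul0r//.
  rewrite eballE sub0r enormN (lt_le_trans (archi_boundP (enorm_ge0 x)))//.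
  by rewrite ler_nat.
have dG : {ae leb, forall x k, setT x -> (`|G k x| <= (EFin \o F) x)%E}.
  apply: aeW => x k _; rewrite /G /= lee_fin ger0_norm ?mulr_ge0 ?powR_ge0//.
  rewrite ler_wpM2r//; apply: ge0_ler_powR; rewrite ?nnegrE ?(ltW pp)//.
  rewrite /trunc indicE; case: (_ \in _); rewrite ?mulr1 ?mulr0 ?subr0//.
  by rewrite subrr normr0.
have [_ _ h] := dominated_convergence measurableT mG (measurable_cst _) cG iF dG.
rewrite integral0 in h.
exact: (cvge0_le h e0).
Qed.

(** The moduli of N f and N (trunc f k) differ by at most |N (f - trunc f k)|, which tends to 0 in
    L^p(w). By Fatou the distance of |N f| from the pointwise limit has norm 0. *)
Lemma lim_trunc_Lp f : space mnorm f ->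
  (IN setT (fun x => `|f x| `^ p * w x)%R < +oo)%E ->
  {ae leb, forall x, `|N f x| = lim_trunc f x}.
Proof.
move=> sf ffin; have [mf _] := sf.
have [C [C0 hC]] := NLp; have [mN _] := hC f mf ffin.
have mL := measurable_lim_trunc sf.
have mNt k := measurable_trunc_op k sf.
have mt k := measurable_trunc k mf.
pose d x := `| `|N f x| - lim_trunc f x | `^ p * w x.
have md : measurable_fun setT d by rewrite /d; mfun.
have d0 x : 0 <= d x by rewrite mulr_ge0// powR_ge0.
have tail_lty k : (IN setT (fun x => `|f x - trunc f k x| `^ p * w x)%R < +oo)%E.
  apply: le_lt_trans ffin; apply: EFin_integral_le => //; [by mfun|by mfun| |].
    by move=> y; rewrite mulr_ge0// powR_ge0.
  move=> y _; rewrite ler_wpM2r//; apply: ge0_ler_powR; rewrite ?nnegrE ?(ltW pp)//.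
  rewrite /trunc indicE; case: (_ \in _); rewrite ?mulr1 ?mulr0 ?subr0//.
  by rewrite subrr normr0.
have small e : 0 < e -> (IN setT d <= (C * e)%:E)%E.
  (* The sequence is shifted by [k0] so that every term, and not only the late ones, obeys the bound
     required by [fatou_le]. *)
  move=> e0; have [k0 hk0] := trunc_tail mf ffin e0.
  apply: (@fatou_le _ _ _ leb setT
    (fun k x => `| `|N f x| - `|N (trunc f (k + k0)) x| | `^ p * w x)) => //.
  - by move=> k; mfun.
  - by move=> k x; rewrite mulr_ge0// powR_ge0.
  - apply: aeW => x _; apply: cvgM; last exact: cvg_cst.
    apply: cvgn_powR => //; apply: cvg_norm; apply: cvgB; first exact: cvg_cst.
    have := @space_cvg f x sf; rewrite -(cvg_shiftn k0); exact.
  move=> k.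
  have mfk : measurable_fun setT (fun y => f y - trunc f (k + k0) y) by mfun.
  have [mNk hk] := hC _ mfk (tail_lty _).
  apply: (@le_trans _ _ (IN setT (fun x => `|N (fun y => f y - trunc f (k + k0) y) x| `^ p * w x)%R)).
    apply: EFin_integral_le => //; [by mfun|by mfun| |].
      by move=> y; rewrite mulr_ge0// powR_ge0.
    move=> y _; rewrite ler_wpM2r//; apply: ge0_ler_powR; rewrite ?nnegrE ?(ltW pp)//.
    exact: Ndist.
  apply: (le_trans hk); rewrite EFinM; apply: lee_wpmul2l; first by rewrite lee_fin.
  apply: le_trans hk0; apply: EFin_integral_le => //; [by mfun|by mfun| |].
    by move=> y; rewrite mulr_ge0// powR_ge0.
  move=> y _; rewrite ler_wpM2r//; apply: ge0_ler_powR; rewrite ?nnegrE ?(ltW pp)//.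
  have [yk|yk] := pselect (eball 0 k0%:R y).
    rewrite [trunc f (k + k0) y]trunc_in ?subrr ?normr0//.
    by apply: eball_le yk; rewrite ler_nat leq_addl.
  rewrite [trunc f k0 y]/trunc indicE (memNset yk) mulr0 subr0.
  rewrite /trunc indicE; case: (_ \in _); rewrite ?mulr1 ?mulr0 ?subr0//.
  by rewrite subrr normr0.
have int0 : IN setT d = 0%E.
  apply/eqP; rewrite eq_le EFin_integral_ge0// andbT; apply/lee_addgt0Pr => e e0.
  have C1 : 0 < C + 1 by rewrite ltr_wpDl.
  rewrite add0e; apply: (le_trans (small _ (divr_gt0 e0 C1))).
  by rewrite lee_fin mulrCA ler_piMr ?(ltW e0)// ler_pdivrMr// mul1r lerDl.
have /ae_eq_integral_abs : measurable_fun setT (EFin \o d) by exact/measurable_EFinP.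
move=> /(_ leb measurableT)[h _].
have {h} : ae_eq leb setT (EFin \o d) (cst 0%E).
  by apply: h; under eq_integral do rewrite /= ger0_norm//.
(* Positivity of w almost everywhere turns the vanishing of the weighted integrand into equality of
   the two functions. *)
move=> h; apply: filterS2 h dual_weight_gt0 => x /(_ Logic.I) /= [] dx wx.
move: dx; rewrite /d => /eqP; rewrite mulf_eq0 (gt_eqF wx) orbF powR_eq0.
by rewrite normr_eq0 subr_eq0 => /andP[/eqP].
Qed.

(* The limit only determines the modulus of the extension; on L^p(w) the sign of
   N f is kept, while |morrey_ext f| = lim_trunc f stays true at every point, so
   that sublinearity holds everywhere and not only almost everywhere. *)
Definition morrey_ext f x :=
  if `[< space (Lp_norm p w) f >] && (`|N f x| == lim_trunc f x)
  then N f x else lim_trunc f x.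

Lemma morrey_ext_norm f x : space mnorm f -> `|morrey_ext f x| = lim_trunc f x.
Proof.
move=> sf; rewrite /morrey_ext; case: ifPn => [/andP[_ /eqP]|_] //.
by rewrite ger0_norm// lim_trunc_ge0.
Qed.

Lemma Lp_space_lty f : space (Lp_norm p w) f ->
  (IN setT (fun x => `|f x| `^ p * w x)%R < +oo)%E.
Proof.
move=> [_]; rewrite /Lp_norm ltNge leye_eq => /negP h.
rewrite ltNge leye_eq; apply/negP => /eqP e; apply: h.
by rewrite e poweRyr// invr_neq0// gt_eqF.
Qed.

Lemma morrey_extension : bounded_on_morrey p lam w N.
Proof.
exists morrey_ext; split.
- split.
    move=> f g x sf sg.
    rewrite (morrey_ext_norm x sf) (morrey_ext_norm x sg).
    rewrite (morrey_ext_norm x (spaceD sf sg)).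
    exact: lim_truncD.
  move=> c f x sf.
  have scf : space mnorm (fun y => c * f y).
    have /spaceP[t [mf t0 _ bt]] := sf; split; first by mfun.
    have M0 : 0 <= `|c| `^ p * t `^ p by rewrite mulr_ge0 ?powR_ge0.
    apply: le_lt_trans (morrey_norm_le M0 _) (ltry _).
    move=> z r r0; apply: (@le_trans _ _ (IN (eball z r)
        (fun y => `|c| `^ p * (`|f y| `^ p * w y))%R)).
      by under eq_integral do rewrite normrM powRM// -mulrA.
    rewrite EFin_integralZ ?powR_ge0//; last 3 first.
    - exact: measurable_eball.
    - by mfun.
    - by move=> y; rewrite mulr_ge0// powR_ge0.
    by rewrite -mulrA EFinM; apply: lee_wpmul2l; rewrite ?lee_fin ?powR_ge0//; exact: bt.
  by rewrite (morrey_ext_norm x sf) (morrey_ext_norm x scf) (lim_truncZ c x sf).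
- move=> f sLp sf; apply: filterS (lim_trunc_Lp sf (Lp_space_lty sLp)) => x h.
  by rewrite /morrey_ext asboolT//= h eqxx.
- move=> f sf; apply: aeW => x; rewrite (morrey_ext_norm x sf); exact: space_cvg.
have [C [C0 hC]] := lim_trunc_bound.
exists (C `^ p^-1) => f sf; split.
  have mL := measurable_lim_trunc sf.
  have [sLp|nLp] := pselect (space (Lp_norm p w) f); last first.
    rewrite (_ : morrey_ext f = lim_trunc f)//.
    by apply/funext => x; rewrite /morrey_ext asboolF.
  have [C' [_ hL]] := NLp; have [mf _] := sf.
  have [mN _] := hL f mf (Lp_space_lty sLp).
  rewrite (_ : morrey_ext f = fun x =>
    if `|N f x| == lim_trunc f x then N f x else lim_trunc f x).
    by apply: measurable_fun_ifT => //; apply: measurable_fun_eqr => //; mfun.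
  by apply/funext => x; rewrite /morrey_ext asboolT.
have [t [mf t0 -> bt]] := spaceP sf.
have tp0 : 0 <= t `^ p by exact: powR_ge0.
have h := hC f _ sf tp0 bt.
have hS : morrey_bound (morrey_ext f) (C * t `^ p).
  move=> x r r0; apply: le_trans (h x r r0).
  under eq_integral => y _ do rewrite (morrey_ext_norm y sf).
  by under [leRHS]eq_integral => y _ do rewrite (ger0_norm (lim_trunc_ge0 y sf)).
apply: (le_trans (morrey_norm_le _ hS)); first exact: mulr_ge0.
by rewrite powRM// -powRrM mulfV ?gt_eqF// powRr1.
Qed.

End morrey_extension.

(** * The operator and its commutator as instances of a kernel operator *)

Section morrey_boundedness.
Context {R : realType} {n : nat}.
Local Notation Rn := 'rV[R]_n.
Local Notation leb := (@lebesgue_rV R n).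
Local Notation IN E f := (\int[leb]_(x in E) (f x)%:E)%E.
Local Notation wr w E := (fine (wmeasure w E)).
Variables (p q K lam : R) (w s : Rn -> R).
Hypothesis n0 : (0 < n)%N.
Hypothesis H : dual_weights p q w s K.
Hypothesis lam01 : 0 < lam < 1.
Variables (T : (Rn -> R) -> (Rn -> R)).
Hypothesis Tsub : sublinear_on measurable_functions T.
Hypothesis Tsize : size_condition T.

Lemma morrey_of_Lp :
  bounded_on (Lp_norm p w) T -> bounded_on_morrey p lam w T.
Proof.
have TE : kernel_op T (fun _ _ => 1) = T.
  apply/funext => f; apply/funext => x; rewrite /kernel_op; congr (T _ x).
  by apply/funext => y; rewrite mul1r.
rewrite -{1}TE => TLp.
have mkap (x : Rn) : measurable_fun setT ((fun _ _ => 1) x : Rn -> R).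
  exact: measurable_cst.
have kap_le (x0 : Rn) r : 0 < r -> exists u v : Rn -> R,
  [/\ measurable_fun setT u /\ (forall x, 0 <= u x),
      measurable_fun setT v /\ (forall x, 0 <= v x),
      forall x y : Rn, `|(fun _ _ => 1) x y| <= u x + v y,
      (IN (eball x0 r) (fun x => u x `^ p * w x)%R <=
         1%:E * wmeasure w (eball x0 r))%E &
      forall j, (IN (eball x0 (2 ^+ j * r)) (fun y => v y `^ q * s y)%R <=
        ((1 * j.+1%:R) `^ q * wr s (eball x0 (2 ^+ j * r)))%:E)%E].
  move=> r0; exists (fun=> 1), (fun=> 1); split.
  - by split=> //; exact: measurable_cst.
  - by split=> //; exact: measurable_cst.
  - by move=> x y; rewrite normr1 lerDl.
  - by under eq_integral do rewrite powR1 mul1r; rewrite mul1e.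
  - move=> j; under eq_integral do rewrite powR1 mul1r.
    have mB := measurable_eball x0 (2 ^+ j * r).
    rewrite -/(wmeasure s _).
    rewrite (wmeasure_sub_eball (dual_weights_sym H) mB (@subset_refl _ _)).
    rewrite lee_fin ler_peMl//; first exact: (fine_wmeasure_ge0 (dual_weights_sym H)).
    have e1 : 1 `^ q = 1 :> R by rewrite powR1.
    rewrite mul1r -[leLHS]e1; apply: ge0_ler_powR; rewrite ?nnegrE ?(ltW (dw_q H))//.
    by rewrite ler1n.
rewrite -TE.
apply: (morrey_extension n0 H).
- by move=> f g x; exact: kernel_opD.
- by move=> c f x; exact: kernel_opZ.
- by move=> f g x; exact: kernel_op_dist.
- exact: (kernel_op_Lp H TLp).
- exact: (kernel_op_morrey n0 H lam01 Tsub Tsize mkap ler01 ler01 kap_le TLp).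
- by move=> f M x; exact: (kernel_op_cvg n0 H lam01 Tsub Tsize mkap ler01 kap_le).
Qed.

(** Both u and v are |b - m|, m being the mean over the ball. John-Nirenberg for (p, w) controls u;
    for (q, s), together with the drift of the means, it controls v on the dilates. *)
Lemma morrey_of_Lp_commutator b : BMO b ->
  bounded_on (Lp_norm p w) (sublinear_commutator T b) ->
  bounded_on_morrey p lam w (sublinear_commutator T b).
Proof.
move=> Hb TLp.
have [[mb _] _] := Hb.
pose kap (x y : Rn) := b x - b y.
have TE : sublinear_commutator T b = kernel_op T kap by [].
rewrite TE in TLp *.
have pp := dw_p H; have qq := dw_q H; have Hs := dual_weights_sym H.
have mkap x : measurable_fun setT (kap x) by rewrite /kap; mfun.
have [Cu [Cu0 hCu]] := john_nirenberg_ball n0 H Hb pp.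
have [Cq [Cq0 hCq]] := john_nirenberg_ball n0 Hs Hb qq.
have [C [C0 hC]] := mean_doubling n0 Hb.
(* [Cq] bounds the oscillation about the mean over the dilate and (j C)^q the drift of that mean;
   both are at most their coefficient times (j + 1)^q, whence the q-th root in [Cv]. *)
pose A := 2 `^ q * (Cq + C `^ q).
have A0 : 0 <= A by rewrite mulr_ge0 ?powR_ge0// addr_ge0// powR_ge0.
pose Cv := A `^ q^-1.
have Cv0 : 0 <= Cv by exact: powR_ge0.
have mw := dw_mw H; have ms := dw_ms H; have s0 := dw_s0 H.
have kap_le (x0 : Rn) r : 0 < r -> exists u v : Rn -> R,
  [/\ measurable_fun setT u /\ (forall x, 0 <= u x),
      measurable_fun setT v /\ (forall x, 0 <= v x),
      forall x y, `|kap x y| <= u x + v y,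
      (IN (eball x0 r) (fun x => u x `^ p * w x)%R <=
         Cu%:E * wmeasure w (eball x0 r))%E &
      forall j, (IN (eball x0 (2 ^+ j * r)) (fun y => v y `^ q * s y)%R <=
        ((Cv * j.+1%:R) `^ q * wr s (eball x0 (2 ^+ j * r)))%:E)%E].
  move=> r0; set m := mean b (eball x0 r).
  exists (fun x => `|b x - m|), (fun x => `|b x - m|); split.
  - by split=> //; mfun.
  - by split=> //; mfun.
  - by move=> x y; rewrite /kap (distrC (b y)); exact: ler_distD.
  - exact: hCu.
  - move=> j; set B := eball x0 (2 ^+ j * r).
    have mB : measurable B by exact: measurable_eball.
    have rj : 0 < 2 ^+ j * r by rewrite mulr_gt0// exprn_gt0.
    have SE := wmeasure_sub_eball Hs mB (@subset_refl _ _).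
    pose mj := mean b B; pose D := (j%:R * C) `^ q.
    have D0 : 0 <= D by exact: powR_ge0.
    have S0 : 0 <= wr s B by exact: (fine_wmeasure_ge0 Hs).
    apply: (@le_trans _ _ (IN B (fun y => 2 `^ q * (`|b y - mj| `^ q * s y + D * s y))%R)).
      apply: EFin_integral_le => //; [by mfun|by mfun|by move=> y; rewrite mulr_ge0// powR_ge0|].
      move=> y _; rewrite -mulrDl mulrA ler_wpM2r//.
      apply: (@le_trans _ _ ((`|b y - mj| + `|mj - m|) `^ q)).
        apply: ge0_ler_powR; rewrite ?nnegrE ?addr_ge0 ?(ltW qq)//.
        exact: ler_distD.
      rewrite (le_trans (powR_add_le _ _ _))// ler_wpM2l ?powR_ge0// lerD2l.
      apply: ge0_ler_powR; rewrite ?nnegrE ?(ltW qq) ?mulr_ge0//.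
      exact: hC.
    rewrite EFin_integralZ ?powR_ge0//; last 2 first.
    - by mfun.
    - by move=> y; rewrite addr_ge0// mulr_ge0// powR_ge0.
    rewrite EFin_integralD//; last 4 first.
    - by mfun.
    - by mfun.
    - by move=> y; rewrite mulr_ge0// powR_ge0.
    - by move=> y; rewrite mulr_ge0.
    rewrite EFin_integralZ// -/(wmeasure s B).
    apply: (@le_trans _ _ ((2 `^ q)%:E * (Cq%:E * wmeasure s B + D%:E * wmeasure s B))%E).
      apply: lee_wpmul2l; first by rewrite lee_fin powR_ge0.
      by apply: leeD => //; exact: hCq.
    rewrite SE -!EFinM lee_fin /= -mulrDl mulrA ler_wpM2r//.
    rewrite powRM// /Cv -powRrM mulVf ?gt_eqF// powRr1// /A -mulrA ler_wpM2l ?powR_ge0//.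
    rewrite mulrDl /D powRM// (mulrC (j%:R `^ q)); apply: lerD.
      rewrite ler_peMr//.
      have e1 : 1 `^ q = 1 :> R by rewrite powR1.
      rewrite -[leLHS]e1; apply: ge0_ler_powR; rewrite ?nnegrE ?(ltW qq)//.
      by rewrite ler1n.
    rewrite ler_wpM2l ?powR_ge0//; apply: ge0_ler_powR; rewrite ?nnegrE ?(ltW qq)//.
    by rewrite ler_nat.
apply: (morrey_extension n0 H).
- by move=> f g x; exact: kernel_opD.
- by move=> c f x; exact: kernel_opZ.
- by move=> f g x; exact: kernel_op_dist.
- exact: (kernel_op_Lp H TLp).
- exact: (kernel_op_morrey n0 H lam01 Tsub Tsize mkap Cu0 Cv0 kap_le TLp).
- by move=> f M x; exact: (kernel_op_cvg n0 H lam01 Tsub Tsize mkap Cv0 kap_le).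
Qed.

(** The two commutators agree on measurable functions, and boundedness evaluates the operator only
    on such functions, truncations included, so the same extension serves. *)
Lemma morrey_of_Lp_linear_commutator b : BMO b -> linear_on measurable_functions T ->
  bounded_on (Lp_norm p w) (commutator T b) ->
  bounded_on_morrey p lam w (commutator T b).
Proof.
move=> Hb Tlin bc; have [[mb _] _] := Hb.
have E (f : Rn -> R) : measurable_fun setT f ->
    sublinear_commutator T b f = commutator T b f.
  by move=> mf; apply/funext => x; exact: sublinear_commutatorE.
have [S [S1 S2 S3 S4]] : bounded_on_morrey p lam w (sublinear_commutator T b).
  apply: (morrey_of_Lp_commutator Hb).
  have [C hC] := bc; exists C => f sf; have [mf _] := sf.
  by rewrite E//; exact: hC.
exists S; split => //.
- by move=> f sf sm; have [mf _] := sf; rewrite -E//; exact: S2.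
- move=> f sm; have [mf _] := sm; apply: filterS (S3 f sm) => x.
  suff -> : (fun k => `|sublinear_commutator T b (trunc f k) x|) =
    (fun k => `|commutator T b (trunc f k) x|) by [].
  by apply/funext => k; rewrite E//; exact: measurable_trunc.
Qed.

End morrey_boundedness.

Theorem theorem1p2 (R : realType) (n : nat) (p lam : R) (w : 'rV[R]_n -> R)
    (T : ('rV[R]_n -> R) -> ('rV[R]_n -> R)) :
  (0 < n)%N -> 1 < p -> 0 < lam < 1 -> Ap p w ->
  sublinear_on measurable_functions T -> size_condition T ->
  (bounded_on (Lp_norm p w) T -> bounded_on_morrey p lam w T) /\
  (forall b : 'rV[R]_n -> R, BMO b ->
     (bounded_on (Lp_norm p w) (sublinear_commutator T b) ->
      bounded_on_morrey p lam w (sublinear_commutator T b)) /\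
     (linear_on measurable_functions T ->
      bounded_on (Lp_norm p w) (commutator T b) ->
      bounded_on_morrey p lam w (commutator T b))).
Proof.
move=> n0 p1 lam01 wAp Tsub Tsize.
have [K H] := Ap_dual_weights n0 p1 wAp.
split; first exact: (morrey_of_Lp n0 H lam01 Tsub Tsize).
move=> b Hb; split; first exact: (morrey_of_Lp_commutator n0 H lam01 Tsub Tsize Hb).
exact: (morrey_of_Lp_linear_commutator n0 H lam01 Tsub Tsize Hb).
Qed.
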